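(* Let $(G,P)$ be a projective Banach Poisson-Lie group with unit $e$, let $\mathfrak{g}=T_eG$ be the Banach Lie algebra of $G$, and let $\Delta$ be the map on $G$ given by $$\Delta(a)=R_{a^{-1}}P_a,\qquad a\in G,$$ which takes values in the Banach space of skew-symmetric elements of $\mathfrak{g}\hat\otimes_\pi\mathfrak{g}$. Then $(\mathfrak{g},T_e\Delta)$ is a projective Banach Lie bialgebra, where $T_e\Delta:\mathfrak{g}\to\mathfrak{g}\hat\otimes_\pi\mathfrak{g}$ is the differential of $\Delta$ at $e$.
   Context: The base field is $\mathbb{K}\in\{\mathbb{R},\mathbb{C}\}$; all Banach manifolds and Banach Lie groups are smooth. $\hat\otimes_\pi$ is the completed projective tensor product. For a Banach space $E$, an element $r\in E\hat\otimes_\pi E$ is skew-symmetric if $\hat\tau(r)=-r$, where $\hat\tau$ continuously extends $x\otimes y\mapsto y\otimes x$. For bounded linear $A,B$, $A\hat\otimes_\pi B$ denotes the continuous extension of $A\otimes B$. For a Banach manifold $M$, $\barwedge^2TM$ is the vector bundle over $M$ whose fiber at $a$ is the Banach space of skew-symmetric elements of $T_aM\hat\otimes_\pi T_aM$. A projective Poisson bivector on $M$ is a smooth section $P$ of $\barwedge^2TM$ such that for all closed local sections $\alpha,\beta,\gamma$ of the cotangent bundle $T^*M$ (fibers are continuous duals), $$\big(\alpha\hat\otimes_\pi d((\beta\hat\otimes_\pi\gamma)(P))\big)(P)+\big(\beta\hat\otimes_\pi d((\gamma\hat\otimes_\pi\alpha)(P))\big)(P)+\big(\gamma\hat\otimes_\pi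 d((\alpha\hat\otimes_\pi\beta)(P))\big)(P)=0,$$ where $(\beta\hat\otimes_\pi\gamma)(P)$ is the local function $a\mapsto(\beta_a\hat\otimes_\pi\gamma_a)(P_a)$ and $d$ is its differential. A projective Banach Poisson manifold is a pair $(M,P)$ with $P$ a projective Poisson bivector on $M$. The product of $(M_1,P')$ and $(M_2,P'')$ is $M_1\times M_2$ with $P_{(a,b)}=P'_a+P''_b$, using $T_{(a,b)}(M_1\times M_2)=T_aM_1\oplus T_bM_2$. A smooth map $F:(M_1,P_1)\to(M_2,P_2)$ is a projective Poisson map if $(T_aF\hat\otimes_\pi T_aF)((P_1)_a)=(P_2)_{F(a)}$ for all $a\in M_1$. A projective Banach Poisson-Lie group is a Banach Lie group $G$ with a projective Banach Poisson manifold structure $(G,P)$ such that the multiplication $m:G\times G\to G$ is a projective Poisson map. $R_b$ denotes right translation by $b$ and also its induced action $TR_b\hat\otimes_\pi TR_b$ on $\barwedge^2TG$. A Banach Lie algebra is a Banach space with a continuous Lie bracket. A projective Banach Lie bialgebra is a pair $(\mathfrak{g},\delta)$ with $\mathfrak{g}$ a Banach Lie algebra and $\delta:\mathfrak{g}\to\mathfrak{g}\hat\otimes_\pi\mathfrak{g}$ a bounded linear operator such that (i) the bilinear map $\mathfrak{g}^*\times\mathfrak{g}^*\to\mathfrak{g}^*$, $(\alpha,\beta)\mapsto\big(x\mapsto(\alpha\hat\otimes_\pi\beta)(\delta(x))\big)$, is a Lie bracket on $\mathfrak{g}^*$; (ii) $\delta([x,y])=\mathrm{ad}_x\delta(y)-\mathrm{ad}_y\delta(x)$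 for all $x,y\in\mathfrak{g}$, where $\mathrm{ad}_x$ on $\mathfrak{g}\hat\otimes_\pi\mathfrak{g}$ continuously extends $u\otimes v\mapsto[x,u]\otimes v+u\otimes[x,v]$. *)

(* Defs.v *)
From HB Require Import structures.
From mathcomp Require Import all_boot all_order all_algebra complex.
From mathcomp Require Import all_classical all_reals all_analysis.
Set Implicit Arguments.
Unset Strict Implicit.
Unset Printing Implicit Defensive.
Import Order.TTheory GRing.Theory Num.Theory.
Import numFieldNormedType.Exports.
Local Open Scope classical_set_scope.
Local Open Scope ring_scope.

Inductive real_or_complex (R : realType) : numFieldType -> Prop :=
| is_real_field : real_or_complex R R
| is_complex_field : real_or_complex R R[i].

HB.instance Definition _ (U V : puniformType) := Uniform.on (U * V)%type.

Lemma prod_complete (U V : completeType) (F : set_system (U * V)) :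
  ProperFilter F -> @cauchy (U*V)%type F -> cvg F.
Proof.
move=> FF Fc.
have F1 : cvg (fst @ F).
  apply: cauchy_cvg => A eA.
  have [[B C] /= [FB FC] BCA] := Fc _ (@prod_entP _ _ A setT eA entourageT).
  exists (fst @` B, fst @` C) => /=.
    by split; [apply: filterS FB|apply: filterS FC] => z Az; exists z.
  by move=> [_ _] /= [[z Bz <-] [t Ct <-]]; have [] := BCA (z, t) (conj Bz Ct).
have F2 : cvg (snd @ F).
  apply: cauchy_cvg => A eA.
  have [[B C] /= [FB FC] BCA] := Fc _ (@prod_entP _ _ setT A entourageT eA).
  exists (snd @` B, snd @` C) => /=.
    by split; [apply: filterS FB|apply: filterS FC] => z Az; exists z.
  by move=> [_ _] /= [[z Bz <-] [t Ct <-]]; have [] := BCA (z, t) (conj Bz Ct).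
apply/cvg_ex; exists (lim (fst @ F), lim (snd @ F)).
rewrite [F in F --> _](_ : F = (fun z : U * V => (z.1, z.2)) @ F); last first.
  by rewrite predeqE => A /=; split; apply: (@filterS _ F) => -[].
exact: cvg_pair.
Qed.
HB.instance Definition _ (U V : completeType) :=
  Uniform_isComplete.Build (U * V)%type (@prod_complete U V).
HB.instance Definition _ (K : numFieldType) (E F : completeNormedModType K) :=
  Complete.on (E * F)%type.

(* A group with a topology; continuity of the operations is a consequence of
   banach_lie_group below. *)
#[short(type="topologicalGroupCarrier")]
HB.structure Definition TopologicalGroupCarrier := {G of Topological G & Group G}.

Section Smooth.
Context (K : numFieldType).

(* C^n on the open set U, by iterated tangent maps (x, h) |-> Df(x)h, with D the
   Frechet derivative: f is C^(n+1) if it is differentiable on U and its tangent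
   map is C^n on U x V.  Asking for the C^1 regularity of the tangent map makes
   x |-> Df(x) continuous for the operator norm, so that smooth_on is the usual
   C^oo, without a type of bounded operators. *)
Fixpoint Ck_on (n : nat) (V W : normedModType K) (U : set V) (f : V -> W) : Prop :=
  if n is m.+1 then
    (forall x, U x -> differentiable f x) /\
    Ck_on m (U `*` [set: V]) (fun p : V * V => 'd f (p.1) p.2)
  else forall x, U x -> {for x, continuous f}.

Definition smooth_on (V W : normedModType K) (U : set V) (f : V -> W) : Prop :=
  forall n, Ck_on n U f.

Lemma near_eq_diff (V W : normedModType K) (f g : V -> W) (x : V) :
  (\near x, f x = g x) -> differentiable f x ->
  differentiable g x /\ 'd g x = 'd f x :> (V -> W).
Proof.
move=> fg dfx.
have fgx : f x = g x by exact: nbhs_singleton fg.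
have cf := diff_continuous dfx.
have E : g \o shift x = cst (g x) + 'd f x +o_ 0 id.
  apply/eqaddoP => e e0.
  have /eqaddoP/(_ e e0) := diff_locally dfx.
  have : \forall y \near 0, f (y + x) = g (y + x).
    by move: fg; rewrite (near_shift 0 x) /=; apply: filterS => y /=; rewrite subr0.
  apply: filterS2 => y fgy /=; rewrite !fctE /= fgy fgx.
  by [].
have D := diff_unique cf E.
split=> //; apply/diff_locallyP; rewrite D; split=> //.
Qed.

Lemma open_setX (V : topologicalType) (W : topologicalType) (A : set V) (B : set W) :
  open A -> open B -> open (A `*` B).
Proof.
rewrite !openE => oA oB [a b] [/= Aa Bb].
by exists (A, B) => //; split; [exact: oA|exact: oB].
Qed.

Lemma Ck_ext n (V W : normedModType K) (U : set V) (f g : V -> W) :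
  open U -> (forall x, U x -> f x = g x) -> Ck_on n U f -> Ck_on n U g.
Proof.
elim: n V W U f g => [|n IHn] V W U f g oU fg /=.
  move=> cf x Ux; have Un : nbhs x U by exact: open_nbhs_nbhs.
  rewrite /prop_for/continuous_at -fg //.
  apply: cvg_trans (cf x Ux); apply: near_eq_cvg.
  by apply: filterS Un => y /fg.
move=> [df Cf].
have nfg x : U x -> \near x, f x = g x.
  by move=> Ux; apply: filterS (open_nbhs_nbhs (conj oU Ux)) => y /fg.
split=> [x Ux|]; first by have [] := near_eq_diff (nfg x Ux) (df x Ux).
apply: IHn Cf; first by apply: open_setX => //; exact: openT.
by move=> [x h] [/= Ux _]; have [_ ->] := near_eq_diff (nfg x Ux) (df x Ux).
Qed.

Lemma Ck_pair n (V W1 W2 : normedModType K) (U : set V) (f : V -> W1) (g : V -> W2) :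
  open U -> Ck_on n U f -> Ck_on n U g -> Ck_on n U (fun x => (f x, g x)).
Proof.
elim: n V W1 W2 U f g => [|n IHn] V W1 W2 U f g oU /=.
  by move=> cf cg x Ux; apply: cvg_pair; [exact: cf|exact: cg].
move=> [df Cf] [dg Cg]; split=> [x Ux|].
  by apply: differentiable_pair; [exact: df|exact: dg].
have oUT : open (U `*` [set: V]) by apply: open_setX => //; exact: openT.
apply: Ck_ext (IHn _ _ _ _ _ _ oUT Cf Cg) => // -[x h] [/= Ux _].
by rewrite (diff_pair (df x Ux) (dg x Ux)).
Qed.

Lemma Ck_comp_linear n (V V' W : normedModType K) (U : set V) (f : V -> W)
    (L : {linear V' -> V}) :
  continuous L -> open U -> Ck_on n U f -> Ck_on n (L @^-1` U) (f \o L).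
Proof.
elim: n V V' W U f L => [|n IHn] V V' W U f L cL oU /=.
  by move=> cf x Ux; apply: continuous_comp; [exact: cL|exact: cf].
move=> [df Cf]; have dL x := linear_differentiable x (cL).
split=> [x Ux|]; first by apply: differentiable_comp => //; exact: df.
have linLL : linear (fun p : V' * V' => (L p.1, L p.2)).
  by move=> a p q /=; rewrite !linearP.
pose LL : {linear (V' * V')%type -> (V * V)%type} :=
  HB.pack (fun p : V' * V' => (L p.1, L p.2)) (GRing.isLinear.Build _ _ _ _ _ linLL).
have cLL : continuous LL.
  move=> p; apply: cvg_pair; apply: continuous_comp.
  - exact: cvg_fst.
  - exact: cL.
  - exact: cvg_snd.
  - exact: cL.
have oUT : open (U `*` [set: V]) by apply: open_setX => //; exact: openT.
have C := IHn _ _ _ _ _ LL cLL oUT Cf.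
apply: Ck_ext C; first by apply: open_comp oUT => p _; exact: cLL.
move=> [x h] [/= Ux _].
by rewrite (diff_comp (dL x) (df _ Ux)) /= diff_lin.
Qed.

Lemma smooth_on_prod (V1 V2 W1 W2 : normedModType K) (U1 : set V1) (U2 : set V2)
    (f : V1 -> W1) (g : V2 -> W2) :
  open U1 -> open U2 -> smooth_on U1 f -> smooth_on U2 g ->
  smooth_on (U1 `*` U2) (fun p => (f p.1, g p.2)).
Proof.
move=> oU1 oU2 sf sg n.
have oU : open (U1 `*` U2) by exact: open_setX.
have sub n' (V W : normedModType K) (A A' : set V) (h : V -> W) :
  A' `<=` A -> Ck_on n' A h -> Ck_on n' A' h.
  elim: n' V W A A' h => [|n' IHn] V W A A' h A'A /=.
    by move=> ch x /A'A; exact: ch.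
  move=> [dh Ch]; split=> [x /A'A|]; first exact: dh.
  by apply: IHn Ch => // -[x k] [/A'A].
apply: Ck_pair => //.
- apply: (@sub _ _ _ (fst @^-1` U1)); first by move=> p [].
  by apply: (@Ck_comp_linear _ _ _ _ _ f fst) => // p; exact: cvg_fst.
- apply: (@sub _ _ _ (snd @^-1` U2)); first by move=> p [].
  by apply: (@Ck_comp_linear _ _ _ _ _ g snd) => // p; exact: cvg_snd.
Qed.
End Smooth.

Section Manifolds.
Context (K : numFieldType).

(* cmap and cinv are total functions, only meaningful on cdom and cmap @` cdom. *)
Record chart (M : topologicalType) (E : normedModType K) := Chart {
  cdom : set M;
  cmap :> M -> E;
  cinv : E -> M;
  cdom_open : open cdom;
  crange_open : open (cmap @` cdom);
  cmapK : forall a, cdom a -> cinv (cmap a) = a;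
  cmap_continuous : forall a, cdom a -> {for a, continuous cmap};
  cinv_continuous : forall u, (cmap @` cdom) u -> {for u, continuous cinv} }.

Definition transition_smooth (M : topologicalType) (E : normedModType K)
    (c d : chart M E) : Prop :=
  smooth_on (c @` (cdom c `&` cdom d)) (d \o cinv c).

Record banachManifold (M : topologicalType) (E : completeNormedModType K) :=
  BanachManifold {
    atlas : set (chart M E);
    chart_at : M -> chart M E;
    manifold_hausdorff : hausdorff_space M;
    chart_at_atlas : forall a, atlas (chart_at a);
    chart_at_dom : forall a, cdom (chart_at a) a;
    atlas_compatible : forall c d, atlas c -> atlas d -> transition_smooth c d }.

Section Product.
Context (M1 M2 : topologicalType).

Section ProductChart.
Context (E1 E2 : normedModType K) (c : chart M1 E1) (d : chart M2 E2).

Let pmap (p : M1 * M2) : E1 * E2 := (c p.1, d p.2).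
Let pinv (q : E1 * E2) : M1 * M2 := (cinv c q.1, cinv d q.2).

Lemma pmap_image (A : set M1) (B : set M2) :
  pmap @` (A `*` B) = (c @` A) `*` (d @` B).
Proof.
apply/seteqP; split=> [_ [[a b] [/= Aa Bb] <-]|[_ _] [/= [a Aa <-] [b Bb <-]]].
  by split=> /=; [exists a|exists b].
by exists (a, b).
Qed.

Lemma prod_chart_range_open : open (pmap @` (cdom c `*` cdom d)).
Proof. by rewrite pmap_image; apply: open_setX; apply: crange_open. Qed.

Lemma prod_chartK p : (cdom c `*` cdom d) p -> pinv (pmap p) = p.
Proof. by case: p => a b [/= ca db]; rewrite /pinv /= !cmapK. Qed.

Lemma prod_chart_continuous p :
  (cdom c `*` cdom d) p -> {for p, continuous pmap}.
Proof.
case: p => a b [/= ca db]; apply: cvg_pair => /=.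
- by apply: (@continuous_comp _ _ _ fst c (a, b)); [exact: cvg_fst|exact: cmap_continuous].
- by apply: (@continuous_comp _ _ _ snd d (a, b)); [exact: cvg_snd|exact: cmap_continuous].
Qed.

Lemma prod_chart_inv_continuous q :
  (pmap @` (cdom c `*` cdom d)) q -> {for q, continuous pinv}.
Proof.
rewrite pmap_image; case: q => u v [/= cu dv]; apply: cvg_pair => /=.
- by apply: (@continuous_comp _ _ _ fst (cinv c) (u, v));
    [exact: cvg_fst|exact: cinv_continuous].
- by apply: (@continuous_comp _ _ _ snd (cinv d) (u, v));
    [exact: cvg_snd|exact: cinv_continuous].
Qed.

Definition prod_chart : chart (M1 * M2)%type (E1 * E2)%type :=
  Chart (open_setX (@cdom_open _ _ c) (@cdom_open _ _ d)) prod_chart_range_open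
    prod_chartK prod_chart_continuous prod_chart_inv_continuous.
End ProductChart.

Context (E1 E2 : completeNormedModType K).
Context (X1 : banachManifold M1 E1) (X2 : banachManifold M2 E2).

Let patlas : set (chart (M1 * M2)%type (E1 * E2)%type) :=
  [set e | exists c d, [/\ atlas X1 c, atlas X2 d & e = prod_chart c d]].
Let pchart_at (p : M1 * M2) := prod_chart (chart_at X1 p.1) (chart_at X2 p.2).

Lemma prod_hausdorff : hausdorff_space (M1 * M2)%type.
Proof.
have H1 := manifold_hausdorff X1; have H2 := manifold_hausdorff X2.
move=> [a b] [a' b'] ab; congr pair.
- apply: H1 => A B Aa Ba'.
  have [||z [[/= Az _] [/= Bz _]]] := ab (A `*` setT) (B `*` setT).
  - by exists (A, setT) => //; split=> //; exact: filterT.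
  - by exists (B, setT) => //; split=> //; exact: filterT.
  - by exists z.1.
- apply: H2 => A B Ab Bb'.
  have [||z [[/= _ Az] [/= _ Bz]]] := ab (setT `*` A) (setT `*` B).
  - by exists (setT, A) => //; split=> //; exact: filterT.
  - by exists (setT, B) => //; split=> //; exact: filterT.
  - by exists z.2.
Qed.

Lemma pchart_at_atlas p : patlas (pchart_at p).
Proof.
exists (chart_at X1 p.1), (chart_at X2 p.2).
by split=> //; exact: chart_at_atlas.
Qed.

Lemma pchart_at_dom p : cdom (pchart_at p) p.
Proof. by split; exact: chart_at_dom. Qed.

Lemma chart_image_open (M : topologicalType) (E : normedModType K)
  (c : chart M E) (A : set M) : open A -> open (c @` (cdom c `&` A)).
Proof.
move=> oA; rewrite openE => _ [a [ca Aa] <-].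
have cra : nbhs (c a) (c @` cdom c).
  by apply: open_nbhs_nbhs; split; [exact: crange_open|exists a].
have := @cinv_continuous _ _ c (c a) (ex_intro2 _ _ a ca erefl) A.
rewrite cmapK // => /(_ (open_nbhs_nbhs (conj oA Aa))) cA.
apply: filterS2 cra cA => _ [b cb <-]; rewrite /= cmapK // => Ab.
by exists b.
Qed.

Lemma patlas_compatible e f : patlas e -> patlas f -> transition_smooth e f.
Proof.
move=> [c [d [Xc Xd ->]]] [c' [d' [Xc' Xd' ->]]].
rewrite /transition_smooth /=.
have -> : cdom c `*` cdom d `&` cdom c' `*` cdom d' =
    (cdom c `&` cdom c') `*` (cdom d `&` cdom d').
  by apply/seteqP; split=> [p [[? ?] [? ?]]|p [[? ?] [? ?]]].
rewrite pmap_image.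
apply: (@smooth_on_prod _ _ _ _ _ _ _ (c' \o cinv c) (d' \o cinv d)).
- by apply: chart_image_open; exact: cdom_open.
- by apply: chart_image_open; exact: cdom_open.
- exact: atlas_compatible Xc Xc'.
- exact: atlas_compatible Xd Xd'.
Qed.

Definition prod_manifold : banachManifold (M1 * M2)%type (E1 * E2)%type :=
  BanachManifold prod_hausdorff pchart_at_atlas pchart_at_dom patlas_compatible.
End Product.

(* T_aM is the model space, identified through the chart chart_at X a;
   tangent_chart X c a is the tangent map at a of another chart c. *)
Definition tangent_chart (M : topologicalType) (E : completeNormedModType K)
    (X : banachManifold M E) (c : chart M E) (a : M) : E -> E :=
  'd (c \o cinv (chart_at X a)) (chart_at X a a).

Definition tangent_chart_inv (M : topologicalType) (E : completeNormedModType K)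
    (X : banachManifold M E) (c : chart M E) (a : M) : E -> E :=
  'd (chart_at X a \o cinv c) (c a).

Definition tangent_map (M N : topologicalType) (E F : completeNormedModType K)
    (X : banachManifold M E) (Y : banachManifold N F) (f : M -> N) (a : M) : E -> F :=
  'd (chart_at Y (f a) \o f \o cinv (chart_at X a)) (chart_at X a a).

Definition smooth_map (M N : topologicalType) (E F : completeNormedModType K)
    (X : banachManifold M E) (Y : banachManifold N F) (f : M -> N) : Prop :=
  continuous f /\
  forall c d, atlas X c -> atlas Y d ->
    smooth_on (c @` (cdom c `&` f @^-1` cdom d)) (d \o f \o cinv c).

Definition differentiable_at (M : topologicalType) (E : completeNormedModType K)
    (X : banachManifold M E) (W : normedModType K) (f : M -> W) (a : M) : Prop :=
  differentiable (f \o cinv (chart_at X a)) (chart_at X a a).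

Definition differential (M : topologicalType) (E : completeNormedModType K)
    (X : banachManifold M E) (W : normedModType K) (f : M -> W) (a : M) : E -> W :=
  'd (f \o cinv (chart_at X a)) (chart_at X a a).

End Manifolds.

Section ProjectiveTensor.
Context (K : numFieldType).

(* A realization of the completed projective tensor product of E and F: a Banach
   space in which the algebraic tensor product embeds (pt_free), as a dense
   subspace (pt_dense), with induced norm
     pi(u) = inf { \sum |x_i| |y_i| : u = \sum x_i (x) y_i }
   (pt_norm_le and pt_norm_inf).  It is unique up to isometric isomorphism. *)
Record projTensor (E F : completeNormedModType K) := ProjTensor {
  pt_space :> completeNormedModType K;
  pt_mul : E -> F -> pt_space;
  pt_bilinear : bilinear_for *:%R *:%R pt_mul;
  pt_free : forall (W : lmodType K) (B : E -> F -> W),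
    bilinear_for *:%R *:%R B ->
    forall s : seq (E * F),
      \sum_(p <- s) pt_mul p.1 p.2 = 0 -> \sum_(p <- s) B p.1 p.2 = 0;
  pt_norm_le : forall s : seq (E * F),
    `|\sum_(p <- s) pt_mul p.1 p.2| <= \sum_(p <- s) `|p.1| * `|p.2|;
  pt_norm_inf : forall (s : seq (E * F)) (e : K), 0 < e ->
    exists t : seq (E * F),
      \sum_(p <- t) pt_mul p.1 p.2 = \sum_(p <- s) pt_mul p.1 p.2 /\
      \sum_(p <- t) `|p.1| * `|p.2| < `|\sum_(p <- s) pt_mul p.1 p.2| + e;
  pt_dense : closure [set \sum_(p <- s) pt_mul p.1 p.2 | s in [set: seq (E * F)]]
    = [set: pt_space] }.

(* The continuous linear L with L (x (x) y) = B x y: it is unique, and exists as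
   soon as B is bilinear and bounded. *)
Definition pt_extend (E F : completeNormedModType K) (T : projTensor E F)
    (W : normedModType K) (B : E -> F -> W) : T -> W :=
  xget (fun=> 0) [set L : T -> W | [/\ linear L, continuous L &
    forall x y, L (pt_mul T x y) = B x y]].

Definition pt_map (E F E' F' : completeNormedModType K)
    (T : projTensor E F) (T' : projTensor E' F') (A : E -> E') (B : F -> F') : T -> T' :=
  pt_extend (fun x y => pt_mul T' (A x) (B y)).

Definition pt_form (E F : completeNormedModType K) (T : projTensor E F)
    (a : E -> K^o) (b : F -> K^o) : T -> K^o :=
  pt_extend (fun x y => a x * b y : K^o).

Definition pt_flip (E : completeNormedModType K) (T : projTensor E E) : T -> T :=
  pt_extend (fun x y => pt_mul T y x).

Definition skew_symmetric (E : completeNormedModType K) (T : projTensor E E) (r : T) :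
  Prop := pt_flip r = - r.

Definition dual (E : completeNormedModType K) : set (E -> K^o) :=
  [set f | linear f /\ continuous f].

End ProjectiveTensor.

Section Poisson.
Context (K : numFieldType).

Section Manifold.
Context (M : topologicalType) (E : completeNormedModType K) (X : banachManifold M E).
Implicit Types (T : projTensor E E) (U : set M) (alpha : M -> E -> K^o).

(* A section of the bundle of skew-symmetric tensors; its smoothness is that of
   its expressions in the bundle charts induced by the charts of M. *)
Definition bivector_field T (P : M -> T) : Prop :=
  (forall a, skew_symmetric (P a)) /\
  forall c, atlas X c ->
    smooth_on (c @` cdom c) (fun u =>
      let a := cinv c u in
      pt_map T (tangent_chart X c a) (tangent_chart X c a) (P a)).

Definition form_coord (c : chart M E) alpha (u k : E) : K^o :=
  alpha (cinv c u) (tangent_chart_inv X c (cinv c u) k).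

(* A local section u |-> alpha_u of the dual bundle is C^oo for the operator norm
   exactly when (u, k) |-> alpha_u(k) is C^oo. *)
Definition local_cotangent_section U alpha : Prop :=
  (forall a, U a -> dual (alpha a)) /\
  forall c, atlas X c ->
    smooth_on ((c @` (cdom c `&` U)) `*` [set: E])
      (fun p : E * E => form_coord c alpha p.1 p.2).

Definition exterior_derivative alpha (a : M) (h k : E) : K^o :=
  let c := chart_at X a in
  'd (form_coord c alpha ^~ k) (c a) h - 'd (form_coord c alpha ^~ h) (c a) k.

Definition closed_local_form U alpha : Prop :=
  local_cotangent_section U alpha /\
  forall a, U a -> forall h k, exterior_derivative alpha a h k = 0.

Definition pairing T (P : M -> T) alpha beta (a : M) : K^o :=
  pt_form (alpha a) (beta a) (P a).

Definition jacobi_term T (P : M -> T) alpha beta gamma (a : M) : K^o :=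
  pairing P alpha (differential X (pairing P beta gamma)) a.

Definition poisson_bivector T (P : M -> T) : Prop :=
  bivector_field P /\
  forall U alpha beta gamma, open U ->
    closed_local_form U alpha -> closed_local_form U beta ->
    closed_local_form U gamma ->
    forall a, U a ->
      jacobi_term P alpha beta gamma a + jacobi_term P beta gamma alpha a +
      jacobi_term P gamma alpha beta a = 0.

End Manifold.

Definition prod_bivector (M1 M2 : topologicalType) (E1 E2 : completeNormedModType K)
    (T1 : projTensor E1 E1) (T2 : projTensor E2 E2)
    (T : projTensor (E1 * E2)%type (E1 * E2)%type)
    (P1 : M1 -> T1) (P2 : M2 -> T2) (p : M1 * M2) : T :=
  let i1 (x : E1) : (E1 * E2)%type := (x, 0) in
  let i2 (y : E2) : (E1 * E2)%type := (0, y) in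
  pt_map T i1 i1 (P1 p.1) + pt_map T i2 i2 (P2 p.2).

Definition poisson_map (M N : topologicalType) (E F : completeNormedModType K)
    (X : banachManifold M E) (Y : banachManifold N F)
    (TM : projTensor E E) (TN : projTensor F F)
    (P : M -> TM) (Q : N -> TN) (f : M -> N) : Prop :=
  smooth_map X Y f /\
  forall a, pt_map TN (tangent_map X Y f a) (tangent_map X Y f a) (P a) = Q (f a).

End Poisson.

Section LieGroup.
Context (K : numFieldType) (E : completeNormedModType K).
Context (G : topologicalGroupCarrier) (X : banachManifold G E).

Definition group_mul (p : G * G) : G := (p.1 * p.2)%g.
Definition group_inv (a : G) : G := (a^-1)%g.

Definition banach_lie_group : Prop :=
  smooth_map (prod_manifold X X) X group_mul /\ smooth_map X X group_inv.

Definition left_invariant_field (x : E) (a : G) : E :=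
  tangent_map X X (fun b => group_mul (a, b)) 1%g x.

(* [V, W] = DW(V) - DV(W) in the chart at a. *)
Definition vector_field_bracket (V W : G -> E) (a : G) : E :=
  let c := chart_at X a in
  let coord (Z : G -> E) (u : E) : E := tangent_chart X c (cinv c u) (Z (cinv c u)) in
  'd (coord W) (c a) (V a) - 'd (coord V) (c a) (W a).

Definition lie_algebra_bracket (x y : E) : E :=
  vector_field_bracket (left_invariant_field x) (left_invariant_field y) 1%g.

Definition right_translate (T : projTensor E E) (b a : G) : T -> T :=
  pt_map T (tangent_map X X (fun g => group_mul (g, b)) a)
           (tangent_map X X (fun g => group_mul (g, b)) a).

(* TT realizes the tensor square of the model of G * G. *)
Definition poisson_lie_group (T : projTensor E E)
    (TT : projTensor (E * E)%type (E * E)%type) (P : G -> T) : Prop :=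
  [/\ banach_lie_group, poisson_bivector X P &
      poisson_map (prod_manifold X X) X (prod_bivector TT P P) P group_mul].

Definition right_trivialization (T : projTensor E E) (P : G -> T) (a : G) : T :=
  right_translate (group_inv a) a (P a).

End LieGroup.

Section LieBialgebra.
Context (K : numFieldType).

(* br restricts to a Lie bracket on the linear subspace S of V. *)
Record lie_bracket_on (V : lmodType K) (S : set V) (br : V -> V -> V) : Prop := {
  lie_closed : forall x y, S x -> S y -> S (br x y);
  lie_linearl : forall (k : K) x y z, S x -> S y -> S z ->
    br (k *: x + y) z = k *: br x z + br y z;
  lie_linearr : forall (k : K) x y z, S x -> S y -> S z ->
    br z (k *: x + y) = k *: br z x + br z y;
  lie_alternating : forall x, S x -> br x x = 0;
  lie_jacobi : forall x y z, S x -> S y -> S z ->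
    br x (br y z) + br y (br z x) + br z (br x y) = 0 }.

Definition banach_lie_bracket (E : completeNormedModType K) (br : E -> E -> E) : Prop :=
  lie_bracket_on [set: E] br /\ continuous (fun p : E * E => br p.1 p.2).

Definition pt_ad (E : completeNormedModType K) (T : projTensor E E)
    (br : E -> E -> E) (x : E) : T -> T :=
  pt_extend (fun u v => pt_mul T (br x u) v + pt_mul T u (br x v)).

Definition dual_bracket (E : completeNormedModType K) (T : projTensor E E)
    (delta : E -> T) (alpha beta : E -> K^o) : E -> K^o :=
  fun x => pt_form alpha beta (delta x).

Record lie_bialgebra (E : completeNormedModType K) (T : projTensor E E)
    (br : E -> E -> E) (delta : E -> T) : Prop := {
  bialgebra_lie : banach_lie_bracket br;
  cobracket_linear : linear delta;
  cobracket_continuous : continuous delta;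
  cobracket_dual : lie_bracket_on (@dual K E) (dual_bracket delta);
  cobracket_cocycle : forall x y,
    delta (br x y) = pt_ad br x (delta y) - pt_ad br y (delta x) }.

End LieBialgebra.

(* Main.v *)
(** Write everything in the chart [c] at the unit [e]: the product becomes a local
    group law [m] and [P] becomes a map [p] into the tensor square. Multiplicativity
    of [P] reads
      [p (m (u, v)) = (D_1 m (u, v))^(x2) (p u) + (D_2 m (u, v))^(x2) (p v)],
    so [p e = 0]. Hence the differential of [Delta] at the unit is [delta = p'(e)],
    whatever the trivialization, and it is skew-symmetric. The Lie bracket of the group is
    [br x y = B x y - B y x] with [B] the mixed second derivative of [m] at [(e, e)].
    - Cocycle: expand [p (m (u, v)) - p (m (v, u))] along [u = e + s x], [v = e + s y]
      up to [o(s^2)], by the formula above and directly.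
    - Jacobi identity for the dual bracket: the forms with constant coefficients in [c]
      are closed by the symmetry of second derivatives. The Jacobi identity of [P] for
      three of them holds near [e]; as [p] vanishes at [e], differentiating it there
      leaves the Jacobi identity for [delta].
    - Jacobi identity for [br]: the bracket of left invariant fields is left invariant,
      by the associativity of [m].
    The completeness of the scalars enters only through the mean value inequality, obtained
    from Cousin's lemma. The tensor square is handled by extending bounded bilinear maps
    by density. *)

Require Import Defs.
From HB Require Import structures.
From mathcomp Require Import all_boot all_order all_algebra complex.
From mathcomp Require Import all_classical all_reals all_analysis.
From mathcomp Require Import ring lra.
Import Order.TTheory GRing.Theory Num.Theory.
Import numFieldNormedType.Exports.
Local Open Scope classical_set_scope.
Local Open Scope ring_scope.

Set Implicit Arguments.
Unset Strict Implicit.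
Unset Printing Implicit Defensive.

(** * Linear identities in a module *)

(** Operators are kept as plain functions, so a product rule for [A_u^(x2) (p u)] would require
    differentiating an operator-valued map. This is avoided in two ways. For the derivative of
    [Delta] and for the dual Jacobi identity, [p u] vanishes at the unit, so continuity of the
    operators in norm is enough. For the cocycle, the operators are expanded to first order only,
    uniformly in their argument; since [p] is O(s) along lines through the unit, the error is still
    o(s^2). The norm estimates rest on one observation: a map that is linear in its second variable
    and differentiable at [(x, 0)] is continuous at [x] for the operator norm. A second obstacle is
    that the tangent space at [a] is the model space read through [chart_at X a], a chart that may
    jump with [a]. Fields are therefore moved to one fixed chart by [tangent_chart] before they are
    differentiated. Finally, [K] may be complex, with a partial order. Positive radii are
    comparable, whence the comparability side conditions on minima. *)

Section LmodExpr.
Context (K : pzRingType) (V : lmodType K).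

Inductive lmod_expr :=
| LmodVar of nat | LmodZero | LmodAdd of lmod_expr & lmod_expr
| LmodOpp of lmod_expr | LmodScale of K & lmod_expr.

Fixpoint lmod_eval (env : seq V) e : V :=
  match e with
  | LmodVar i => nth 0 env i
  | LmodZero => 0
  | LmodAdd a b => lmod_eval env a + lmod_eval env b
  | LmodOpp a => - lmod_eval env a
  | LmodScale k a => k *: lmod_eval env a
  end.

Fixpoint lmod_coef e (i : nat) : K :=
  match e with
  | LmodVar j => if Nat.eqb j i then 1 else 0
  | LmodZero => 0
  | LmodAdd a b => lmod_coef a i + lmod_coef b i
  | LmodOpp a => - lmod_coef a i
  | LmodScale k a => k * lmod_coef a i
  end.

(** A nested conjunction rather than a quantification over indices, so that computation turns it
    into one scalar identity per atom, each left to [ring]. *)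
Fixpoint lmod_coef_eq (n : nat) a b : Prop :=
  if n is m.+1 then lmod_coef a m = lmod_coef b m /\ lmod_coef_eq m a b else True.

Lemma lmod_evalE env e :
  lmod_eval env e = \sum_(i < size env) lmod_coef e i *: nth 0 env i.
Proof.
elim: e => [j||a IHa b IHb|a IHa|k a IHa] /=.
- have [js|sj] := ltnP j (size env).
    rewrite (bigD1 (Ordinal js)) //= PeanoNat.Nat.eqb_refl scale1r big1 ?addr0 // => i ij.
    case: PeanoNat.Nat.eqb_spec => [ji|_]; last by rewrite scale0r.
    by rewrite -val_eqE /= ji eqxx in ij.
  rewrite nth_default // big1 // => i _.
  case: PeanoNat.Nat.eqb_spec => [ji|_]; last by rewrite scale0r.
  by have := leq_trans (ltn_ord i) sj; rewrite ji ltnn.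
- by rewrite big1 // => i _; rewrite scale0r.
- by rewrite IHa IHb -big_split; apply: eq_bigr => i _; rewrite scalerDl.
- by rewrite IHa -sumrN; apply: eq_bigr => i _; rewrite scaleNr.
- by rewrite IHa scaler_sumr; apply: eq_bigr => i _; rewrite scalerA.
Qed.

(** Soundness of the reflection: both sides are combinations of the same atoms, so equal
    coefficients suffice. Distinct atoms are treated as independent. *)
Lemma lmod_eval_eq env a b :
  lmod_coef_eq (size env) a b -> lmod_eval env a = lmod_eval env b.
Proof.
move=> ab; rewrite !lmod_evalE; apply: eq_bigr => i _; congr (_ *: _).
elim: (size env) ab (nat_of_ord i) (ltn_ord i) => [|n IHn] //= [abn ab] j.
by rewrite ltnS leq_eqVlt => /orP[/eqP ->//|]; exact: IHn.
Qed.

End LmodExpr.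

Ltac lmod_lookup_syntactic x env :=
  match env with
  | x :: _ => constr:(0%N)
  | _ :: ?s => let i := lmod_lookup_syntactic x s in constr:(S i)
  end.

Ltac lmod_lookup_conv x env :=
  match env with
  | ?y :: _ => let _ := constr:(erefl x : x = y) in constr:(0%N)
  | _ :: ?s => let i := lmod_lookup_conv x s in constr:(S i)
  end.

Ltac lmod_vars lookup env t :=
  match t with
  | 0%R => env
  | (?a + ?b)%R => let env' := lmod_vars lookup env a in lmod_vars lookup env' b
  | (- ?a)%R => lmod_vars lookup env a
  | (_ *: ?a)%R => lmod_vars lookup env a
  | ?x => match env with
          | _ => let i := lookup x env in env
          | _ => constr:(x :: env)
          end
  end.

Ltac lmod_reify lookup K env t :=
  match t with
  | 0%R => constr:(LmodZero K)
  | (?a + ?b)%R =>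
    let a' := lmod_reify lookup K env a in let b' := lmod_reify lookup K env b in
    constr:(LmodAdd a' b')
  | (- ?a)%R => let a' := lmod_reify lookup K env a in constr:(LmodOpp a')
  | (?k *: ?a)%R => let a' := lmod_reify lookup K env a in constr:(LmodScale (k : K) a')
  | ?x => let i := lookup x env in constr:(LmodVar K i)
  end.

Ltac lmod_with lookup K :=
  match goal with
  | |- @eq ?V ?s ?t =>
    let env := lmod_vars lookup (@nil V) s in
    let env := lmod_vars lookup env t in
    let s' := lmod_reify lookup K env s in
    let t' := lmod_reify lookup K env t in
    refine (@lmod_eval_eq K _ env s' t' _);
    cbn [lmod_coef_eq lmod_coef size Nat.eqb]; repeat split; ring
  end.

(* Atoms that differ only in the inferred structure instances are identified by
   the second, slower attempt. *)
Ltac lmod K :=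
  first [ lmod_with lmod_lookup_syntactic K | lmod_with lmod_lookup_conv K ].
(** * Cousin's lemma and the mean value inequality *)

Section Cousin.
Local Notation cousin K := (forall Q : K -> K -> Prop,
  (forall s t u : K, 0 <= s -> s <= t -> t <= u -> u <= 1 ->
    Q s t -> Q t u -> Q s u) ->
  (forall r : K, 0 <= r <= 1 -> exists2 d : K, 0 < d & forall s : K,
    0 <= s <= 1 -> `|s - r| < d -> (s <= r -> Q s r) /\ (r <= s -> Q r s)) ->
  Q 0 1).

(** Cousin's lemma as an induction on intervals: [Q] is closed under concatenation and holds on all
    short intervals with one end at a given point. The supremum of the [t] with [Q 0 t] is reached,
    and it cannot be below 1. *)
Lemma real_cousin (R : realType) : cousin R.
Proof.
move=> Q Qtrans Qloc; pose S := [set t : R | 0 <= t <= 1 /\ Q 0 t].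
have S0 : S 0.
  have [|d d0 /(_ 0) []] := Qloc 0; rewrite ?lexx ?ler01 ?subrr ?normr0 //.
  by move=> Q00 _; split; [rewrite lexx ler01|exact: Q00].
have supS : has_sup S by split; [exists 0|exists 1 => t [/andP[]]].
set r := sup S; have r0 : 0 <= r by apply: sup_upper_bound.
have r1 : r <= 1 by apply: ge_sup => [|t [/andP[]]//]; exists 0.
have [|d d0 Qd] := Qloc r; first by rewrite r0.
have Q0r : Q 0 r.
  have [t [/andP[t0 t1] Q0t] rdt] := sup_adherent d0 supS.
  have tr : t <= r by apply: sup_upper_bound => //; rewrite /S /= t0.
  apply: Qtrans Q0t _ => //.
  have trd : `|t - r| < d by rewrite ler0_norm; rewrite -/r in rdt; lra.
  by have [|Qtr _] := Qd t _ trd; [rewrite t0|exact: Qtr].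
have [re1|rn1] := eqVneq r 1; first by rewrite -re1.
have lr1 : r < 1 by rewrite lt_neqAle rn1.
(* A point beyond [r], still within the local radius and in the unit interval: it would belong to
   [S]. *)
pose u := Num.min 1 (r + d / 2).
have ru : r < u by rewrite lt_min lr1 /=; lra.
have ud : u <= r + d / 2 by rewrite ge_min lexx orbT.
have u1 : u <= 1 by rewrite ge_min lexx.
have u01 : 0 <= u <= 1 by rewrite u1 andbT; lra.
have [|_ Qru] := Qd u u01; first by rewrite ger0_norm; lra.
have Su : S u by split=> //; apply: Qtrans Q0r (Qru _) => //; exact: ltW.
have := sup_upper_bound supS Su; rewrite -/r; lra.
Qed.

(** Over the complex numbers [0 <= z] forces [z] to be real, so the segment and the radii are those
    of the real case. *)
Lemma cousin_lemma (R : realType) (K : numFieldType) (hK : real_or_complex R K) :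
  cousin K.
Proof.
case: hK; first exact: real_cousin.
move=> Q Qtrans Qloc.
have cK (z : R[i]) : 0 <= z -> z = (complex.Re z)%:C%C.
  by case: z => a b; rewrite lecE /= => /andP[/eqP -> _].
apply: (@real_cousin R (fun s t => Q s%:C%C t%:C%C)).
  by move=> s t u s0 st tu u1; apply: Qtrans; rewrite ?ler0c ?lecR // -[1]/(1%:C)%C lecR.
move=> r /andP[r0 r1]; have [|d d0 Qd] := Qloc r%:C%C.
  by rewrite ler0c r0 -[1]/(1%:C)%C lecR.
exists (complex.Re d); first by move: (d0); rewrite ltcE => /andP[].
move=> s /andP[s0 s1] sd; have [||Q1 Q2] := Qd s%:C%C.
- by rewrite ler0c s0 -[1]/(1%:C)%C lecR.
- by rewrite -rmorphB /= normc_def /= expr0n addr0 sqrtr_sqr (cK d (ltW d0)) ltcR.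
- by split=> ?; [apply: Q1|apply: Q2]; rewrite lecR.
Qed.
End Cousin.

(** * Frechet differentiability in epsilon form *)

Section Calculus.
Context {K : numFieldType}.
Implicit Types V W : normedModType K.

Lemma near_normP V (x : V) (Q : V -> Prop) :
  (\forall u \near x, Q u) <->
  exists2 r : K, 0 < r & forall u, `|u - x| < r -> Q u.
Proof.
split=> [/nbhs_normP[r /= r0 rQ]|[r r0 rQ]].
  by exists r => // u ux; apply: rQ; rewrite /= distrC.
by apply/nbhs_normP; exists r => //= u /=; rewrite distrC; exact: rQ.
Qed.

Lemma near_norm_and V (x : V) (Q1 Q2 : V -> Prop) :
  (\forall u \near x, Q1 u) -> (\forall u \near x, Q2 u) ->
  exists2 r : K, 0 < r & forall u, `|u - x| < r -> Q1 u /\ Q2 u.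
Proof.
move=> q1 q2; apply/(@near_normP _ x (fun u => Q1 u /\ Q2 u)).
exact: filterI q1 q2.
Qed.

Lemma norm_pair_le V W (x : V) (y : W) : `|(x, y)| <= `|x| + `|y|.
Proof.
rewrite prod_normE /= comparable_ge_max; last by rewrite real_comparable.
by rewrite lerDl lerDr !normr_ge0.
Qed.

Lemma linear_bound V W (f : V -> W) : linear f -> continuous f ->
  exists2 C : K, 0 < C & forall x, `|f x| <= C * `|x|.
Proof.
move=> lf cf.
pose g : {linear V -> W} := HB.pack f (GRing.isLinear.Build _ _ _ _ _ lf).
exact: (@linear_lipschitz _ _ _ g).
Qed.

Lemma linear_bound_continuous V W (f : V -> W) (C : K) : linear f ->
  (forall x, `|f x| <= C * `|x|) -> continuous f.
Proof.
move=> lf fC.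
pose g : {linear V -> W} := HB.pack f (GRing.isLinear.Build _ _ _ _ _ lf).
apply: (@bounded_linear_continuous _ _ _ g).
apply/ex_bound; exists `|C|; apply/near_normP; exists 1 => // x.
rewrite subr0 => /ltW x1; apply: le_trans (fC x) _.
rewrite -[leLHS]ger0_norm ?(le_trans _ (fC x))// normrM normr_id.
by rewrite ler_piMr.
Qed.

Lemma linear_sub V W (f g : V -> W) : linear f -> linear g -> linear (f \- g).
Proof. by move=> lf lg a x y /=; rewrite lf lg; lmod K. Qed.

Lemma diff_near V W (f : V -> W) x : differentiable f x -> forall e : K, 0 < e ->
  \forall u \near x, `|f u - f x - 'd f x (u - x)| <= e * `|u - x|.
Proof.
move=> /diff_locally/eqaddoP fE e e0; have := fE e e0.
move=> /near_normP[r r0 rf]; apply/near_normP; exists r => // u ux.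
have := rf (u - x); rewrite subr0 => /(_ ux); rewrite !fctE /= subrK.
by rewrite opprD addrA.
Qed.

Lemma diff_unique_near V W (f L : V -> W) x : linear L -> continuous L ->
  (forall e : K, 0 < e -> \forall u \near x, `|f u - f x - L (u - x)| <= e * `|u - x|) ->
  differentiable f x /\ 'd f x = L :> (V -> W).
Proof.
move=> lL cL fL.
pose g : {linear V -> W} := HB.pack L (GRing.isLinear.Build _ _ _ _ _ lL).
have fE : f \o shift x = cst (f x) + g +o_ 0 id.
  apply/eqaddoP => e e0.
  have /near_normP[r r0 rf] := fL e e0; apply/near_normP; exists r => // h.
  rewrite subr0 => hr; have := rf (h + x); rewrite !fctE /= addrK => /(_ hr).
  by rewrite opprD addrA.
have dE := diff_unique (df := g) cL fE.
by split=> //; apply/diff_locallyP; rewrite dE.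
Qed.

Lemma diff_scale V W (f : V -> W) x a h : 'd f x (a *: h) = a *: 'd f x h.
Proof. exact: linearZ. Qed.

Lemma diff_add V W (f : V -> W) x h k : 'd f x (h + k) = 'd f x h + 'd f x k.
Proof. exact: linearD. Qed.

Lemma linear_differential V W (L : V -> W) x : linear L -> continuous L ->
  differentiable L x /\ 'd L x = L :> (V -> W).
Proof.
move=> lL cL.
pose g : {linear V -> W} := HB.pack L (GRing.isLinear.Build _ _ _ _ _ lL).
by split; [exact: (@linear_differentiable _ _ _ g x cL)|exact: (@diff_lin _ _ _ g x cL)].
Qed.

End Calculus.

Section MeanValue.
Context (R : realType) (K : numFieldType) (hK : real_or_complex R K).
Implicit Types V W : normedModType K.

(** Cousin's lemma for the intervals on which the increment of [f], minus its share of [w], is at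
    most [C + e] times the length. These bounds add up under concatenation, and the slack [e]
    absorbs the error of differentiability at each point. *)
Lemma mean_value V W (f : V -> W) (x k : V) (w : W) (C : K) :
  (forall t : K, 0 <= t <= 1 -> differentiable f (x + t *: k)) ->
  (forall t : K, 0 <= t <= 1 -> `|'d f (x + t *: k) k - w| <= C) ->
  `|f (x + k) - f x - w| <= C.
Proof.
move=> df dfC; apply/ler_addgt0Pr => e e0.
pose Q (s t : K) :=
  `|f (x + t *: k) - f (x + s *: k) - (t - s) *: w| <= (C + e) * (t - s).
suff : Q 0 1 by rewrite /Q subr0 !scale1r mulr1 scale0r addr0.
apply: (cousin_lemma hK (Q := Q)).
  move=> s t u _ _ _ _; rewrite /Q => Qst Qtu.
  have -> : f (x + u *: k) - f (x + s *: k) - (u - s) *: w =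
    (f (x + t *: k) - f (x + s *: k) - (t - s) *: w) +
    (f (x + u *: k) - f (x + t *: k) - (u - t) *: w).
    lmod K.
  rewrite (_ : u - s = (t - s) + (u - t)); last by ring.
  by rewrite mulrDr (le_trans (ler_normD _ _))// lerD.
(* The added 1 keeps the divisor positive when [k = 0]. *)
move=> r r01; have k1 : 0 < `|k| + 1 by rewrite ltr_wpDl.
have /near_normP[d d0 dr] := diff_near (df r r01) (divr_gt0 e0 k1).
exists (d / (`|k| + 1)); first by rewrite divr_gt0.
move=> s s01; rewrite ltr_pdivlMr// => sr.
have xsr : x + s *: k - (x + r *: k) = (s - r) *: k.
  by rewrite opprD addrACA subrr add0r scalerBl.
have /dr : `|x + s *: k - (x + r *: k)| < d.
  rewrite xsr normrZ; apply: le_lt_trans sr.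
  by rewrite ler_wpM2l// lerDl.
rewrite xsr linearZ /= normrZ => frs.
have key : `|f (x + s *: k) - f (x + r *: k) - (s - r) *: w| <= (C + e) * `|s - r|.
  have -> : f (x + s *: k) - f (x + r *: k) - (s - r) *: w =
    (f (x + s *: k) - f (x + r *: k) - (s - r) *: 'd f (x + r *: k) k) +
    (s - r) *: ('d f (x + r *: k) k - w).
    lmod K.
  apply: le_trans (ler_normD _ _) _; rewrite normrZ mulrDl addrC lerD//.
    by rewrite mulrC ler_wpM2r// dfC.
  apply: le_trans frs _; rewrite mulrCA [leRHS]mulrC ler_wpM2l//.
  by rewrite mulrAC ler_pdivrMr// ler_wpM2l ?(ltW e0)// lerDl.
split=> [sr'|rs']; rewrite /Q.
  rewrite [X in _ <= _ * X](_ : r - s = `|s - r|); last first.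
    by rewrite ler0_norm ?opprB ?subr_le0.
  rewrite (_ : f (x + r *: k) - f (x + s *: k) - (r - s) *: w =
    - (f (x + s *: k) - f (x + r *: k) - (s - r) *: w)) ?normrN //.
  lmod K.
by move: key; rewrite ger0_norm ?subr_ge0.
Qed.

End MeanValue.
(** * Second derivatives *)

Section SecondOrder.
Context (R : realType) (K : numFieldType) (hK : real_or_complex R K).
Implicit Types V W : normedModType K.

Lemma segment_ball V (c x k : V) (r t : K) : 0 <= t <= 1 ->
  `|x - c| < r -> `|x + k - c| < r -> `|x + t *: k - c| < r.
Proof.
move=> /andP[t0 t1] xr xkr.
have -> : x + t *: k - c = (1 - t) *: (x - c) + t *: (x + k - c) by lmod K.
apply: le_lt_trans (ler_normD _ _) _; rewrite !normrZ.
rewrite (ger0_norm t0) ger0_norm ?subr_ge0//.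
have -> : r = (1 - t) * r + t * r by ring.
(* The strict inequality comes from the second term, which is absent at [t = 0]. *)
have [->|tn0] := eqVneq t 0; first by rewrite !mul0r subr0 !mul1r !addr0.
rewrite ler_ltD//; first by rewrite ler_wpM2l ?subr_ge0// ltW.
by rewrite ltr_pM2l// lt0r tn0.
Qed.

(** The mean value inequality on the segment from [v] to [u], with [w] the differential at the
    centre. Both points may move, which the cocycle computation requires. *)
Lemma strict_differentiable V W (f : V -> W) (x : V) :
  (\forall u \near x, differentiable f u) ->
  (forall e : K, 0 < e -> \forall u \near x, forall h,
     `|'d f u h - 'd f x h| <= e * `|h|) ->
  forall e : K, 0 < e -> exists2 r : K, 0 < r & forall u v,
    `|u - x| < r -> `|v - x| < r ->
    `|f u - f v - 'd f x (u - v)| <= e * `|u - v|.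
Proof.
move=> df cdf e e0.
have [r r0 rP] := near_norm_and df (cdf e e0).
exists r => // u v ur vr.
have vuv : v + (u - v) = u by rewrite addrC subrK.
rewrite -{1}vuv; apply: (mean_value hK) => t t01.
  by apply: (rP _ _).1; apply: segment_ball; rewrite ?vuv.
by apply: (rP _ _).2; apply: segment_ball; rewrite ?vuv.
Qed.

Lemma diff_translate V W (f : V -> W) (a y : V) : differentiable f (a + y) ->
  differentiable (fun v => f (a + v)) y /\
  'd (fun v => f (a + v)) y = 'd f (a + y) :> (V -> W).
Proof.
move=> df; apply: diff_unique_near; [exact: linearP|exact: diff_continuous|].
move=> e e0; have /near_normP[r r0 rf] := diff_near df e0.
apply/near_normP; exists r => // u uy.
have := rf (a + u); have -> : a + u - (a + y) = u - y by lmod K.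
exact.
Qed.

(** The mean value inequality for [g v = f (x + s h + v) - f (x + v)] along [s k]. The derivative of
    [g] is an increment of [u |-> Df(u)k], which differentiability at [x] controls. *)
Lemma second_difference V W (f : V -> W) (x h k : V) :
  (\forall u \near x, differentiable f u) ->
  differentiable (fun u => 'd f u k) x ->
  forall e : K, 0 < e -> \forall s \near (0 : K),
    `|f (x + s *: h + s *: k) - f (x + s *: h) - (f (x + s *: k) - f x)
      - s ^+ 2 *: 'd (fun u => 'd f u k) x h| <= e * `|s| ^+ 2.
Proof.
move=> df d2f e e0; set L := 'd _ x.
(* [|s| * N] bounds every displacement that occurs, and two remainders share the error: hence
   [e / (2 * N)]. *)
pose N := `|h| + `|k| + 1.
have N0 : 0 < N by rewrite ltr_wpDl ?addr_ge0.
have e'0 : 0 < e / (2 * N) by rewrite divr_gt0 ?mulr_gt0.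
have [r r0 rP] := near_norm_and df (diff_near d2f e'0).
apply/near_normP; exists (r / N); first exact: divr_gt0.
move=> s; rewrite subr0 ltr_pdivlMr// => sN.
have inr a b : 0 <= a <= 1 -> 0 <= b <= 1 ->
  `|x + a *: (s *: h) + b *: (s *: k) - x| <= `|s| * N.
  move=> /andP[a0 a1] /andP[b0 b1].
  have -> : x + a *: (s *: h) + b *: (s *: k) - x = s *: (a *: h + b *: k).
    lmod K.
  rewrite normrZ ler_wpM2l// /N ler_wpDr// (le_trans (ler_normD _ _))//.
  by rewrite !normrZ !ger0_norm// lerD// ler_piMl.
have ab1 : 0 <= (1 : K) <= 1 by rewrite lexx ler01.
have ab0 : 0 <= (0 : K) <= 1 by rewrite lexx ler01.
pose g v := f (x + s *: h + v) - f (x + v).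
have dg t : 0 <= t <= 1 -> differentiable g (0 + t *: (s *: k)) /\
    'd g (0 + t *: (s *: k)) (s *: k) =
    s *: ('d f (x + s *: h + t *: (s *: k)) k - 'd f (x + t *: (s *: k)) k).
  move=> t01; rewrite add0r.
  have d1 : differentiable f (x + s *: h + t *: (s *: k)).
    by apply: (rP _ _).1; rewrite -[s *: h]scale1r (le_lt_trans (inr _ _ _ _)).
  have d2 : differentiable f (x + t *: (s *: k)).
    have := inr 0 t ab0 t01; rewrite scale0r addr0 => xt.
    by apply: (rP _ _).1; rewrite (le_lt_trans xt).
  have [dg1 dg1E] := diff_translate d1.
  have [dg2 dg2E] := diff_translate d2.
  split; first exact: differentiableB.
  have -> : 'd g (t *: (s *: k)) (s *: k) =
      'd (fun v => f (x + s *: h + v)) (t *: (s *: k)) (s *: k) -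
      'd (fun v => f (x + v)) (t *: (s *: k)) (s *: k).
    by rewrite diffB.
  by rewrite dg1E dg2E !diff_scale scalerBr.
have gE : f (x + s *: h + s *: k) - f (x + s *: h) - (f (x + s *: k) - f x) =
    g (0 + s *: k) - g 0.
  by rewrite /g add0r !addr0; lmod K.
rewrite gE; apply: (mean_value hK) => t t01; first by have [] := dg t t01.
have [_ ->] := dg t t01.
have -> : s *: ('d f (x + s *: h + t *: (s *: k)) k - 'd f (x + t *: (s *: k)) k)
    - s ^+ 2 *: L h =
  s *: (('d f (x + s *: h + t *: (s *: k)) k - 'd f x k
         - L (x + s *: h + t *: (s *: k) - x)) -
        ('d f (x + t *: (s *: k)) k - 'd f x k - L (x + t *: (s *: k) - x))).
  have -> : L (x + s *: h + t *: (s *: k) - x) = s *: L h + L (t *: (s *: k)).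
    by rewrite /L -diff_scale -diff_add; congr ('d _ _ _); lmod K.
  have -> : L (x + t *: (s *: k) - x) = L (t *: (s *: k)) by congr (L _); lmod K.
  lmod K.
rewrite normrZ expr2 mulrA [e * _]mulrC -mulrA ler_wpM2l//.
have -> : e * `|s| = e / (2 * N) * (`|s| * N) + e / (2 * N) * (`|s| * N).
  by field; rewrite gt_eqF.
have i1 := inr 1 t ab1 t01; have i2 := inr 0 t ab0 t01.
rewrite scale1r in i1; rewrite scale0r addr0 in i2.
apply: le_trans (ler_normB _ _) _; apply: lerD.
  apply: le_trans ((rP _ _).2) _; first by rewrite (le_lt_trans i1).
  by rewrite ler_wpM2l// ltW.
apply: le_trans ((rP _ _).2) _; first by rewrite (le_lt_trans i2).
by rewrite ler_wpM2l// ltW.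
Qed.

Lemma le_eps_eq0 W (w : W) : (forall e : K, 0 < e -> `|w| <= e) -> w = 0.
Proof.
move=> we; apply/eqP; rewrite -normr_le0; apply/ler_addgt0Pr => e e0.
by rewrite add0r we.
Qed.

Lemma near0_neq0 (Q : K -> Prop) : (\forall s \near (0 : K), Q s) ->
  exists2 s, s != 0 & Q s.
Proof.
move=> /near_normP[r r0 rQ]; exists (r / 2); first by rewrite gt_eqF ?divr_gt0.
by apply: rQ; rewrite subr0 gtr0_norm ?divr_gt0// ltr_pdivrMr// ltr_pMr// ltr1n.
Qed.

(** The second difference is symmetric in [h] and [k], so both derivatives approximate the same
    vector divided by [s^2]; for each [e], one nonzero [s] is enough. *)
Lemma second_diff_sym V W (f : V -> W) (x h k : V) :
  (\forall u \near x, differentiable f u) ->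
  differentiable (fun u => 'd f u h) x ->
  differentiable (fun u => 'd f u k) x ->
  'd (fun u => 'd f u k) x h = 'd (fun u => 'd f u h) x k.
Proof.
move=> df dh dk; apply/subr0_eq/le_eps_eq0 => e e0.
have e20 : 0 < e / 2 by rewrite divr_gt0.
have [s s0 []] := near0_neq0 (filterI (@second_difference _ _ f x h k df dk _ e20)
  (@second_difference _ _ f x k h df dh _ e20)).
set a := f _ - _ - _; set b := f _ - _ - _.
have xE : x + s *: k + s *: h = x + s *: h + s *: k by lmod K.
have -> : b = a by rewrite /b xE /a; lmod K.
move: ('d _ x h) ('d _ x k) => p q ap aq.
have s2 : 0 < `|s| ^+ 2 by rewrite exprn_gt0 // normr_gt0.
rewrite -(ler_pM2r s2) [X in X <= _]mulrC -normrX -normrZ.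
have -> : s ^+ 2 *: (p - q) = (a - s ^+ 2 *: q) - (a - s ^+ 2 *: p) by lmod K.
apply: le_trans (ler_normB _ _) _; rewrite normrX.
by rewrite [X in _ <= X * _]splitr mulrDl lerD.
Qed.

End SecondOrder.

(** * Estimates uniform in a linear variable *)

Section OperatorNorm.
Context (R : realType) (K : numFieldType) (hK : real_or_complex R K).
Implicit Types V W H : normedModType K.

(** By homogeneity it is enough to treat [h] of norm at most [|u - x|]. There [F u h - F x h] is
    compared with the differential [L] at [(x, 0)]; the values of [L] cancel because it is additive
    and [F u 0 = 0]. *)
Lemma op_continuous V H W (F : V -> H -> W) (x : V) :
  (\forall u \near x, linear (F u)) ->
  differentiable (fun p : V * H => F p.1 p.2) (x, 0) ->
  forall e : K, 0 < e -> \forall u \near x, forall h,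
    `|F u h - F x h| <= e * `|h|.
Proof.
move=> linF dF e e0.
(* Three remainders are used, each at a pair of norm at most [2 * |u - x|]. *)
have e40 : 0 < e / 6 by rewrite divr_gt0.
have /near_normP[r1 r10 r1P] := linF.
have /near_normP[r2 r20 r2P] := diff_near dF e40.
set L := 'd _ (x, 0 : H) in r2P *.
have lin0 u : linear (F u) -> F u 0 = 0.
  by move=> lu; have := lu (-1) 0 0; rewrite scaler0 addr0 scaleN1r addNr.
have linZ u a h : linear (F u) -> F u (a *: h) = a *: F u h.
  by move=> lu; have := lu a h 0; rewrite !addr0 lin0// addr0.
have linx : linear (F x) by apply: r1P; rewrite subrr normr0.
pose r := Num.min r1 (r2 / 2).
have r0 : 0 < r.
  by rewrite /r; case: (Num.Theory.real_leP (gtr0_real r10)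
    (gtr0_real (divr_gt0 r20 (ltr0n _ 2)))) => //; rewrite ?divr_gt0.
have rr1 : r <= r1.
  by rewrite comparable_ge_min ?lexx// real_comparable// gtr0_real// divr_gt0.
have rr2 : r <= r2 / 2.
  by rewrite comparable_ge_min ?lexx ?orbT// real_comparable// gtr0_real// divr_gt0.
apply/near_normP; exists r => // u ux h.
have lu : linear (F u) by apply: r1P; exact: lt_le_trans rr1.
have key h' : `|h'| <= `|u - x| -> `|F u h' - F x h'| <= e * `|u - x|.
  move=> h'u.
  have small (a : V) (b : H) : `|a| <= `|u - x| -> `|b| <= `|u - x| ->
      `|F (x + a) b - L (a, b)| <= e / 3 * `|u - x|.
    move=> au bu.
    have abn : `|(a, b)| <= 2 * `|u - x|.
      by apply: le_trans (norm_pair_le _ _) _; rewrite mulr_natl mulr2n lerD.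
    have := r2P (x + a, b); rewrite /= lin0// subr0.
    have -> : (x + a, b) - (x, 0) = (a, b).
      apply: injective_projections; rewrite /= ?subr0 //; lmod K.
    have ab2 : `|(a, b)| < r2.
      apply: le_lt_trans abn _; rewrite mulrC -ltr_pdivlMr//.
      exact: lt_le_trans ux rr2.
    move=> /(_ ab2) /le_trans; apply.
    have -> : e / 3 * `|u - x| = e / 6 * (2 * `|u - x|) by field.
    by rewrite ler_wpM2l// ltW.
  have s1 := small (u - x) h' (lexx _) h'u.
  have s2 := small 0 h'; rewrite normr0 addr0 in s2.
  have {}s2 := s2 (normr_ge0 _) h'u.
  have s3 := small (u - x) 0 (lexx _); rewrite normr0 in s3.
  have {}s3 := s3 (normr_ge0 _).
  have xux : x + (u - x) = u by lmod K.
  rewrite xux in s1 s3; rewrite (lin0 u lu) in s3.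
  have LE : L (u - x, h') = L (u - x, 0) + L (0, h').
    rewrite /L -diff_add; congr ('d _ _ _).
    by apply: injective_projections; rewrite /= ?addr0 ?add0r.
  have -> : F u h' - F x h' =
      (F u h' - L (u - x, h')) - (F x h' - L (0, h')) - (0 - L (u - x, 0)).
    by rewrite LE; lmod K.
  have -> : e * `|u - x| = e / 3 * `|u - x| + e / 3 * `|u - x| + e / 3 * `|u - x|.
    by field.
  apply: le_trans (ler_normB _ _) _; apply: lerD => //.
  by apply: le_trans (ler_normB _ _) _; apply: lerD.
(* The rescaling of [h] to norm [|u - x|] excludes [u = x] and [h = 0]. *)
have [ux0|uxn0] := eqVneq u x.
  by rewrite ux0 subrr normr0 mulr_ge0// ltW.
have [->|hn0] := eqVneq h 0; first by rewrite !lin0// subrr !normr0 mulr0.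
have nu : 0 < `|u - x| by rewrite normr_gt0 subr_eq0.
have nh : 0 < `|h| by rewrite normr_gt0.
have := key ((`|u - x| / `|h|) *: h).
rewrite normrZ ger0_norm ?divr_ge0// divfK ?gt_eqF// lexx => /(_ isT).
rewrite !linZ// -scalerBr normrZ ger0_norm ?divr_ge0//.
by rewrite mulrAC ler_pdivrMr// -mulrA [e * _]mulrCA ler_pM2l.
Qed.

(** The mean value inequality for each [F ^~ h]; the derivative along [y] is again linear in [h], so
    [op_continuous] makes the bound uniform in [h]. *)
Lemma op_first_order V H W (F : V -> H -> W) (x y : V) :
  (\forall u \near x, linear (F u)) ->
  (\forall u \near x, forall h, differentiable (F ^~ h) u) ->
  differentiable (fun p : V * H => 'd (F ^~ p.2) (p.1) y) (x, 0) ->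
  forall e : K, 0 < e -> \forall s \near (0 : K), forall h,
    `|F (x + s *: y) h - F x h - s *: 'd (F ^~ h) x y| <= e * `|s| * `|h|.
Proof.
move=> linF dF dN e e0.
(* [F v] is linear for all [v] close to [u], so linearity in [h] survives differentiation in [u]. *)
have linN : \forall u \near x, linear (fun h => 'd (F ^~ h) u y).
  have := near_join linF; move: dF; apply: filterS2 => u du lu a h h'.
  have E : \forall v \near u, (a *: F ^~ h + F ^~ h') v = F v (a *: h + h').
    by apply: filterS lu => v lv; rewrite lv.
  have dZ := differentiableZ a (du h).
  have [_ ->] := near_eq_diff E (differentiableD dZ (du h')).
  by rewrite diffD// diffZ.
have [r r0 rP] := near_norm_and dF (op_continuous linN dN e0).
have y0 : 0 < `|y| + 1 by rewrite ltr_wpDl.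
apply/near_normP; exists (r / (`|y| + 1)); first exact: divr_gt0.
move=> s; rewrite subr0 ltr_pdivlMr// => sr h.
have tr t : 0 <= t <= 1 -> `|x + t *: (s *: y) - x| < r.
  move=> t01; apply: segment_ball => //; first by rewrite subrr normr0.
  rewrite [x + _]addrC addrK normrZ; apply: le_lt_trans sr.
  by rewrite ler_wpM2l// lerDl.
apply: (mean_value hK (f := F ^~ h)) => t t01; first by have [+ _] := rP _ (tr t t01); apply.
rewrite diff_scale -scalerBr normrZ [e * _]mulrC -mulrA ler_wpM2l//.
by have [_] := rP _ (tr t t01); apply.
Qed.

End OperatorNorm.

(** * Composition of C^n maps *)

Section CkTheory.
Context {K : numFieldType}.
Implicit Types V W : normedModType K.

Lemma Ck_affine n V W (U : set V) (a : W) (L : V -> W) :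
  linear L -> continuous L -> Ck_on n U (fun x => a + L x).
Proof.
elim: n V W U a L => [|n IHn] V W U a L lL cL /=.
  by move=> x _; apply: cvgD; [exact: cvg_cst|exact: cL].
have dL x : differentiable (fun x => a + L x) x /\ 'd (fun x => a + L x) x = L :> (V -> W).
  have [d1 dE] := linear_differential x lL cL.
  have dc : differentiable (cst a : V -> W) x by exact: differentiable_cst.
  split; first exact: (differentiableD dc d1).
  by rewrite (diffD dc d1) diff_cst dE; apply/funext => h; exact: add0r.
split=> [x _|]; first by have [] := dL x.
rewrite (_ : (fun p : V * V => _) = (fun p => 0 + (L \o snd) p)); last first.
  by apply/funext => p; have [_ ->] := dL p.1; rewrite add0r.
apply: IHn; first by move=> k p q /=; rewrite lL.
by move=> p; apply: continuous_comp; [exact: cvg_snd|exact: cL].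
Qed.

Lemma Ck_linear n V W (U : set V) (L : V -> W) :
  linear L -> continuous L -> Ck_on n U L.
Proof.
move=> lL cL; rewrite (_ : L = fun x => 0 + L x); first exact: Ck_affine.
by apply/funext => x; rewrite add0r.
Qed.

Lemma Ck_pred n V W (U : set V) (f : V -> W) : Ck_on n.+1 U f -> Ck_on n U f.
Proof.
elim: n V W U f => [|n IHn] V W U f.
  by move=> [df _] x Ux; exact/differentiable_continuous/df.
by move=> [df Cf]; split=> //; apply: IHn.
Qed.

(** The tangent map is a functor: that of [f \o g] is the tangent map of [f] after that of [g], so
    induction on [n] applies. The base point component [g] is only needed one order lower, whence
    [Ck_pred]. *)
Lemma Ck_comp n V' V W (U : set V) (U' : set V') (f : V -> W) (g : V' -> V) :
  open U -> open U' -> (forall x, U' x -> U (g x)) ->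
  Ck_on n U f -> Ck_on n U' g -> Ck_on n U' (f \o g).
Proof.
elim: n V' V W U U' f g => [|n IHn] V' V W U U' f g oU oU' UU'.
  by move=> cf cg x U'x; apply: continuous_comp; [exact: cg|exact/cf/UU'].
move=> Sf Sg; have [df Cf] := Sf; have [dg Cg] := Sg.
split=> [x U'x|].
  by apply: differentiable_comp; [exact: dg|exact/df/UU'].
have oUT : open (U `*` [set: V]) by apply: open_setX => //; exact: openT.
have oU'T : open (U' `*` [set: V']) by apply: open_setX => //; exact: openT.
apply: (@Ck_ext _ _ _ _ _ ((fun p : V * V => 'd f (p.1) p.2) \o
    (fun p : V' * V' => (g p.1, 'd g (p.1) p.2)))) => //.
  move=> [x h] [/= U'x _].
  by rewrite (diff_comp (dg _ U'x) (df _ (UU' _ U'x))).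
apply: (IHn _ _ _ (U `*` [set: V])) => //; first by move=> [x h] [/= /UU'].
apply: Ck_pair => //.
apply: (IHn _ _ _ U' _ g fst) => //; first by move=> [x h] [].
  exact: Ck_pred.
apply: Ck_linear; first by [].
by move=> p; exact: cvg_fst.
Qed.

End CkTheory.
(** * Bounded bilinear maps on the projective tensor product *)

Section Extension.
Context {K : numFieldType} {E F : completeNormedModType K} (T : projTensor E F).
Implicit Types (W : normedModType K) (s : seq (E * F)).

Lemma pt_mulDl x x' y : pt_mul T (x + x') y = pt_mul T x y + pt_mul T x' y.
Proof. by have := (pt_bilinear T).1 y 1 x x'; rewrite /= !scale1r. Qed.

Lemma pt_mulDr x y y' : pt_mul T x (y + y') = pt_mul T x y + pt_mul T x y'.
Proof. by have := (pt_bilinear T).2 x 1 y y'; rewrite /= !scale1r. Qed.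

Lemma pt_mulZl a x y : pt_mul T (a *: x) y = a *: pt_mul T x y.
Proof.
have m0 : pt_mul T 0 y = 0.
  by apply: (@addrI _ (pt_mul T 0 y)); rewrite -pt_mulDl !addr0.
by have := (pt_bilinear T).1 y a x 0; rewrite /= m0 !addr0.
Qed.

Lemma pt_mulZr a x y : pt_mul T x (a *: y) = a *: pt_mul T x y.
Proof.
have m0 : pt_mul T x 0 = 0.
  by apply: (@addrI _ (pt_mul T x 0)); rewrite -pt_mulDr !addr0.
by have := (pt_bilinear T).2 x a y 0; rewrite /= m0 !addr0.
Qed.

Lemma pt_mulBl x x' y : pt_mul T (x - x') y = pt_mul T x y - pt_mul T x' y.
Proof. by rewrite pt_mulDl -scaleN1r pt_mulZl scaleN1r. Qed.

Lemma pt_mulBr x y y' : pt_mul T x (y - y') = pt_mul T x y - pt_mul T x y'.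
Proof. by rewrite pt_mulDr -[- y']scaleN1r pt_mulZr scaleN1r. Qed.

Lemma pt_mul_norm x y : `|pt_mul T x y| <= `|x| * `|y|.
Proof. by have := pt_norm_le T [:: (x, y)]; rewrite !big_seq1. Qed.

Definition bilinear_sum W (B : E -> F -> W) s := \sum_(p <- s) B p.1 p.2.
Local Notation tsum := (bilinear_sum (pt_mul T)).

(** Finite sequences represent algebraic tensors. Appending [scale_fst (-1) s'] to [s] represents
    the difference of two of them. *)
Definition scale_fst (a : K) s := [seq (a *: p.1, p.2) | p <- s].

Lemma tensor_dense (t : T) (e : K) : 0 < e -> exists s, `|t - tsum s| < e.
Proof.
move=> e0; have : closure [set tsum s | s in setT] t by rewrite pt_dense.
move=> /(_ (ball t e) (nbhsx_ballx _ _ e0)) [_ [[s _ <-]]].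
by rewrite -ball_normE => ?; exists s.
Qed.

Lemma bilinear_sumZ W' (B' : E -> F -> W') (a : K) s : bilinear_for *:%R *:%R B' ->
  bilinear_sum B' (scale_fst a s) = a *: bilinear_sum B' s.
Proof.
move=> bil; rewrite /bilinear_sum big_map scaler_sumr; apply: eq_bigr => p _ /=.
have z0 : B' 0 p.2 = 0.
  have := bil.1 p.2 (-1) 0 0; rewrite /= scaler0 addr0 => {1}->.
  by rewrite scaleN1r addNr.
by have := bil.1 p.2 a p.1 0; rewrite /= z0 !addr0.
Qed.

Lemma bilinear_sum_cat W' (B' : E -> F -> W') s s' :
  bilinear_sum B' (s ++ s') = bilinear_sum B' s + bilinear_sum B' s'.
Proof. exact: big_cat. Qed.

Section Bilinear.
Context W (B : E -> F -> W) (C : K).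
Context (bilB : bilinear_for *:%R *:%R B) (C0 : 0 <= C).
Context (boundB : forall x y, `|B x y| <= C * (`|x| * `|y|)).

(** By [pt_free], the sum of [B] depends only on the tensor and not on the sequence, so [s] may be
    replaced by a sequence that is nearly optimal for the projective norm. *)
Lemma bilinear_sum_bound s : `|bilinear_sum B s| <= C * `|tsum s|.
Proof.
apply/ler_addgt0Pr => e e0.
have C1 : 0 < C + 1 by rewrite ltr_wpDl.
have [t [ts tn]] := pt_norm_inf T s (divr_gt0 e0 C1).
have -> : bilinear_sum B s = bilinear_sum B t.
  have := @pt_free _ _ _ T _ _ bilB (t ++ scale_fst (-1) s).
  rewrite -!/(bilinear_sum _ _) !bilinear_sum_cat !bilinear_sumZ//; last exact: pt_bilinear.
  rewrite {1}/bilinear_sum ts -/(bilinear_sum _ _) !scaleN1r subrr => /(_ erefl) tsB.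
  by apply/esym/subr0_eq.
apply: (@le_trans _ _ (C * \sum_(p <- t) `|p.1| * `|p.2|)).
  rewrite mulr_sumr /bilinear_sum; apply: le_trans (ler_norm_sum _ _ _) _.
  by apply: ler_sum => p _.
apply: (@le_trans _ _ (C * (`|tsum s| + e / (C + 1)))).
  by rewrite ler_wpM2l// ltW.
rewrite mulrDr lerD2l mulrCA -{2}[e]mulr1 ler_wpM2l// ?ltW//.
by rewrite ltr_pdivrMr// mul1r ltrDl.
Qed.

Lemma bilinear_sum_boundB s s' : `|bilinear_sum B s - bilinear_sum B s'| <= C * `|tsum s - tsum s'|.
Proof.
have := bilinear_sum_bound (s ++ scale_fst (-1) s').
by rewrite !bilinear_sum_cat !bilinear_sumZ ?scaleN1r//; exact: pt_bilinear.
Qed.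

(** Continuity gives some bound [M]. Approximating [t] by finite sums makes the part controlled by
    [M] negligible and leaves the constant [C]. *)
Lemma pt_bound_of_bilinear (L : T -> W) : linear L -> continuous L ->
  (forall x y, L (pt_mul T x y) = B x y) -> forall t, `|L t| <= C * `|t|.
Proof.
move=> lL cL LB t; have [M M0 LM] := linear_bound lL cL.
pose g : {linear T -> W} := HB.pack L (GRing.isLinear.Build _ _ _ _ _ lL).
have Ls s : L (tsum s) = bilinear_sum B s.
  by rewrite -[L]/(g : _ -> _) raddf_sum; apply: eq_bigr => p _; exact: LB.
apply/ler_addgt0Pr => e e0.
have MC0 : 0 < M + C by rewrite ltr_wpDr.
have [s ts] := tensor_dense t (divr_gt0 e0 MC0).
have -> : L t = L (t - tsum s) + bilinear_sum B s.
  by rewrite -Ls -[L]/(g : _ -> _) -raddfD subrK.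
apply: (@le_trans _ _ (M * `|t - tsum s| + C * (`|t| + `|t - tsum s|))).
  apply: le_trans (ler_normD _ _) _; apply: lerD => //.
  apply: le_trans (bilinear_sum_bound s) _; rewrite ler_wpM2l//.
  have {1}-> : tsum s = t - (t - tsum s) by lmod K.
  exact: ler_normB.
have -> : M * `|t - tsum s| + C * (`|t| + `|t - tsum s|) =
  C * `|t| + (M + C) * `|t - tsum s| by ring.
by rewrite lerD2l mulrC -ler_pdivlMr// ltW.
Qed.

End Bilinear.

(** The value at [t] is the limit of the sums of [B] over sequences whose tensors approach [t]. The
    estimate [|L t - B(s)| <= C |t - s|], valid for every sequence [s], then yields linearity,
    continuity and the values on elementary tensors. *)
Lemma pt_extension_exists (W : completeNormedModType K) (B : E -> F -> W) (C : K) :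
  bilinear_for *:%R *:%R B -> 0 <= C ->
  (forall x y, `|B x y| <= C * (`|x| * `|y|)) ->
  exists L : T -> W, [/\ linear L, continuous L &
    forall x y, L (pt_mul T x y) = B x y].
Proof.
move=> bilB C0 boundB.
have bndB s s' : `|bilinear_sum B s - bilinear_sum B s'| <= C * `|tsum s - tsum s'|.
  exact: (bilinear_sum_boundB bilB C0 boundB).
have ext t : exists l, forall s, `|l - bilinear_sum B s| <= C * `|t - tsum s|.
  (* The filter of the values of [B] on better and better approximations of [t]; it is Cauchy by
     [bndB], and [W] is complete. *)
  pose G := filter_from [set e : K | 0 < e]
    (fun e => [set bilinear_sum B s | s in [set s | `|t - tsum s| < e]]).
  have GF : ProperFilter G.
    apply: filter_from_proper.
      apply: filter_from_filter; first by exists 1 => /=.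
      move=> i j i0 j0; exists (Num.min i j).
        rewrite /= /Num.min; by case: ifP.
      have ij : (i >=< j)%R by rewrite real_comparable// gtr0_real.
      move=> _ [s /= + <-]; rewrite comparable_lt_min// => /andP[si sj].
      by split; exists s.
    by move=> e e0; have [s ts] := tensor_dense t e0; exists (bilinear_sum B s), s.
  have GC : cauchy G.
    apply/cauchy_ballP => e e0.
    have C1 : 0 < 2 * (C + 1) by rewrite mulr_gt0// ltr_wpDl.
    pose d := e / (2 * (C + 1)); have d0 : 0 < d by exact: divr_gt0.
    pose A := [set bilinear_sum B s | s in [set s | `|t - tsum s| < d]].
    exists (A, A); first by split; exists d.
    move=> [_ _] [/= [s ts <-] [s' ts' <-]] /=; rewrite /= in ts ts'.
    rewrite -ball_normE /=; apply: le_lt_trans (bndB s s') _.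
    have tss : `|tsum s - tsum s'| < d + d.
      have -> : tsum s - tsum s' = (t - tsum s') - (t - tsum s) by lmod K.
      by apply: le_lt_trans (ler_normB _ _) _; rewrite ltrD.
    apply: (@le_lt_trans _ _ (C * (d + d))); first by rewrite ler_wpM2l// ltW.
    have -> : e = (C + 1) * (d + d).
      by rewrite /d; field; rewrite gt_eqF// ltr_wpDl.
    by rewrite ltr_pM2r ?addr_gt0// ltrDl.
  have /cvg_ex[l Gl] := @cauchy_cvg _ G GF GC.
  exists l => s; apply/ler_addgt0Pr => e e0.
  have C1 : 0 < C + 1 by rewrite ltr_wpDl.
  pose d := e / (C + 1); have d0 : 0 < d by exact: divr_gt0.
  have : G (ball l d) by apply: Gl; exact: nbhsx_ballx.
  move=> [r r0 rl].
  have [s' ts'r ts'd] : exists2 s', `|t - tsum s'| < r & `|t - tsum s'| < d.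
    have rd0 : 0 < Num.min r d by rewrite /Num.min; case: ifP.
    have [s' ] := tensor_dense t rd0; rewrite comparable_lt_min.
      by move=> /andP[? ?]; exists s'.
    by rewrite real_comparable// gtr0_real.
  have : ball l d (bilinear_sum B s') by apply: rl; exists s'.
  rewrite -ball_normE /= => ls'.
  have -> : l - bilinear_sum B s = (l - bilinear_sum B s') + (bilinear_sum B s' - bilinear_sum B s) by lmod K.
  apply: (@le_trans _ _ (d + C * (d + `|t - tsum s|))).
    apply: le_trans (ler_normD _ _) _; apply: lerD; first exact: ltW.
    apply: le_trans (bndB s' s) _; rewrite ler_wpM2l//.
    have -> : tsum s' - tsum s = - (t - tsum s') + (t - tsum s) by lmod K.
    by apply: le_trans (ler_normD _ _) _; rewrite normrN lerD2r ltW.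
  have -> : d + C * (d + `|t - tsum s|) = C * `|t - tsum s| + (C + 1) * d by ring.
  by rewrite lerD2l /d mulrC divfK// gt_eqF.
have [L LP] := choice ext.
have lL : linear L.
  move=> a t t'; apply/subr0_eq/le_eps_eq0 => e e0.
  (* The approximations at [a *: t + t'] and at [t], [t'] each cost [C * (|a| + 1)] times [e / N];
     the final 1 keeps [N] positive. *)
  pose N := 2 * C * (`|a| + 1) + 1.
  have N0 : 0 < N by rewrite ltr_wpDl// !mulr_ge0// addr_ge0.
  have [s ts] := tensor_dense t (divr_gt0 e0 N0).
  have [s' ts'] := tensor_dense t' (divr_gt0 e0 N0).
  have := LP (a *: t + t') (scale_fst a s ++ s').
  rewrite !bilinear_sum_cat !bilinear_sumZ//; last exact: pt_bilinear.
  move=> Latt.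
  have -> : L (a *: t + t') - (a *: L t + L t') =
    (L (a *: t + t') - (a *: bilinear_sum B s + bilinear_sum B s')) -
    (a *: (L t - bilinear_sum B s) + (L t' - bilinear_sum B s')) by lmod K.
  set d := e / N in ts ts'.
  apply: (@le_trans _ _ (C * (`|a| * d + d) + (`|a| * (C * d) + C * d))).
    apply: le_trans (ler_normB _ _) _; apply: lerD.
      apply: le_trans Latt _; rewrite ler_wpM2l//.
      have -> : a *: t + t' - (a *: tsum s + tsum s') =
        a *: (t - tsum s) + (t' - tsum s') by lmod K.
      apply: le_trans (ler_normD _ _) _; rewrite normrZ.
      by apply: lerD; [rewrite ler_wpM2l// ltW|exact: ltW].
    apply: le_trans (ler_normD _ _) _; rewrite normrZ; apply: lerD.
      rewrite ler_wpM2l//; apply: le_trans (LP _ _) _.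
      by rewrite ler_wpM2l// ltW.
    by apply: le_trans (LP _ _) _; rewrite ler_wpM2l// ltW.
  have -> : e = N * d by rewrite /d mulrC divfK// gt_eqF.
  have d0 : 0 < d by rewrite divr_gt0.
  have -> : C * (`|a| * d + d) + (`|a| * (C * d) + C * d) = (N - 1) * d.
    by rewrite /N; ring.
  by rewrite ler_pM2r// gerBl.
exists L; split=> //.
  (* The empty sequence in the estimate gives [|L t| <= C |t|]; the one-term sequence below gives
     the value on an elementary tensor. *)
  apply: (@linear_bound_continuous _ _ _ L C lL) => t.
  by have := LP t [::]; rewrite /bilinear_sum !big_nil !subr0.
move=> x y; apply/subr0_eq/eqP; rewrite -normr_le0.
have := LP (pt_mul T x y) [:: (x, y)].
by rewrite /bilinear_sum !big_seq1 subrr normr0 mulr0.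
Qed.

(** [pt_extend] is a choice with default 0, so nothing is known about it until some extension has
    been exhibited. *)
Lemma pt_extend_spec W (B : E -> F -> W) :
  (exists L : T -> W, [/\ linear L, continuous L &
    forall x y, L (pt_mul T x y) = B x y]) ->
  [/\ linear (pt_extend (T := T) B), continuous (pt_extend (T := T) B) &
    forall x y, pt_extend B (pt_mul T x y) = B x y].
Proof.
move=> exL; exact: (@xgetPex _ (fun=> 0) [set L : T -> W | [/\ linear L, continuous L &
  forall x y, L (pt_mul T x y) = B x y]] exL).
Qed.

Lemma pt_extendP (W : completeNormedModType K) (B : E -> F -> W) (C : K) :
  bilinear_for *:%R *:%R B -> 0 <= C ->
  (forall x y, `|B x y| <= C * (`|x| * `|y|)) ->
  [/\ linear (pt_extend (T := T) B), continuous (pt_extend (T := T) B) &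
    forall x y, pt_extend B (pt_mul T x y) = B x y].
Proof.
by move=> bB C0 BC; apply: pt_extend_spec; exact: pt_extension_exists bB C0 BC.
Qed.

Lemma pt_bound W (L : T -> W) (C : K) : linear L -> continuous L -> 0 <= C ->
  (forall x y, `|L (pt_mul T x y)| <= C * (`|x| * `|y|)) ->
  forall t, `|L t| <= C * `|t|.
Proof.
move=> lL cL C0 LC.
apply: (@pt_bound_of_bilinear W (fun x y => L (pt_mul T x y)) C) => //.
split=> [y a x x'|x a y y'] /=.
  by rewrite pt_mulDl pt_mulZl lL.
by rewrite pt_mulDr pt_mulZr lL.
Qed.

(** The difference vanishes on elementary tensors, hence is bounded with constant 0. *)
Lemma pt_unique W (L L' : T -> W) : linear L -> continuous L ->
  linear L' -> continuous L' ->
  (forall x y, L (pt_mul T x y) = L' (pt_mul T x y)) -> L = L'.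
Proof.
move=> lL cL lL' cL' LL'; apply/funext => t; apply/subr0_eq/eqP.
rewrite -normr_le0 -(mul0r `|t|); apply: (@pt_bound W (L \- L')) => //.
- exact: linear_sub.
- by move=> x; apply: cvgB; [exact: cL|exact: cL'].
- by move=> x y /=; rewrite LL' subrr normr0 mul0r.
Qed.

End Extension.

(** * Tensor products of bounded operators and functionals *)

Section TensorMaps.
Context {K : numFieldType}.
Implicit Types E F : completeNormedModType K.

(** A predicate on bare functions, so that differentials, partial maps and composites are treated
    alike. For scalar values it is convertible to membership in [dual]. *)
Definition blin (V W : normedModType K) (f : V -> W) := linear f /\ continuous f.

Lemma blin_diff (V W : normedModType K) (f : V -> W) x :
  differentiable f x -> blin ('d f x : V -> W).
Proof. by move=> df; split; [exact: linearP|exact: diff_continuous]. Qed.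

Lemma blin_comp (V W Z : normedModType K) (g : W -> Z) (f : V -> W) :
  blin g -> blin f -> blin (g \o f).
Proof.
move=> [lg cg] [lf cf]; split; first by move=> a x y /=; rewrite lf lg.
by move=> x; apply: continuous_comp; [exact: cf|exact: cg].
Qed.

Lemma blin_id (V : normedModType K) : blin (@id V).
Proof. by split=> // x; exact: cvg_id. Qed.

Lemma blin_bound (V W : normedModType K) (f : V -> W) : blin f ->
  exists2 C : K, 0 < C & forall x, `|f x| <= C * `|x|.
Proof. by move=> [lf cf]; exact: linear_bound. Qed.

Lemma blinD (V W : normedModType K) (f g : V -> W) :
  blin f -> blin g -> blin (fun x => f x + g x).
Proof.
move=> [lf cf] [lg cg]; split; first by move=> a x y; rewrite lf lg; lmod K.
by move=> x; apply: cvgD; [exact: cf|exact: cg].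
Qed.

Lemma blinZ (V W : normedModType K) (k : K) (f : V -> W) :
  blin f -> blin (fun x => k *: f x).
Proof.
move=> [lf cf]; split; first by move=> a x y; rewrite lf; lmod K.
by move=> x; apply: cvgZ; [exact: cvg_cst|exact: cf].
Qed.

Lemma blinB (V W : normedModType K) (f g : V -> W) :
  blin f -> blin g -> blin (fun x => f x - g x).
Proof.
move=> bf bg; have := blinD bf (blinZ (-1) bg).
by congr blin; apply/funext => x; rewrite scaleN1r.
Qed.

Lemma lin0 (V W : normedModType K) (f : V -> W) : linear f -> f 0 = 0.
Proof. by move=> lf; have := lf (-1) 0 0; rewrite scaler0 addr0 scaleN1r addNr. Qed.

Lemma linZ (V W : normedModType K) (f : V -> W) : linear f ->
  forall a x, f (a *: x) = a *: f x.
Proof. by move=> lf a x; have := lf a x 0; rewrite !addr0 lin0// addr0. Qed.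

Lemma linD (V W : normedModType K) (f : V -> W) : linear f ->
  forall x y, f (x + y) = f x + f y.
Proof. by move=> lf x y; have := lf 1 x y; rewrite !scale1r. Qed.

Lemma linB (V W : normedModType K) (f : V -> W) : linear f ->
  forall x y, f (x - y) = f x - f y.
Proof. by move=> lf x y; rewrite linD// -scaleN1r linZ// scaleN1r. Qed.

Lemma pt_blin_unique E F (T : projTensor E F) (W : normedModType K) (L L' : T -> W) :
  blin L -> blin L' -> (forall x y, L (pt_mul T x y) = L' (pt_mul T x y)) -> L = L'.
Proof. by move=> [? ?] [? ?]; exact: pt_unique. Qed.

Lemma pt_blin_bound E F (T : projTensor E F) (W : normedModType K) (L : T -> W) (C : K) :
  blin L -> 0 <= C -> (forall x y, `|L (pt_mul T x y)| <= C * (`|x| * `|y|)) ->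
  forall t, `|L t| <= C * `|t|.
Proof. by move=> [? ?]; exact: pt_bound. Qed.

Section Map.
Context E F E' F' (T : projTensor E F) (T' : projTensor E' F').

Lemma pt_map_spec (A : E -> E') (B : F -> F') : blin A -> blin B ->
  blin (pt_map (T := T) T' A B) /\
  forall x y, pt_map (T := T) T' A B (pt_mul T x y) = pt_mul T' (A x) (B y).
Proof.
move=> bA bB; have [a a0 Aa] := blin_bound bA; have [b b0 Bb] := blin_bound bB.
have ab0 : 0 <= a * b by rewrite mulr_ge0// ltW.
have [||? ? ?] := @pt_extendP _ _ _ T T' (fun x y => pt_mul T' (A x) (B y)) _ _ ab0.
- split=> [y k x x'|x k y y'] /=.
    by rewrite bA.1 pt_mulDl pt_mulZl.
  by rewrite bB.1 pt_mulDr pt_mulZr.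
- move=> x y; apply: le_trans (pt_mul_norm _ _ _) _.
  have -> : a * b * (`|x| * `|y|) = (a * `|x|) * (b * `|y|) by ring.
  exact: ler_pM.
- by [].
Qed.

End Map.

Lemma pt_map_comp E F E' F' E'' F'' (T : projTensor E F) (T' : projTensor E' F')
    (T'' : projTensor E'' F'') (A : E -> E') (B : F -> F') (A' : E' -> E'')
    (B' : F' -> F'') t : blin A -> blin B -> blin A' -> blin B' ->
  pt_map (T := T') T'' A' B' (pt_map (T := T) T' A B t) =
  pt_map (T := T) T'' (A' \o A) (B' \o B) t.
Proof.
move=> bA bB bA' bB'; have [M M1] := pt_map_spec T T' bA bB.
have [M' M'1] := pt_map_spec T' T'' bA' bB'.
have [M'' M''1] := pt_map_spec T T'' (blin_comp bA' bA) (blin_comp bB' bB).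
rewrite -[LHS]/((pt_map (T := T') T'' A' B' \o pt_map (T := T) T' A B) t).
congr (_ t); apply: pt_blin_unique => //; first exact: blin_comp.
by move=> x y; rewrite M''1 /= M1 M'1.
Qed.

Lemma pt_map_id E F (T : projTensor E F) t : pt_map (T := T) T id id t = t.
Proof.
have [M M1] := pt_map_spec T T (@blin_id E) (@blin_id F).
rewrite -[RHS]/(id t); congr (_ t); apply: pt_blin_unique => //; exact: blin_id.
Qed.

Section Form.
Context E F (T : projTensor E F).

(* K is not assumed complete, so the functional is obtained by composing alpha
   with a map into E. *)
Lemma pt_form_spec (alpha : E -> K^o) (beta : F -> K^o) : blin alpha -> blin beta ->
  blin (pt_form alpha beta : T -> K^o) /\
  forall x y, pt_form alpha beta (pt_mul T x y) = alpha x * beta y.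
Proof.
move=> ba bb.
suff : exists L : T -> K^o, [/\ linear L, continuous L &
    forall x y, L (pt_mul T x y) = alpha x * beta y].
  by move=> /(@pt_extend_spec _ _ _ T _ (fun x y => alpha x * beta y : K^o)) [].
have [[x0 ax0]|a0] := pselect (exists x, alpha x <> 0); last first.
  exists (fun=> 0); split.
  - by move=> a x y; rewrite scaler0 addr0.
  - by move=> x; exact: cvg_cst.
  - move=> x y; have -> : alpha x = 0.
      by apply: contrapT => ax; apply: a0; exists x.
    by rewrite mul0r.
have [a a0 Aa] := blin_bound ba; have [b b0 Bb] := blin_bound bb.
have C0 : 0 <= a * b * `|x0| by rewrite !mulr_ge0// ltW.
have [||L [lL cL LE]] :=
  @pt_extension_exists _ _ _ T E (fun x y => (alpha x * beta y) *: x0) _ _ C0.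
- split=> [y k x x'|x k y y'] /=.
    have -> : alpha (k *: x + x') = k * alpha x + alpha x' :> K by rewrite ba.1.
    by rewrite mulrDl scalerDl -mulrA scalerA.
  have -> : beta (k *: y + y') = k * beta y + beta y' :> K by rewrite bb.1.
  by rewrite mulrDr scalerDl mulrCA scalerA.
- move=> x y; rewrite normrZ normrM.
  have -> : a * b * `|x0| * (`|x| * `|y|) = (a * `|x|) * (b * `|y|) * `|x0| by ring.
  by rewrite ler_wpM2r// ler_pM.
have [lA cA] := blinZ (alpha x0)^-1 (blin_comp ba (conj lL cL)).
exists (fun t => (alpha x0)^-1 *: (alpha \o L) t); split=> // x y /=.
rewrite LE linZ//; last exact: ba.1.
by rewrite /GRing.scale /= mulrC mulfK//; apply/eqP.
Qed.

Lemma pt_form_bound (alpha : E -> K^o) (beta : F -> K^o) (a b : K) :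
  blin alpha -> blin beta -> 0 <= a -> 0 <= b ->
  (forall x, `|alpha x| <= a * `|x|) -> (forall y, `|beta y| <= b * `|y|) ->
  forall t : T, `|pt_form alpha beta t| <= a * b * `|t|.
Proof.
move=> ba bb a0 b0 Aa Bb; have [bM M] := pt_form_spec ba bb.
have ab0 : 0 <= a * b by exact: mulr_ge0.
refine (@pt_blin_bound _ _ T K^o (pt_form alpha beta) (a * b) bM ab0 _).
move=> x y; rewrite M normrM.
have -> : a * b * (`|x| * `|y|) = (a * `|x|) * (b * `|y|) by ring.
exact: ler_pM.
Qed.

Lemma pt_form_linl (k : K) (alpha alpha' : E -> K^o) (beta : F -> K^o) (t : T) :
  blin alpha -> blin alpha' -> blin beta ->
  pt_form (k *: alpha + alpha') beta t =
  k *: pt_form alpha beta t + pt_form alpha' beta t.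
Proof.
move=> ba ba' bb; have [M1 E1] := pt_form_spec ba bb.
have [M2 E2] := pt_form_spec ba' bb.
have [M3 E3] := pt_form_spec (blinD (blinZ k ba) ba') bb.
suff -> : pt_form (k *: alpha + alpha') beta =
    (fun t => k *: pt_form alpha beta t + pt_form alpha' beta t) :> (T -> K^o) by [].
refine (@pt_blin_unique _ _ T K^o _ _ M3 (blinD (blinZ k M1) M2) _).
by move=> x y; rewrite E1 E2 E3 mulrDl -mulrA.
Qed.

Lemma pt_form_linr (k : K) (alpha : E -> K^o) (beta beta' : F -> K^o) (t : T) :
  blin alpha -> blin beta -> blin beta' ->
  pt_form alpha (k *: beta + beta') t =
  k *: pt_form alpha beta t + pt_form alpha beta' t.
Proof.
move=> ba bb bb'; have [M1 E1] := pt_form_spec ba bb.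
have [M2 E2] := pt_form_spec ba bb'.
have [M3 E3] := pt_form_spec ba (blinD (blinZ k bb) bb').
suff -> : pt_form alpha (k *: beta + beta') =
    (fun t => k *: pt_form alpha beta t + pt_form alpha beta' t) :> (T -> K^o) by [].
refine (@pt_blin_unique _ _ T K^o _ _ M3 (blinD (blinZ k M1) M2) _).
by move=> x y; rewrite E1 E2 E3 mulrDr mulrCA.
Qed.

End Form.

Lemma pt_form_map E F E' F' (T : projTensor E F) (T' : projTensor E' F')
    (alpha : E' -> K^o) (beta : F' -> K^o) (A : E -> E') (B : F -> F') t :
  blin alpha -> blin beta -> blin A -> blin B ->
  pt_form alpha beta (pt_map (T := T) T' A B t) = pt_form (alpha \o A) (beta \o B) t.
Proof.
move=> ba bb bA bB; have [M M1] := pt_map_spec T T' bA bB.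
have [M' M'1] := pt_form_spec T' ba bb.
have [M'' M''1] := pt_form_spec T (blin_comp ba bA) (blin_comp bb bB).
suff <- : pt_form alpha beta \o pt_map (T := T) T' A B =
    pt_form (alpha \o A) (beta \o B) :> (T -> K^o) by [].
refine (@pt_blin_unique _ _ T K^o _ _ (blin_comp M' M) M'' _).
by move=> x y; rewrite M''1 /= M1 M'1.
Qed.

Section Square.
Context E (T : projTensor E E).

Lemma pt_flip_spec : blin (pt_flip (T := T)) /\
  forall x y, pt_flip (pt_mul T x y) = pt_mul T y x.
Proof.
have [||? ? ?] := @pt_extendP _ _ _ T T (fun x y => pt_mul T y x) 1 _ ler01.
- split=> [y k x x'|x k y y'] /=.
    by rewrite pt_mulDr pt_mulZr.
  by rewrite pt_mulDl pt_mulZl.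
- by move=> x y; rewrite mul1r mulrC pt_mul_norm.
- by [].
Qed.

(** Exchanging the two functionals amounts to composing with the flip. *)
Lemma skew_pt_form (alpha beta : E -> K^o) (t : T) : blin alpha -> blin beta ->
  skew_symmetric t -> pt_form alpha beta t = - pt_form beta alpha t.
Proof.
move=> ba bb st; have [M1 E1] := pt_form_spec T ba bb.
have [M2 E2] := pt_form_spec T bb ba; have [M3 E3] := pt_flip_spec.
have -> : pt_form beta alpha t = pt_form alpha beta (pt_flip t).
  suff -> : pt_form beta alpha = pt_form alpha beta \o pt_flip (T := T) :> (T -> K^o) by [].
  refine (@pt_blin_unique _ _ T K^o _ _ M2 (blin_comp M1 M3) _).
  by move=> x y; rewrite E2 /= E3 E1 mulrC.
by rewrite st -[- t]scaleN1r (linZ M1.1) scaleN1r opprK.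
Qed.

End Square.

(* When the extension defining pt_map does not exist, pt_map is 0. *)
Lemma skew_pt_map E E' (T : projTensor E E) (T' : projTensor E' E') (A : E -> E')
    (t : T) : skew_symmetric t -> skew_symmetric (pt_map (T := T) T' A A t).
Proof.
move=> st; have [f1 f2] := pt_flip_spec T; have [f1' f2'] := pt_flip_spec T'.
rewrite /skew_symmetric /pt_map /pt_extend; case: xgetP => [L _ [lL cL LE]|_].
  have -> : pt_flip (L t) = L (pt_flip t).
    rewrite -[LHS]/((pt_flip (T := T') \o L) t) -[RHS]/((L \o pt_flip (T := T)) t).
    congr (_ t); apply: pt_blin_unique; [exact: blin_comp|exact: blin_comp|].
    by move=> x y /=; rewrite f2 !LE f2'.
  by rewrite st -scaleN1r (linZ lL) scaleN1r.
by rewrite (lin0 f1'.1) oppr0.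
Qed.

Section Ad.
Context E (T : projTensor E E) (br : E -> E -> E) (x : E) (bbr : blin (br x)).

Lemma pt_ad_spec : blin (pt_ad br x : T -> T) /\
  forall u v, pt_ad br x (pt_mul T u v) = pt_mul T (br x u) v + pt_mul T u (br x v).
Proof.
have [b b0 Bb] := blin_bound bbr; have b20 : 0 <= 2 * b by rewrite mulr_ge0// ltW.
have [||? ? ?] := @pt_extendP _ _ _ T T
  (fun u v => pt_mul T (br x u) v + pt_mul T u (br x v)) _ _ b20.
- split=> [y k u u'|u k y y'] /=.
    by rewrite bbr.1 !pt_mulDl !pt_mulZl; lmod K.
  by rewrite bbr.1 !pt_mulDr !pt_mulZr; lmod K.
- move=> u v; apply: le_trans (ler_normD _ _) _.
  have -> : 2 * b * (`|u| * `|v|) = (b * `|u|) * `|v| + `|u| * (b * `|v|) by ring.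
  by apply: lerD; apply: le_trans (pt_mul_norm _ _ _) _;
    [rewrite ler_wpM2r|rewrite ler_wpM2l].
- by [].
Qed.

End Ad.
End TensorMaps.
(** * Calculus of smooth maps *)

Section SmoothMaps.
Context (R : realType) (K : numFieldType) (hK : real_or_complex R K).
Implicit Types V W : normedModType K.

Definition diff2 V W (f : V -> W) (x h k : V) : W := 'd (fun u => 'd f u k) x h.

Lemma smooth_comp V' V W (U : set V) (U' : set V') (f : V -> W) (g : V' -> V) :
  open U -> open U' -> (forall x, U' x -> U (g x)) ->
  smooth_on U f -> smooth_on U' g -> smooth_on U' (f \o g).
Proof. by move=> oU oU' UU' sf sg n; exact: Ck_comp (sf n) (sg n). Qed.

Lemma smooth_affine V W (U : set V) (a : W) (L : V -> W) : blin L ->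
  smooth_on U (fun x => a + L x).
Proof. by move=> [lL cL] n; exact: Ck_affine. Qed.

Lemma smooth_blin V W (U : set V) (L : V -> W) : blin L -> smooth_on U L.
Proof. by move=> [lL cL] n; exact: Ck_linear. Qed.

Lemma smooth_ext V W (A : set V) (f g : V -> W) : open A ->
  (forall x, A x -> f x = g x) -> smooth_on A f -> smooth_on A g.
Proof. by move=> oA fg sf n; exact: Ck_ext (sf n). Qed.

Lemma blin_fst V W : blin (fst : V * W -> V).
Proof. by split=> // p; exact: cvg_fst. Qed.

Lemma blin_snd V W : blin (snd : V * W -> W).
Proof. by split=> // p; exact: cvg_snd. Qed.

Lemma blin_pair V W (Z : normedModType K) (f : V -> W) (g : V -> Z) :
  blin f -> blin g -> blin (fun x => (f x, g x)).
Proof.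
move=> [lf cf] [lg cg]; split; first by move=> a x y; rewrite lf lg.
by move=> x; apply: cvg_pair; [exact: cf|exact: cg].
Qed.

Lemma blin_zero V W : blin (fun _ : V => 0 : W).
Proof.
split; first by move=> a x y; rewrite scaler0 addr0.
by move=> x; exact: cvg_cst.
Qed.

Lemma blin_inl V W : blin (fun x : V => (x, 0 : W)).
Proof. by apply: blin_pair; [exact: blin_id|exact: blin_zero]. Qed.

Lemma blin_inr V W : blin (fun y : W => (0 : V, y)).
Proof. by apply: blin_pair; [exact: blin_zero|exact: blin_id]. Qed.

Lemma diff_affine V W (a : W) (L : V -> W) x : blin L ->
  differentiable (fun u => a + L u) x /\ 'd (fun u => a + L u) x = L :> (V -> W).
Proof.
move=> [lL cL]; have [d1 dE] := linear_differential x lL cL.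
have dc : differentiable (cst a : V -> W) x by exact: differentiable_cst.
split; first exact: (differentiableD dc d1).
by rewrite (diffD dc d1) diff_cst dE; apply/funext => h; exact: add0r.
Qed.

Section OneMap.
Context V W (U : set V) (f : V -> W) (oU : open U) (sf : smooth_on U f).

Lemma near_open_set x : U x -> \forall u \near x, U u.
Proof. by move=> Ux; exact: open_nbhs_nbhs. Qed.

Lemma smooth_diff x : U x -> differentiable f x.
Proof. by move=> Ux; have [df _] := sf 1; exact: df. Qed.

Lemma smooth_near_diff x : U x -> \forall u \near x, differentiable f u.
Proof. by move=> Ux; apply: filterS (near_open_set Ux) => u; exact: smooth_diff. Qed.

Lemma smooth_tangent : smooth_on (U `*` setT) (fun p : V * V => 'd f (p.1) p.2).
Proof. by move=> n; have [_] := sf n.+1. Qed.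

Lemma open_tangent : open (U `*` [set: V]).
Proof. by apply: open_setX => //; exact: openT. Qed.

Lemma smooth_dir k : smooth_on U (fun u => 'd f u k).
Proof.
have bL : blin (fun u : V => (u, 0 : V)) by exact: blin_inl.
have sL := smooth_affine U (0, k) bL.
have sC := smooth_comp open_tangent oU _ smooth_tangent sL.
apply: smooth_ext (sC _) => //; first by move=> x Ux /=; rewrite add0r addr0.
by move=> x Ux; split; rewrite //= add0r.
Qed.

Lemma dir_diff k x : U x -> differentiable (fun u => 'd f u k) x.
Proof. by move=> Ux; have [df _] := smooth_dir k 1; exact: df. Qed.

Lemma diff2_sym x h k : U x -> diff2 f x h k = diff2 f x k h.
Proof.
move=> Ux; apply: (second_diff_sym hK); [exact: smooth_near_diff|exact: dir_diff|].
exact: dir_diff.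
Qed.

Lemma diff2_linl x k : U x -> blin (fun h => diff2 f x h k).
Proof. by move=> Ux; exact/blin_diff/dir_diff. Qed.

Lemma diff2_linr x h : U x -> blin (diff2 f x h).
Proof.
move=> Ux; have := diff2_linl h Ux; congr blin; apply/funext => k.
exact: diff2_sym.
Qed.

Lemma tangent_diff x k : U x ->
  differentiable (fun p : V * V => 'd f (p.1) p.2) (x, k).
Proof. by move=> Ux; have [df _] := smooth_tangent 1; exact: df. Qed.

(** The direction splits as [(h, 0) + (0, l)]: the first part moves the base point and gives a
    second derivative, the second stays in the fibre, where the tangent map is linear. *)
Lemma diff_tangent x k h l : U x ->
  'd (fun p : V * V => 'd f (p.1) p.2) (x, k) (h, l) = diff2 f x h k + 'd f x l.
Proof.
move=> Ux; set F := fun p : V * V => _; have dF := tangent_diff k Ux.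
have -> : (h, l) = (h, 0) + (0, l) :> V * V.
  by apply: injective_projections; rewrite /= ?addr0 ?add0r.
rewrite diff_add; congr (_ + _).
  have [dg gE] := diff_affine ((0, k) : V * V) x (blin_inl V V).
  have Fg : (fun u => 'd f u k) = F \o (fun u => (0, k) + (u, 0)).
    by apply/funext => u; rewrite /F /= add0r addr0.
  have xk : (0, k) + (x, 0) = (x, k) :> V * V.
    by apply: injective_projections; rewrite /= ?addr0 ?add0r.
  have dF' : differentiable F ((0, k) + (x, 0)) by rewrite xk.
  by rewrite /diff2 Fg (diff_comp dg dF') [RHS]/= gE xk.
have [dg gE] := diff_affine ((x, 0) : V * V) k (blin_inr V V).
have Fg : 'd f x = F \o (fun u => (x, 0) + (0, u)) :> (V -> W).
  by apply/funext => u; rewrite /F /= addr0 add0r.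
have dfx : differentiable f x by exact: smooth_diff.
have [_ <-] := linear_differential k (blin_diff dfx).1 (blin_diff dfx).2.
have xk : (x, 0) + (0, k) = (x, k) :> V * V.
  by apply: injective_projections; rewrite /= ?addr0 ?add0r.
have dF' : differentiable F ((x, 0) + (0, k)) by rewrite xk.
by rewrite Fg (diff_comp dg dF') [RHS]/= gE xk.
Qed.

Lemma diff_tangent_comp V' (g k : V' -> V) y h gh kh : U (g y) ->
  differentiable g y -> differentiable k y -> 'd g y h = gh -> 'd k y h = kh ->
  differentiable (fun v => 'd f (g v) (k v)) y /\
  'd (fun v => 'd f (g v) (k v)) y h = diff2 f (g y) gh (k y) + 'd f (g y) kh.
Proof.
move=> Ux dg dk <- <-; have dF := tangent_diff (k y) Ux.
have dgk := differentiable_pair dg dk.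
split; first exact: (differentiable_comp dgk dF).
have -> : (fun v => 'd f (g v) (k v)) =
  (fun p : V * V => 'd f (p.1) p.2) \o (fun v => (g v, k v)) by [].
by rewrite (diff_comp dgk dF) /= (diff_pair dg dk) diff_tangent.
Qed.

Lemma diff_op_continuous x : U x -> forall e : K, 0 < e -> \forall u \near x, forall h,
  `|'d f u h - 'd f x h| <= e * `|h|.
Proof.
move=> Ux; apply: (@op_continuous _ _ _ _ (fun u h => 'd f u h)).
  by apply: filterS (near_open_set Ux) => u _; exact: linearP.
exact: tangent_diff.
Qed.

Lemma smooth_strict x : U x -> forall e : K, 0 < e -> exists2 r : K, 0 < r &
  forall u v, `|u - x| < r -> `|v - x| < r ->
  `|f u - f v - 'd f x (u - v)| <= e * `|u - v|.
Proof.
move=> Ux; apply: (strict_differentiable hK); first exact: smooth_near_diff.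
exact: diff_op_continuous.
Qed.

End OneMap.

(** [L] selects a family of directions; with the two inclusions into a product it gives expansions
    of the partial derivatives, uniform in the direction. *)
Lemma diff_op_first_order V W (H : normedModType K) (U : set V) (f : V -> W)
    (L : H -> V) x y : open U -> smooth_on U f -> U x -> blin L ->
  forall e : K, 0 < e -> \forall s \near (0 : K), forall h,
  `|'d f (x + s *: y) (L h) - 'd f x (L h) - s *: diff2 f x y (L h)| <= e * `|s| * `|h|.
Proof.
move=> oU sf Ux bL; apply: (op_first_order hK (F := fun u h => 'd f u (L h))).
- apply: filterS (near_open_set oU Ux) => u Uu a h h'.
  by rewrite bL.1 diff_add diff_scale.
- by apply: filterS (near_open_set oU Ux) => u Uu h; exact: (dir_diff oU sf).
have bM : blin (fun p : V * H => (p.1, L p.2)).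
  apply: blin_pair; first exact: blin_fst.
  by apply: blin_comp (blin_snd _ _).
have [dM _] := linear_differential (x, 0 : H) bM.1 bM.2.
have sT := smooth_tangent sf; have oT := open_tangent oU.
(* The map to be differentiated is the derivative of the tangent map of [f] along [(y, 0)],
   precomposed with [L]. *)
have dD : differentiable (fun q : V * V => 'd (fun p : V * V => 'd f (p.1) p.2) q (y, 0))
    (x, L 0) by apply: (dir_diff oT sT).
refine (near_eq_diff _ (differentiable_comp dM dD)).1.
have : \forall p \near (x, 0 : H), (U `*` setT) p.
  by apply: open_nbhs_nbhs; split=> //; apply: open_setX => //; exact: openT.
apply: filterS => -[u h] [/= Uu _].
by rewrite (diff_tangent sf)// linear0 addr0.
Qed.

End SmoothMaps.

Section BilinearAtZero.
Context {K : numFieldType}.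
Implicit Types V W T : normedModType K.

(* Only the continuity of G in the operator norm matters, because p vanishes at x. *)
Lemma diff_apply_at_zero V T W (G : V -> T -> W) (p : V -> T) (x : V) :
  p x = 0 -> differentiable p x -> (\forall u \near x, linear (G u)) ->
  continuous (G x) ->
  (forall e : K, 0 < e -> \forall u \near x, forall t, `|G u t - G x t| <= e * `|t|) ->
  differentiable (fun u => G u (p u)) x /\
  'd (fun u => G u (p u)) x = G x \o 'd p x :> (V -> W).
Proof.
move=> px0 dp linG cG opG; have linGx : linear (G x) by exact: nbhs_singleton linG.
have bGp : blin (G x \o 'd p x).
  by apply: blin_comp; [split|exact: blin_diff].
have [g g0 gG] := blin_bound (conj linGx cG : blin (G x)).
have [c c0 cp] := blin_bound (blin_diff dp).
apply: diff_unique_near; [exact: bGp.1|exact: bGp.2|] => e e0.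
have c1 : 0 < c + 1 by rewrite ltr_wpDr// ltW.
(* Near [x], [|p u| <= (c + 1) |u - x|]: [c] comes from the differential and 1 from its remainder.
   The other half of [e] pays for that remainder, sent through [G x]. *)
have [r1 r10 r1P] := near_norm_and (opG _ (divr_gt0 (divr_gt0 e0 (ltr0n K 2)) c1))
  (diff_near dp ltr01).
have e2g : 0 < e / 2 / g by rewrite !divr_gt0.
have [r2 r20 r2P] := near_norm_and (diff_near dp e2g) linG.
apply/near_normP; exists (Num.min r1 r2); first by rewrite /Num.min; case: ifP.
move=> u; rewrite comparable_lt_min ?real_comparable ?gtr0_real// => /andP[ur1 ur2].
have [q1 q2] := r1P u ur1; have [q3 _] := r2P u ur2.
rewrite /= px0 (lin0 linGx) !subr0 in q1 q2 q3 *.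
have -> : G u (p u) - G x ('d p x (u - x)) =
  (G u (p u) - G x (p u)) + G x (p u - 'd p x (u - x)).
  by rewrite (linB linGx); lmod K.
rewrite [e]splitr mulrDl; apply: le_trans (ler_normD _ _) _; apply: lerD.
  apply: le_trans (q1 _) _; rewrite mulrAC ler_pdivrMr// -[leRHS]mulrA.
  rewrite ler_wpM2l ?divr_ge0 ?(ltW e0)// mulrC mulrDl mul1r.
  rewrite {1}(_ : p u = 'd p x (u - x) + (p u - 'd p x (u - x))); last by lmod K.
  apply: le_trans (ler_normD _ _) _; apply: lerD; first exact: cp.
  by rewrite mul1r in q2.
apply: le_trans (gG _) _; rewrite mulrC -ler_pdivlMr//.
by rewrite mulrAC.
Qed.

End BilinearAtZero.

(** * Partial derivatives and pointwise forms of the rules of differentiation *)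

Section PartialMaps.
Context {K : numFieldType}.
Implicit Types V W Z : normedModType K.

Lemma diff_partial1 V W Z (f : V * W -> Z) a b : differentiable f (a, b) ->
  differentiable (fun v => f (v, b)) a /\
  forall h, 'd (fun v => f (v, b)) a h = 'd f (a, b) (h, 0).
Proof.
move=> df; have [dg gE] := diff_affine ((0, b) : V * W) a (blin_inl V W).
have ab : (0, b) + (a, 0) = (a, b) :> V * W.
  by apply: injective_projections; rewrite /= ?addr0 ?add0r.
have fE : (fun v => f (v, b)) = f \o (fun v => (0, b) + (v, 0)).
  apply/funext => v /=; congr f.
  by apply: injective_projections; rewrite /= ?addr0 ?add0r.
have df' : differentiable f ((0, b) + (a, 0)) by rewrite ab.
rewrite fE; split; first exact: (differentiable_comp dg df').
by move=> h; rewrite (diff_comp dg df') /= gE ab.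
Qed.

Lemma diff_partial2 V W Z (f : V * W -> Z) a b : differentiable f (a, b) ->
  differentiable (fun w => f (a, w)) b /\
  forall h, 'd (fun w => f (a, w)) b h = 'd f (a, b) (0, h).
Proof.
move=> df; have [dg gE] := diff_affine ((a, 0) : V * W) b (blin_inr V W).
have ab : (a, 0) + (0, b) = (a, b) :> V * W.
  by apply: injective_projections; rewrite /= ?addr0 ?add0r.
have fE : (fun w => f (a, w)) = f \o (fun w => (a, 0) + (0, w)).
  apply/funext => w /=; congr f.
  by apply: injective_projections; rewrite /= ?addr0 ?add0r.
have df' : differentiable f ((a, 0) + (0, b)) by rewrite ab.
rewrite fE; split; first exact: (differentiable_comp dg df').
by move=> h; rewrite (diff_comp dg df') /= gE ab.
Qed.

Lemma differential_id V (x : V) : differentiable id x /\ 'd id x = id :> (V -> V).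
Proof. by have [l c] := @blin_id K V; exact: linear_differential. Qed.

Lemma differential_cst V W (w : W) (x h : V) : 'd (fun=> w) x h = 0 :> W.
Proof. exact: (congr1 (fun f : V -> W => f h) (diff_cst w x)). Qed.

Lemma differential_pair V W Z (f : V -> W) (g : V -> Z) x h :
  differentiable f x -> differentiable g x ->
  'd (fun y => (f y, g y)) x h = ('d f x h, 'd g x h).
Proof.
by move=> df dg; exact: (congr1 (fun k : V -> W * Z => k h) (diff_pair df dg)).
Qed.

Lemma differential_comp V W Z (f : V -> W) (g : W -> Z) x h :
  differentiable f x -> differentiable g (f x) ->
  'd (fun y => g (f y)) x h = 'd g (f x) ('d f x h).
Proof.
by move=> df dg; exact: (congr1 (fun k : V -> Z => k h) (diff_comp df dg)).
Qed.

Lemma differential_sub V W (f g : V -> W) x h :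
  differentiable f x -> differentiable g x ->
  'd (fun y => f y - g y) x h = 'd f x h - 'd g x h.
Proof.
by move=> df dg; exact: (congr1 (fun k : V -> W => k h) (diffB df dg)).
Qed.

Lemma differential_add V W (f g : V -> W) x h :
  differentiable f x -> differentiable g x ->
  'd (fun y => f y + g y) x h = 'd f x h + 'd g x h.
Proof.
by move=> df dg; exact: (congr1 (fun k : V -> W => k h) (diffD df dg)).
Qed.

Lemma near_diff_eq V W (f g : V -> W) x : (\forall u \near x, f u = g u) ->
  differentiable f x -> 'd g x = 'd f x :> (V -> W).
Proof. by move=> fg df; have [] := near_eq_diff fg df. Qed.

Lemma near_curry (V W : topologicalType) (a : V) (b : W) (Q : V * W -> Prop) :
  (\forall q \near (a, b), Q q) -> \forall u \near a, \forall v \near b, Q (u, v).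
Proof.
move=> [[A B] /= [Aa Bb] AB]; apply: filterS Aa => u Au.
by apply: filterS Bb => v Bv; exact: AB.
Qed.

End PartialMaps.

(** * Local groups *)

Section LocalGroup.
Context (R : realType) (K : numFieldType) (hK : real_or_complex R K).
Context (E : completeNormedModType K) (e : E) (m : E * E -> E) (S : set (E * E)).
Context (oS : open S) (sm : smooth_on S m) (See : S (e, e)).
Context (mr : \forall u \near e, m (u, e) = u) (ml : \forall v \near e, m (e, v) = v).
Context (massoc : \forall u \near e, \forall v \near e, \forall w \near e,
  m (m (u, v), w) = m (u, m (v, w))).

(** The left invariant vector field with value [y] at the unit, read in the chart. *)
Definition left_field (y u : E) : E := 'd m (u, e) (0, y).
Definition mixed_diff (x y : E) : E := diff2 m (e, e) (x, 0) (0, y).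
Definition local_bracket (x y : E) : E := mixed_diff x y - mixed_diff y x.

Local Notation V := left_field.
Local Notation B := mixed_diff.
Local Notation br := local_bracket.

Let mee : m (e, e) = e. Proof. exact: nbhs_singleton mr. Qed.

Let nearS : \forall u \near e, \forall v \near e, S (u, v).
Proof. by apply: near_curry; exact: open_nbhs_nbhs. Qed.

Let nearSe : \forall u \near e, S (u, e).
Proof. by apply: filterS nearS => u; exact: nbhs_singleton. Qed.

Let neareS : \forall v \near e, S (e, v).
Proof. exact: nbhs_singleton nearS. Qed.

(** The unit law is differentiated on a whole neighbourhood, not just at [e], so that the result can
    be differentiated once more. *)
Lemma diff_right_unit : \forall u \near e, forall h, 'd m (u, e) (h, 0) = h.
Proof.
have := near_join mr; move: nearSe; apply: filterS2 => u Su mu h.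
have [d1 <-] := diff_partial1 (smooth_diff sm Su).
have /near_diff_eq : \forall v \near u, id v = m (v, e) by apply: filterS mu => v ->.
have [di iE] := differential_id u.
by move=> ->; rewrite ?iE.
Qed.

Lemma diff_left_unit : \forall v \near e, forall h, 'd m (e, v) (0, h) = h.
Proof.
have := near_join ml; move: neareS; apply: filterS2 => u Su mu h.
have [d1 <-] := diff_partial2 (smooth_diff sm Su).
have /near_diff_eq : \forall v \near u, id v = m (e, v) by apply: filterS mu => v ->.
have [di iE] := differential_id u.
by move=> ->; rewrite ?iE.
Qed.

Lemma left_field_unit y : V y e = y.
Proof. exact: (nbhs_singleton diff_left_unit). Qed.

(** Near the unit [D_1 m (u, e)] is the identity, hence constant in [u]. *)
Lemma diff2_fst x x' : diff2 m (e, e) (x, 0) (x', 0) = 0.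
Proof.
have [d1 dE] := diff_partial1 (dir_diff oS sm (x', 0) See).
rewrite /diff2 -dE.
suff -> : 'd (fun v => 'd m (v, e) (x', 0)) e = 'd (cst x') e :> (E -> E).
  by rewrite diff_cst.
apply: near_diff_eq; last exact: differentiable_cst.
by apply: filterS diff_right_unit => u ->.
Qed.

Lemma diff2_snd y y' : diff2 m (e, e) (0, y) (0, y') = 0.
Proof.
have [d1 dE] := diff_partial2 (dir_diff oS sm (0, y') See).
rewrite /diff2 -dE.
suff -> : 'd (fun v => 'd m (e, v) (0, y')) e = 'd (cst y') e :> (E -> E).
  by rewrite diff_cst.
apply: near_diff_eq; last exact: differentiable_cst.
by apply: filterS diff_left_unit => u ->.
Qed.

(** The pure second derivatives vanish by the unit laws, so [B] carries the whole Hessian of [m] at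
    the unit. *)
Lemma diff2_unit x y x' y' :
  diff2 m (e, e) (x, y) (x', y') = B x y' + B x' y.
Proof.
have split2 (a b : E) : (a, b) = (a, 0) + (0, b).
  by apply: injective_projections; rewrite /= ?addr0 ?add0r.
have Dl k := (diff2_linl oS sm k See).1; have Dr h := (diff2_linr hK oS sm h See).1.
rewrite (split2 x y) (split2 x' y') (linD (Dr _)) !(linD (Dl _)).
rewrite diff2_fst diff2_snd add0r addr0 addrC; congr (_ + _).
exact: (diff2_sym hK oS sm).
Qed.

Lemma mixed_diff_linl y : blin (B ^~ y).
Proof.
have := blin_comp (diff2_linl oS sm (0, y) See) (blin_inl E E).
exact.
Qed.

Lemma mixed_diff_linr x : blin (B x).
Proof.
have := blin_comp (diff2_linr hK oS sm (x, 0) See) (blin_inr E E).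
exact.
Qed.

Lemma mixed_diff_continuous : continuous (fun p : E * E => B p.1 p.2).
Proof.
(* [B x y] is the second tangent map of [m] at a point depending affinely on [(x, y)], which gives
   joint continuity from that of the tangent map. *)
pose L (p : E * E) : (E * E) * (E * E) * ((E * E) * (E * E)) :=
  ((0, (0, p.2)), ((p.1, 0), 0)).
have bL : blin L.
  apply: blin_pair; apply: blin_pair; try exact: blin_zero.
    exact: blin_comp (blin_inr _ _) (blin_snd _ _).
  exact: blin_comp (blin_inl _ _) (blin_fst _ _).
pose g p := (((e, e), 0), 0) + L p.
have gE p : g p = (((e, e), (0, p.2)), ((p.1, 0), 0)).
  by do ?apply: injective_projections; rewrite /= ?addr0 ?add0r.
move=> p; have cg := smooth_affine setT (((e, e), 0), 0) bL 0 p I.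
have Sg : ((S `*` setT) `*` setT) (g p) by rewrite gE.
have C := smooth_tangent (smooth_tangent sm) 0 (g p) Sg.
have -> : (fun p : E * E => B p.1 p.2) = (fun q => 'd (fun p : (E * E) * (E * E) =>
    'd m (p.1) p.2) (q.1) q.2) \o g.
  by apply/funext => q; rewrite [RHS]/comp gE (diff_tangent sm)// linear0 addr0.
exact: (continuous_comp (f := g) cg C).
Qed.

Lemma left_field_diff u y : S (u, e) -> differentiable (V y) u /\
  forall x, 'd (V y) u x = diff2 m (u, e) (x, 0) (0, y).
Proof. by move=> Su; exact: (diff_partial1 (dir_diff oS sm (0, y) Su)). Qed.

Lemma open_left_dom : open [set u | S (u, e)].
Proof.
rewrite openE => u Su; have := near_curry (open_nbhs_nbhs (conj oS Su)).
by apply: filterS => v; exact: nbhs_singleton.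
Qed.

Lemma left_field_smooth y : smooth_on [set u | S (u, e)] (V y).
Proof.
have cE u : (0, e) + (u, 0) = (u, e) :> E * E.
  by apply: injective_projections; rewrite /= ?addr0 ?add0r.
have -> : V y = (fun q => 'd m q (0, y)) \o (fun u => (0, e) + (u, 0)).
  by apply/funext => u; rewrite /= cE.
apply: (smooth_comp oS open_left_dom _ (smooth_dir oS sm _)).
  by move=> u Su; rewrite cE.
exact: (smooth_affine _ _ (blin_inl E E)).
Qed.

(** Left invariance, obtained by differentiating the associative law in its last variable at the
    unit. *)
Lemma left_field_mul : \forall u \near e, \forall v \near e, forall z,
  V z (m (u, v)) = 'd m (u, v) (0, V z v).
Proof.
have := mr; move: massoc nearS nearSe => a1 a2 a3 a4.
apply: filterS (filterI (filterI a1 a2) (filterI a3 a4)) => u [[a1u a2u] [a3u a4u]].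
have cm : {for e, continuous (fun v => m (u, v))}.
  by apply: differentiable_continuous; have [] := diff_partial2 (smooth_diff sm a3u).
have Sm : \forall v \near e, S (m (u, v), e).
  apply: (cm (fun w => S (w, e))); rewrite /= a4u.
  by apply: open_nbhs_nbhs; split => //; exact: open_left_dom.
have := mr; move: nearSe => b1 b2.
apply: filterS (filterI (filterI a1u a2u) (filterI Sm (filterI b1 b2))).
move=> v [[av Suv] [Smv [Sv mv]]] z.
have [d1 d1E] := diff_partial2 (smooth_diff sm Smv).
have [d2 d2E] := diff_partial2 (smooth_diff sm Sv).
have Suv' : S (u, m (v, e)) by rewrite mv.
have [d3 d3E] := diff_partial2 (smooth_diff sm Suv').
have -> : V z (m (u, v)) = 'd (fun w => m (m (u, v), w)) e z by rewrite d1E.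
have -> : 'd (fun w => m (m (u, v), w)) e =
    'd ((fun y => m (u, y)) \o (fun w => m (v, w))) e :> (E -> E).
  apply: near_diff_eq; last exact: differentiable_comp.
  by apply: filterS av => w ->.
by rewrite (diff_comp d2 d3) /comp d3E mv d2E.
Qed.

(* Differentiate left_field_mul in v at the unit: the second derivatives of m in v
   are symmetric in y and z, hence cancel. *)
Lemma left_field_bracket y z : \forall u \near e,
  'd (V z) u (V y u) - 'd (V y) u (V z u) = V (br y z) u.
Proof.
have a1 := left_field_mul; have a2 := nearSe; have a3 := mr.
apply: filterS (filterI (filterI a1 a2) a3) => u [[a1u Su] mu].
have key x w : 'd (V w) u (V x u) = diff2 m (u, e) (0, x) (0, w) + V (B x w) u.
  have Sue : S (m (u, e), e) by rewrite mu.
  have [d1 d1E] := diff_partial2 (smooth_diff sm Su).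
  have [d2 d2E] := left_field_diff w Sue.
  have [d3 d3E] := left_field_diff w See.
  have [did idE] := differential_id e.
  have dcu (a : E) : differentiable (fun _ : E => a) e by exact: differentiable_cst.
  have dg : differentiable (fun v => (u, v)) e := differentiable_pair (dcu u) did.
  have gE h : 'd (fun v => (u, v)) e h = (0, h).
    rewrite -[RHS]/(0, id h) -idE -(differential_cst u e h).
    exact: (differential_pair h (dcu u) did).
  have dk : differentiable (fun v => (0 : E, V w v)) e.
    exact: differentiable_pair (dcu 0) d3.
  have kE h : 'd (fun v => (0 : E, V w v)) e h = (0, 'd (V w) e h).
    rewrite -{2}(differential_cst (0 : E) e h).
    exact: (differential_pair h (dcu 0) d3).
  have [d4 d4E] := diff_tangent_comp (g := fun v => (u, v)) sm Su dg dk (gE x) (kE x).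
  have -> : 'd (V w) u (V x u) = 'd (fun v => V w (m (u, v))) e x.
    exact: (eq_trans (congr2 (fun a b => 'd (V w) a b) (esym mu) (esym (d1E x)))
      (esym (differential_comp x d1 d2))).
  have -> : 'd (fun v => V w (m (u, v))) e =
      'd (fun v => 'd m (u, v) (0, V w v)) e :> (E -> E).
    by apply: (near_diff_eq _ d4); apply: filterS a1u => v ->.
  by rewrite d4E (left_field_unit w) (d3E x).
rewrite !key (diff2_sym hK oS sm)// opprD addrACA subrr add0r.
by rewrite /left_field -linearB /=; congr ('d m _ _); rewrite -[RHS]/(0, _); congr pair;
  rewrite subrr.
Qed.

Lemma local_bracket_lie : banach_lie_bracket br.
Proof.
have Bl x y z k : B (k *: x + y) z = k *: B x z + B y z by rewrite (mixed_diff_linl z).1.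
have Br x y z k : B z (k *: x + y) = k *: B z x + B z y by rewrite (mixed_diff_linr z).1.
split; last first.
  have cB := mixed_diff_continuous.
  have cBs : continuous (fun p : E * E => B p.2 p.1).
    move=> p; apply: (@continuous_comp _ _ _ (fun p : E * E => (p.2, p.1))
      (fun p : E * E => B p.1 p.2)); last exact: cB.
    by apply: cvg_pair; [exact: cvg_snd|exact: cvg_fst].
  by move=> p; apply: cvgB; [exact: cB|exact: cBs].
split=> //.
- by move=> k x y z _ _ _; rewrite /local_bracket Bl Br; lmod K.
- by move=> k x y z _ _ _; rewrite /local_bracket Bl Br; lmod K.
- by move=> x _; rewrite /local_bracket subrr.
(* The only third derivatives of [m] that occur; their symmetry makes them cancel in the cyclic
   sum. *)
pose D z x y := diff2 (V z) e x y.
have Dsym z x y : D z x y = D z y x.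
  exact: (diff2_sym hK open_left_dom (left_field_smooth z)).
(* The identity of [left_field_bracket] differentiated at the unit along [x]. *)
have key x y z : D z x y + B (B x y) z - (D y x z + B (B x z) y) = B x (br y z).
  have [did idE] := differential_id e.
  have dVV a b : differentiable (fun u => 'd (V b) u (V a u)) e /\
      'd (fun u => 'd (V b) u (V a u)) e x = D b x a + B (B x a) b.
    have [da daE] := left_field_diff a See.
    have [d1 d1E] := diff_tangent_comp (g := id) (left_field_smooth b) See did da
      (congr1 (fun f => f x) idE) (daE x).
    split=> //; rewrite left_field_unit in d1E.
    by rewrite d1E; have [_ ->] := left_field_diff b See.
  have [d1 d1E] := dVV y z; have [d2 d2E] := dVV z y.
  have [_ dE] := left_field_diff (br y z) See.
  have bE := near_diff_eq (left_field_bracket y z) (differentiableB d1 d2).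
  apply: (eq_trans _ (dE x)).
  apply: (eq_trans _ (esym (congr1 (fun f : E -> E => f x) bE))).
  apply: (eq_trans _ (esym (differential_sub x d1 d2))).
  exact: (congr2 (fun a b => a - b) (esym d1E) (esym d2E)).
move=> x y z _ _ _.
have -> : br x (br y z) + br y (br z x) + br z (br x y) =
  B x (br y z) - B (br y z) x + (B y (br z x) - B (br z x) y) +
  (B z (br x y) - B (br x y) z) by [].
have Bb a b c : B (br a b) c = B (B a b) c - B (B b a) c.
  by rewrite (linB (mixed_diff_linl c).1).
(* After [key], only terms [B (B _ _) _] remain besides the [D] terms, and they cancel in pairs. *)
rewrite -!key !Bb (Dsym x y z) (Dsym y z x) (Dsym z x y).
lmod K.
Qed.

End LocalGroup.
(** * Expansions in a scalar parameter *)

Section Little.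
Context {K : numFieldType}.
Implicit Types V W T : normedModType K.

(** [f s = o(s^n)] at 0; [op_little] below is o(s) in operator norm. *)
Definition little (n : nat) W (f : K -> W) : Prop :=
  forall e : K, 0 < e -> \forall s \near (0 : K), `|f s| <= e * `|s| ^+ n.

Definition op_little V W (G : K -> V -> W) : Prop :=
  forall e : K, 0 < e -> \forall s \near (0 : K), forall t, `|G s t| <= e * `|s| * `|t|.

Lemma littleD n W (f g : K -> W) :
  little n f -> little n g -> little n (fun s => f s + g s).
Proof.
move=> lf lg e e0; have e20 : 0 < e / 2 by rewrite divr_gt0.
apply: filterS2 (lf _ e20) (lg _ e20) => s fs gs.
by rewrite [e]splitr mulrDl; apply: le_trans (ler_normD _ _) _; exact: lerD.
Qed.

Lemma little_blin n V W (L : V -> W) (f : K -> V) :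
  blin L -> little n f -> little n (fun s => L (f s)).
Proof.
move=> bL lf e e0; have [c c0 Lc] := blin_bound bL.
apply: filterS (lf _ (divr_gt0 e0 c0)) => s fs; apply: le_trans (Lc _) _.
by rewrite mulrC -ler_pdivlMr// mulrAC.
Qed.

Lemma littleN n W (f : K -> W) : little n f -> little n (fun s => - f s).
Proof. by move=> lf e e0; apply: filterS (lf e e0) => s; rewrite normrN. Qed.

Lemma littleB n W (f g : K -> W) :
  little n f -> little n g -> little n (fun s => f s - g s).
Proof. by move=> lf lg; apply: littleD => //; exact: littleN. Qed.

Lemma little_scale n W (f : K -> W) : little n f -> little n.+1 (fun s => s *: f s).
Proof.
move=> lf e e0; apply: filterS (lf e e0) => s fs.
by rewrite normrZ exprS mulrCA ler_wpM2l.
Qed.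

Lemma little_ext n W (f g : K -> W) : (\forall s \near (0 : K), f s = g s) ->
  little n f -> little n g.
Proof. by move=> fg lf e e0; apply: filterS2 fg (lf e e0) => s <-. Qed.

(** Turns an expansion into an identity: the coefficient of [s^n] in something that is o(s^n) is
    zero. *)
Lemma little_cst n W (w : W) : little n (fun s => s ^+ n *: w) -> w = 0.
Proof.
move=> lw; apply: le_eps_eq0 => e e0; have [s s0] := near0_neq0 (lw e e0).
by rewrite normrZ normrX mulrC ler_pM2r// exprn_gt0// normr_gt0.
Qed.

(** An operator of norm o(s) applied to a vector of size O(s): this is where the second order is
    gained from first-order information. *)
Lemma op_little_apply V W (G : K -> V -> W) (f : K -> V) (v : V) :
  op_little G -> little 1 (fun s => f s - s *: v) -> little 2 (fun s => G s (f s)).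
Proof.
move=> lG lf e e0; have v0 : 0 < `|v| + 1 by rewrite ltr_wpDl.
apply: filterS2 (lG _ (divr_gt0 e0 v0)) (lf 1 ltr01) => s Gs fs.
apply: le_trans (Gs _) _; rewrite expr2 mulrA.
have sv : `|f s| <= `|s| * (`|v| + 1).
  have -> : f s = s *: v + (f s - s *: v) by lmod K.
  apply: le_trans (ler_normD _ _) _; rewrite normrZ mulrDr mulr1 lerD2l.
  by rewrite mul1r expr1 in fs.
apply: (@le_trans _ _ (e / (`|v| + 1) * `|s| * (`|s| * (`|v| + 1)))).
  by rewrite ler_wpM2l// mulr_ge0// ltW// divr_gt0.
by have -> : e / (`|v| + 1) * `|s| * (`|s| * (`|v| + 1)) = e * `|s| * `|s|;
  first by field; rewrite gt_eqF.
Qed.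

Lemma near0_scale V (x y : V) (Q : V -> Prop) : (\forall u \near x, Q u) ->
  \forall s \near (0 : K), Q (x + s *: y).
Proof.
move=> /near_normP[r r0 rQ]; have y0 : 0 < `|y| + 1 by rewrite ltr_wpDl.
apply/near_normP; exists (r / (`|y| + 1)); first exact: divr_gt0.
move=> s; rewrite subr0 ltr_pdivlMr// => sy; apply: rQ.
rewrite [x + _]addrC addrK normrZ; apply: le_lt_trans sy.
by rewrite ler_wpM2l// lerDl.
Qed.

Lemma little_diff V W (f : V -> W) x y : differentiable f x ->
  little 1 (fun s => f (x + s *: y) - f x - s *: 'd f x y).
Proof.
move=> df e e0; have y0 : 0 < `|y| + 1 by rewrite ltr_wpDl.
apply: filterS (near0_scale y (diff_near df (divr_gt0 e0 y0))) => s.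
rewrite [x + _ - _]addrC addKr diff_scale => /le_trans; apply.
rewrite normrZ expr1 mulrCA [leRHS]mulrC ler_wpM2l//.
by rewrite mulrAC ler_pdivrMr// ler_wpM2l ?(ltW e0)// lerDl.
Qed.

End Little.

(** * Tensor squares of operators close to the identity *)

Section TensorOperators.
Context {K : numFieldType} (E : completeNormedModType K) (T : projTensor E E).

(** Telescoping: the difference of tensor squares is [(A - A') (x) A + A' (x) (A - A')]. *)
Lemma pt_map_near (A A' : E -> E) (a d : K) : blin A -> blin A' -> 0 <= a -> 0 <= d ->
  (forall h, `|A h| <= a * `|h|) -> (forall h, `|A' h| <= a * `|h|) ->
  (forall h, `|A h - A' h| <= d * `|h|) ->
  forall t : T, `|pt_map T A A t - pt_map T A' A' t| <= 2 * a * d * `|t|.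
Proof.
move=> bA bA' a0 d0 Aa A'a Ad; have [bM ME] := pt_map_spec T T bA bA.
have [bM' ME'] := pt_map_spec T T bA' bA'.
have bD := blinB bM bM'.
apply: (pt_blin_bound bD); first by rewrite !mulr_ge0.
move=> h k; rewrite ME ME'.
have -> : pt_mul T (A h) (A k) - pt_mul T (A' h) (A' k) =
   pt_mul T (A h - A' h) (A k) + pt_mul T (A' h) (A k - A' k).
  by rewrite pt_mulBl pt_mulBr; lmod K.
have -> : 2 * a * d * (`|h| * `|k|) = (d * `|h|) * (a * `|k|) + (a * `|h|) * (d * `|k|).
  by ring.
by apply: le_trans (ler_normD _ _) _; apply: lerD;
  apply: le_trans (pt_mul_norm _ _ _) _; apply: ler_pM.
Qed.

(** With [A = 1 + s N] and [A' = 1 + s N'] up to o(s), the tensor squares differ at first order by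
    [N - N' = ad_x] acting as a derivation. *)
Lemma pt_map_first_order (A A' : K -> E -> E) (N N' : E -> E) (br : E -> E -> E) (x : E) :
  (\forall s \near (0 : K), blin (A s)) -> (\forall s \near (0 : K), blin (A' s)) ->
  blin N -> blin N' -> blin (br x) -> (forall h, N h - N' h = br x h) ->
  op_little (fun s h => A s h - h - s *: N h) ->
  op_little (fun s h => A' s h - h - s *: N' h) ->
  op_little (fun s (t : T) => pt_map T (A s) (A s) t - pt_map T (A' s) (A' s) t
     - s *: pt_ad br x t).
Proof.
move=> bA bA' bN bN' bb NN' lA lA' e e0.
have [n n0 Nn] := blin_bound bN; have [n' n'0 Nn'] := blin_bound bN'.
have [b b0 bbn] := blin_bound bb.
(* The four terms of the telescoping below cost [4 d], [b d], [4 d] and [b d], in all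
   [2 * C * d = e]. *)
pose C : K := 4 + b; have C0 : 0 < C by rewrite addr_gt0.
pose d : K := e / (2 * C); have d0 : 0 < d by rewrite divr_gt0// mulr_gt0.
(* Being at most 1, it bounds [A s] and [A' s] by 2; being at most [d], it makes the mixed terms
   small. *)
pose d1 : K := Num.min d 1.
have d10 : 0 < d1 by rewrite /d1 /Num.min; case: ifP.
have d1d : d1 <= d by rewrite comparable_ge_min ?lexx// real_comparable// gtr0_real.
have d11 : d1 <= 1 by rewrite comparable_ge_min ?lexx ?orbT// real_comparable// gtr0_real.
have small (c : K) : 0 < c -> \forall s \near (0 : K), c * `|s| <= d1 / 2.
  move=> c0; apply/near_normP; exists (d1 / 2 / c); first by rewrite !divr_gt0.
  by move=> s; rewrite subr0 => /ltW sc; rewrite mulrC -ler_pdivlMr.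
have d12 : 0 < d1 / 2 by rewrite divr_gt0.
have near1 (B : K -> E -> E) (M : E -> E) (c : K) : 0 < c ->
    (forall h, `|M h| <= c * `|h|) -> op_little (fun s h => B s h - h - s *: M h) ->
    \forall s \near (0 : K), forall h, `|B s h - h| <= d1 * `|h|.
  move=> c0 Mc lB; have s1 : \forall s \near (0 : K), `|s| <= 1.
    by apply/near_normP; exists 1 => // s; rewrite subr0 => /ltW.
  apply: filterS (filterI (small c c0) (filterI s1 (lB _ d12))) => s [cs [s1' Bs]] h.
  have -> : B s h - h = (B s h - h - s *: M h) + s *: M h by lmod K.
  apply: le_trans (ler_normD _ _) _; rewrite normrZ [d1]splitr mulrDl; apply: lerD.
    apply: le_trans (Bs h) _; rewrite ler_wpM2r// ler_piMr// ltW//.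
  apply: (@le_trans _ _ (`|s| * (c * `|h|))); first by rewrite ler_wpM2l.
  by rewrite mulrA ler_wpM2r// mulrC.
have a1 := near1 A N n n0 Nn lA; have a2 := near1 A' N' n' n'0 Nn' lA'.
apply: filterS (filterI (filterI bA bA') (filterI (filterI a1 a2)
  (filterI (lA _ d0) (lA' _ d0)))).
move=> s [[bAs bAs'] [[a1s a2s] [lAs lAs']]].
have [bM ME] := pt_map_spec T T bAs bAs; have [bM' ME'] := pt_map_spec T T bAs' bAs'.
have [bad adE] := pt_ad_spec T bb.
have bD := blinB (blinB bM bM') (blinZ s bad).
have diffA h : `|A s h - A' s h - s *: br x h| <= 2 * d * `|s| * `|h|.
  have -> : A s h - A' s h - s *: br x h =
    (A s h - h - s *: N h) - (A' s h - h - s *: N' h) by rewrite -NN'; lmod K.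
  have -> : 2 * d * `|s| * `|h| = d * `|s| * `|h| + d * `|s| * `|h| by ring.
  by apply: le_trans (ler_normB _ _) _; exact: lerD.
have two B : (forall h, `|B h - h| <= d1 * `|h|) -> forall h : E, `|B h| <= 2 * `|h|.
  move=> Bh h; have -> : B h = (B h - h) + h by rewrite subrK.
  apply: le_trans (ler_normD _ _) _.
  have -> : 2 * `|h| = `|h| + `|h| by ring.
  by rewrite lerD2r; apply: le_trans (Bh h) _; rewrite ler_piMl.
have A2 := two _ a1s; have A'2 := two _ a2s.
have ds0 : 0 <= e * `|s| by rewrite mulr_ge0// ltW.
apply: (pt_blin_bound bD ds0) => h k; rewrite ME ME' adE.
have -> : pt_mul T (A s h) (A s k) - pt_mul T (A' s h) (A' s k) -
   s *: (pt_mul T (br x h) k + pt_mul T h (br x k)) =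
   pt_mul T (A s h - A' s h - s *: br x h) (A s k) +
   pt_mul T (s *: br x h) (A s k - k) +
   pt_mul T (A' s h) (A s k - A' s k - s *: br x k) +
   pt_mul T (A' s h - h) (s *: br x k).
  by rewrite !(pt_mulBl, pt_mulBr, pt_mulZl, pt_mulZr); lmod K.
have -> : e * `|s| * (`|h| * `|k|) =
   (2 * d * `|s| * `|h|) * (2 * `|k|) + (`|s| * (b * `|h|)) * (d * `|k|) +
   (2 * `|h|) * (2 * d * `|s| * `|k|) + (d * `|h|) * (`|s| * (b * `|k|)).
  have -> : e = d * (2 * C) by rewrite /d divfK// gt_eqF// mulr_gt0.
  by rewrite /C; ring.
have sb h' : `|s *: br x h'| <= `|s| * (b * `|h'|) by rewrite normrZ ler_wpM2l.
have a1d h' := le_trans (a1s h') (ler_wpM2r (normr_ge0 h') d1d).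
have a2d h' := le_trans (a2s h') (ler_wpM2r (normr_ge0 h') d1d).
do 3!(apply: le_trans (ler_normD _ _) _; apply: lerD;
  last by apply: le_trans (pt_mul_norm _ _ _) _; exact: ler_pM).
by apply: le_trans (pt_mul_norm _ _ _) _; exact: ler_pM.
Qed.

End TensorOperators.
(** * Multiplicative bivectors on local groups *)

Section LocalPoisson.
Context (R : realType) (K : numFieldType) (hK : real_or_complex R K).
Context (E : completeNormedModType K) (e : E) (m : E * E -> E) (S : set (E * E)).
Context (oS : open S) (sm : smooth_on S m) (See : S (e, e)).
Context (mr : \forall u \near e, m (u, e) = u) (ml : \forall v \near e, m (e, v) = v).
Context (T : projTensor E E) (p : E -> T) (D : set E).
Context (oD : open D) (De : D e) (sp : smooth_on D p).
Context (skew_p : forall u, skew_symmetric (p u)).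
Context (mul_p : \forall q \near (e, e), p (m q) =
  pt_map T (fun h => 'd m q (h, 0)) (fun h => 'd m q (h, 0)) (p q.1) +
  pt_map T (fun h => 'd m q (0, h)) (fun h => 'd m q (0, h)) (p q.2)).

Local Notation delta := ('d p e : E -> T).
Local Notation B := (mixed_diff e m).
Local Notation br := (local_bracket e m).

Let dp : differentiable p e. Proof. exact (smooth_diff sp De). Qed.
Let bdelta : blin delta. Proof. exact: blin_diff dp. Qed.

Let d1id : (fun h => 'd m (e, e) (h, 0)) = id.
Proof. by apply/funext; exact: nbhs_singleton (diff_right_unit oS sm See mr). Qed.

Let d1h h : 'd m (e, e) (h, 0) = h.
Proof. exact (congr1 (fun f => f h) d1id). Qed.

Let d2id : (fun h => 'd m (e, e) (0, h)) = id.
Proof. by apply/funext; exact: nbhs_singleton (diff_left_unit oS sm See ml). Qed.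

Let d2h h : 'd m (e, e) (0, h) = h.
Proof. exact (congr1 (fun f => f h) d2id). Qed.

Lemma poisson_unit : p e = 0.
Proof.
have := nbhs_singleton mul_p; rewrite d1id d2id !pt_map_id (nbhs_singleton mr) /=.
by move=> /eqP; rewrite -subr_eq subrr eq_sym => /eqP.
Qed.

Lemma skew_delta x : skew_symmetric (delta x).
Proof.
have [bf _] := pt_flip_spec T.
have [df fE] := linear_differential (p e) bf.1 bf.2.
have := differential_comp x dp df; rewrite fE /skew_symmetric => <-.
have -> : 'd (fun y => pt_flip (p y)) e = 'd (- p) e :> (E -> T).
  apply: near_diff_eq; last exact: differentiableN.
  by near=> u; rewrite skew_p.
by rewrite diffN.
Unshelve. all: by end_near. Qed.

(** [i] stands for inversion in the chart. The operators are the identity at [e], where [p]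
    vanishes, so their variation does not contribute. *)
Lemma trivialized_diff (i : E -> E) : {for e, continuous i} -> i e = e ->
  let Delta u := pt_map T (fun h => 'd m (u, i u) (h, 0))
                          (fun h => 'd m (u, i u) (h, 0)) (p u) in
  differentiable Delta e /\ 'd Delta e = delta :> (E -> T).
Proof.
move=> ci ie Delta.
pose J u h := 'd m (u, i u) (h, 0).
have ciu : {for e, continuous (fun u => (u, i u))}.
  by apply: cvg_pair => //; exact: cvg_id.
have near_ci Q : (\forall q \near (e, e), Q q) -> \forall u \near e, Q (u, i u).
  by move=> nQ; apply: (ciu Q); rewrite /= ie.
have bJ : \forall u \near e, blin (J u).
  have := near_ci _ (near_open_set oS See); apply: filterS => u Su.
  exact: blin_comp (blin_diff (smooth_diff sm Su)) (blin_inl E E).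
have Je : J e = id by rewrite /J ie d1id.
have GE t : pt_map T (J e) (J e) t = t by rewrite Je pt_map_id.
have [|||d1 d2] := @diff_apply_at_zero K E T T (fun u t => pt_map T (J u) (J u) t) p e
  poisson_unit dp.
- by apply: filterS bJ => u bu; exact: (pt_map_spec T T bu bu).1.1.
- by rewrite (_ : (fun t => _) = id) ?funeqE//; move=> t; exact: cvg_id.
- move=> d d0.
  (* Both operators are bounded by 2, so [pt_map_near] yields the constant [2 * 2 * d']. *)
  pose d' : K := Num.min 1 (d / 4).
  have d40 : 0 < d / 4 by rewrite divr_gt0.
  have d'0 : 0 < d' by rewrite /d' /Num.min; case: ifP.
  have d'1 : d' <= 1 by rewrite comparable_ge_min ?lexx// real_comparable// gtr0_real.
  have d'd : d' <= d / 4.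
    by rewrite comparable_ge_min ?lexx ?orbT// real_comparable// gtr0_real.
  have opJ : \forall u \near e, forall h, `|J u h - h| <= d' * `|(h, 0 : E)|.
    have := near_ci (fun q => forall h, `|'d m q h - 'd m (e, e) h| <= d' * `|h|)
      (diff_op_continuous oS sm See d'0).
    apply: filterS => u opu h.
    exact: (eq_ind _ (fun y => `|J u h - y| <= d' * `|(h, 0 : E)|) (opu (h, 0)) _ (d1h h)).
  apply: filterS (filterI opJ bJ) => u [opu bu] t.
  refine (eq_ind_r (fun y => `|pt_map T (J u) (J u) t - y| <= d * `|t|) _ (GE t)).
  have Jh h : `|J u h - h| <= d' * `|h|.
    apply: le_trans (opu h) _; rewrite ler_wpM2l ?(ltW d'0)//.
    by apply: le_trans (norm_pair_le _ _) _; rewrite normr0 addr0.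
  have J2 h : `|J u h| <= 2 * `|h|.
    have -> : J u h = (J u h - h) + h by rewrite subrK.
    apply: le_trans (ler_normD _ _) _.
    have -> : 2 * `|h| = `|h| + `|h| by ring.
    by rewrite lerD2r; apply: le_trans (Jh h) _; rewrite ler_piMl.
  have id2 (h : E) : `|id h| <= 2 * `|h| by rewrite ler_peMl// ler1n.
  have := pt_map_near bu (@blin_id _ E) (ler0n K 2) (ltW d'0) J2 id2 Jh t.
  rewrite pt_map_id => /le_trans; apply; rewrite ler_wpM2r//.
  apply: (@le_trans _ _ (2 * 2 * (d / 4))); first by rewrite ler_wpM2l.
  by rewrite le_eqVlt; apply/orP; left; apply/eqP; field.
- split; first exact d1.
  exact (eq_trans d2 (funext (fun x => GE (delta x)))).
Qed.

Section Dual.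
Context (jacobi_p : forall alpha beta gamma : E -> K^o,
  blin alpha -> blin beta -> blin gamma -> \forall u \near e,
  pt_form alpha (pt_form beta gamma \o 'd p u) (p u) +
  pt_form beta (pt_form gamma alpha \o 'd p u) (p u) +
  pt_form gamma (pt_form alpha beta \o 'd p u) (p u) = 0).

(** [J u] is a functional depending on [u], applied to [p u]. Since [p e = 0], its derivative at [x]
    is the double bracket of [alpha] with that of [beta] and [gamma]. *)
Lemma jacobi_term_diff (alpha beta gamma : E -> K^o) :
  blin alpha -> blin beta -> blin gamma ->
  let J u : K^o := pt_form alpha (pt_form beta gamma \o 'd p u) (p u) in
  differentiable J e /\ forall x, 'd J e x =
    pt_form alpha (pt_form beta gamma \o delta) (delta x).
Proof.
move=> ba bb bg J; have [bphi _] := pt_form_spec T bb bg.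
have bpd : \forall u \near e, blin ((pt_form beta gamma : T -> K^o) \o 'd p u).
  apply: filterS (near_open_set oD De) => u Du.
  exact: blin_comp bphi (blin_diff (smooth_diff sp Du)).
have bpe := nbhs_singleton bpd.
have [|||d1 d2] := @diff_apply_at_zero K E T K^o
  (fun u t => pt_form alpha (pt_form beta gamma \o 'd p u) t) p e poisson_unit dp.
- by apply: filterS bpd => u bu; exact: (pt_form_spec T ba bu).1.1.
- exact: (pt_form_spec T ba bpe).1.2.
- move=> d d0; have [a a0 Aa] := blin_bound ba; have [c c0 Cc] := blin_bound bphi.
  have d'0 : 0 < d / (a * c) by rewrite divr_gt0// mulr_gt0.
  apply: filterS2 (diff_op_continuous oD sp De d'0) bpd => u opu bu t.
  have bD := blinB bu bpe.
  have -> : pt_form alpha ((pt_form beta gamma : T -> K^o) \o 'd p u) t -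
    pt_form alpha ((pt_form beta gamma : T -> K^o) \o 'd p e) t =
    pt_form alpha (fun h => ((pt_form beta gamma : T -> K^o) \o 'd p u) h -
      ((pt_form beta gamma : T -> K^o) \o 'd p e) h) t.
    have lin := pt_form_linr (-1) t ba bpe bu.
    rewrite [LHS]addrC -[X in X + _]scaleN1r -lin.
    by congr (pt_form _ _ _); apply/funext => h; rewrite fctE /= scaleN1r addrC.
  have dc0 : 0 <= c * (d / (a * c)) by rewrite mulr_ge0// ltW.
  have bnd h : `|((pt_form beta gamma : T -> K^o) \o 'd p u) h -
      ((pt_form beta gamma : T -> K^o) \o 'd p e) h| <= c * (d / (a * c)) * `|h|.
    rewrite /= -(linB bphi.1) -mulrA; apply: le_trans (Cc _) _.
    by rewrite ler_wpM2l ?(ltW c0).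
  have := pt_form_bound ba bD (ltW a0) dc0 Aa bnd t.
  by rewrite (_ : a * (c * (d / (a * c))) = d)//; field; rewrite !gt_eqF.
- by split=> // x; rewrite d2.
Qed.

Lemma dual_bracket_lie : lie_bracket_on (@dual K E) (dual_bracket delta).
Proof.
have bD (a b : E -> K^o) : blin a -> blin b -> blin (dual_bracket delta a b).
  by move=> ba bb; exact: blin_comp (pt_form_spec T ba bb).1 bdelta.
split.
- by move=> a b; exact: bD.
- by move=> k a b c da db dc; apply/funext => x; exact: pt_form_linl.
- by move=> k a b c da db dc; apply/funext => x; exact: pt_form_linr.
(* Skew-symmetry makes the value equal to its opposite, and 2 is invertible. *)
- move=> a da; apply/funext => x; rewrite /dual_bracket.
  have := skew_pt_form da da (skew_delta x) => /eqP.
  by rewrite -addr_eq0 -mulr2n mulrn_eq0 /= => /eqP.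
move=> a b c da db dc; apply/funext => x.
have [d1 d1E] := jacobi_term_diff da db dc.
have [d2 d2E] := jacobi_term_diff db dc da.
have [d3 d3E] := jacobi_term_diff dc da db.
pose J (a' b' c' : E -> K^o) u : K^o := pt_form a' (pt_form b' c' \o 'd p u) (p u).
have d12 : differentiable (fun u => J a b c u + J b c a u) e := differentiableD d1 d2.
have d123 : differentiable (fun u => J a b c u + J b c a u + J c a b u) e :=
  differentiableD d12 d3.
have sum0 : \forall u \near e, J a b c u + J b c a u + J c a b u = 0 :=
  jacobi_p da db dc.
have dE := near_diff_eq (g := fun=> 0) sum0 d123.
apply: (eq_trans _ (differential_cst (0 : K^o) e x)).
apply: (eq_trans _ (esym (congr1 (fun f : E -> K^o => f x) dE))).
apply: (eq_trans _ (esym (differential_add x d12 d3))).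
apply: (congr2 (fun s t : K^o => s + t) _ (esym (d3E x))).
apply: (eq_trans _ (esym (differential_add x d1 d2))).
exact: (congr2 (fun s t : K^o => s + t) (esym (d1E x)) (esym (d2E x))).
Qed.

End Dual.

(** The second difference of [m] along the two axes: the unit laws give the other three corners
    exactly. *)
Lemma mul_second_order x y :
  little 2 (fun s => m (e + s *: x, e + s *: y) - e - s *: (x + y) - s ^+ 2 *: B x y).
Proof.
have sd := @second_difference R K hK _ _ m (e, e) (x, 0) (0, y)
  (smooth_near_diff oS sm See) (dir_diff oS sm (0, y) See).
apply: little_ext sd; have mee := nbhs_singleton mr.
have xE s : (e, e) + s *: (x, 0) = (e + s *: x, e) :> E * E.
  by apply: injective_projections; rewrite /= ?scaler0 ?addr0.
have yE s : (e, e) + s *: (0, y) = (e, e + s *: y) :> E * E.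
  by apply: injective_projections; rewrite /= ?scaler0 ?addr0.
have xyE s : (e + s *: x, e) + s *: (0, y) = (e + s *: x, e + s *: y) :> E * E.
  by apply: injective_projections; rewrite /= ?scaler0 ?addr0.
apply: filterS2 (near0_scale x mr) (near0_scale y ml) => s mx my.
rewrite xE yE xyE mx my mee -/(diff2 m (e, e) (x, 0) (0, y)) -/(B x y).
lmod K.
Qed.

Lemma near_lines x y (Q : E * E -> Prop) : (\forall q \near (e, e), Q q) ->
  \forall s \near (0 : K), Q (e + s *: x, e + s *: y).
Proof.
move=> nQ; have := near0_scale (x, y) nQ; apply: filterS => s.
congr Q.
Qed.

(** [D_1 m = 1 + s B(_, y)] along the line: by [diff2_unit], the displacement [x] does not enter at
    this order. *)
Lemma op_first_order_fst x y :
  op_little (fun s h => 'd m (e + s *: x, e + s *: y) (h, 0) - h - s *: B h y).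
Proof.
move=> d d0; have := diff_op_first_order hK (x, y) oS sm See (blin_inl E E) d0.
apply: filterS => s H h.
have E2 : diff2 m (e, e) (x, y) (h, 0) = B h y.
  apply: (eq_trans (diff2_unit hK oS sm See mr ml x y h 0)).
  by rewrite (lin0 (mixed_diff_linr hK oS sm See x).1) add0r.
refine (eq_ind _ (fun k => `|'d m (e + s *: x, e + s *: y) (h, 0) - k - s *: B h y|
  <= d * `|s| * `|h|) _ _ (d1h h)).
exact (eq_ind _ (fun k => `|'d m (e + s *: x, e + s *: y) (h, 0) -
  'd m (e, e) (h, 0) - s *: k| <= d * `|s| * `|h|) (H h) _ E2).
Qed.

Lemma op_first_order_snd x y :
  op_little (fun s h => 'd m (e + s *: x, e + s *: y) (0, h) - h - s *: B x h).
Proof.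
move=> d d0; have := diff_op_first_order hK (x, y) oS sm See (blin_inr E E) d0.
apply: filterS => s H h.
have E2 : diff2 m (e, e) (x, y) (0, h) = B x h.
  apply: (eq_trans (diff2_unit hK oS sm See mr ml x y 0 h)).
  by rewrite (lin0 (mixed_diff_linl oS sm See y).1) addr0.
refine (eq_ind _ (fun k => `|'d m (e + s *: x, e + s *: y) (0, h) - k - s *: B x h|
  <= d * `|s| * `|h|) _ _ (d2h h)).
exact (eq_ind _ (fun k => `|'d m (e + s *: x, e + s *: y) (0, h) -
  'd m (e, e) (0, h) - s *: k| <= d * `|s| * `|h|) (H h) _ E2).
Qed.

Lemma local_bracket_blin x : blin (br x).
Proof.
exact (blinB (mixed_diff_linr hK oS sm See x) (mixed_diff_linl oS sm See x)).
Qed.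

(* Compare p (m (u, v)) and p (m (v, u)) to second order along u = e + s x,
   v = e + s y. *)
Lemma local_cocycle x y :
  delta (br x y) = pt_ad br x (delta y) - pt_ad br y (delta x).
Proof.
apply/subr0_eq/(@little_cst _ 2).
set w := _ - _.
pose a s := m (e + s *: x, e + s *: y); pose b s := m (e + s *: y, e + s *: x).
have lab : little 2 (fun s => a s - b s - s ^+ 2 *: br x y).
  apply: little_ext (littleB (mul_second_order x y) (mul_second_order y x)).
  by near=> s; rewrite /a /b /local_bracket; lmod K.
have cm : {for (e, e), continuous m}.
  exact/differentiable_continuous/(smooth_diff sm See).
have mee := nbhs_singleton mr.
have near_m (x' y' : E) Q : (\forall u \near e, Q u) ->
    \forall s \near (0 : K), Q (m (e + s *: x', e + s *: y')).
  move=> nQ; apply: (@near_lines x' y' (fun q => Q (m q))).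
  by apply: (cm Q); rewrite mee.
have lp : little 2 (fun s => p (a s) - p (b s) - s ^+ 2 *: delta (br x y)).
  (* Both [a s] and [b s] move, at distance O(s^2) from each other. Strict differentiability gives
     o(s^2), where differentiability at [e] alone would give o(s). *)
  have l1 : little 2 (fun s => p (a s) - p (b s) - delta (a s - b s)).
    pose c : K := `|br x y| + 1.
    have c0 : 0 < c by rewrite ltr_wpDl.
    move=> d d0; have [r r0 rP] := smooth_strict hK oD sp De (divr_gt0 d0 c0).
    have nr : \forall u \near e, `|u - e| < r by apply/near_normP; exists r.
    apply: filterS (filterI (near_m x y _ nr) (filterI (near_m y x _ nr) (lab 1 ltr01))).
    move=> s [ar [br' labs]]; apply: le_trans (rP _ _ ar br') _.
    rewrite mulrAC ler_pdivrMr// -mulrA ler_wpM2l ?(ltW d0)//.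
    have -> : m (e + s *: x, e + s *: y) - m (e + s *: y, e + s *: x) =
      (a s - b s - s ^+ 2 *: br x y) + s ^+ 2 *: br x y by rewrite subrK.
    apply: le_trans (ler_normD _ _) _; rewrite /c mulrDr mulr1 addrC.
    by rewrite normrZ normrX lerD2l; rewrite mul1r in labs.
  apply: little_ext (littleD l1 (little_blin bdelta lab)).
  near=> s; rewrite (linB bdelta.1 (a s - b s)) (linZ bdelta.1); lmod K.
have bJ1 x' y' : \forall s \near (0 : K),
    blin (fun h => 'd m (e + s *: x', e + s *: y') (h, 0)).
  apply: filterS (near_lines x' y' (near_open_set oS See)) => s Ss.
  exact: blin_comp (blin_diff (smooth_diff sm Ss)) (blin_inl E E).
have bJ2 x' y' : \forall s \near (0 : K),
    blin (fun h => 'd m (e + s *: x', e + s *: y') (0, h)).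
  apply: filterS (near_lines x' y' (near_open_set oS See)) => s Ss.
  exact: blin_comp (blin_diff (smooth_diff sm Ss)) (blin_inr E E).
(* The two operators that act on [p (e + s y')]: one from [D_2] in [p (m (u, v))], one from [D_1] in
   the product taken in the other order. *)
have op x' y' : op_little (fun s (t : T) =>
    pt_map T (fun h => 'd m (e + s *: x', e + s *: y') (0, h))
      (fun h => 'd m (e + s *: x', e + s *: y') (0, h)) t -
    pt_map T (fun h => 'd m (e + s *: y', e + s *: x') (h, 0))
      (fun h => 'd m (e + s *: y', e + s *: x') (h, 0)) t - s *: pt_ad br x' t).
  apply: (@pt_map_first_order _ _ T (fun s h => 'd m (e + s *: x', e + s *: y') (0, h))
    (fun s h => 'd m (e + s *: y', e + s *: x') (h, 0)) (B x') (B ^~ x')).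
  - exact: bJ2.
  - exact: bJ1.
  - exact (mixed_diff_linr hK oS sm See x').
  - exact (mixed_diff_linl oS sm See x').
  - exact: local_bracket_blin.
  - by [].
  - exact: op_first_order_snd.
  - exact: op_first_order_fst.
have pe0 := poisson_unit.
have lpx x' : little 1 (fun s => p (e + s *: x') - s *: delta x').
  by apply: little_ext (little_diff x' dp); near=> s; rewrite pe0 subr0.
have badx x' := (pt_ad_spec T (local_bracket_blin x')).1.
(* Hence the contribution of [p (e + s y')] is [s^2 *: pt_ad br x' (delta y')] up to o(s^2). *)
have lq x' y' := littleD (op_little_apply (op x' y') (lpx y'))
  (little_scale (little_blin (badx x') (lpx y'))).
apply: little_ext (littleB (littleB (lq x y) (lq y x)) lp).
apply: filterS (filterI (near_lines x y mul_p) (near_lines y x mul_p)) => s [mxy myx].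
rewrite /a /b mxy myx /= !(linB (badx _).1) !(linZ (badx _).1) /w.
lmod K.
Unshelve. all: by end_near. Qed.

End LocalPoisson.
(** * Banach manifolds and Lie groups in charts *)

Section Charts.
Context (K : numFieldType) (M : topologicalType) (E : completeNormedModType K).
Context (X : banachManifold M E).
Implicit Types (c d : chart M E) (a : M).

Lemma cinv_range c u : (c @` cdom c) u -> cdom c (cinv c u) /\ c (cinv c u) = u.
Proof. by move=> [a ca <-]; rewrite cmapK. Qed.

Lemma near_range c a : cdom c a -> \forall u \near c a, (c @` cdom c) u.
Proof.
by move=> ca; apply: open_nbhs_nbhs; split; [exact: crange_open|exists a].
Qed.

Lemma near_cinv c a (Q : M -> Prop) : cdom c a -> (\forall b \near a, Q b) ->
  \forall u \near c a, Q (cinv c u).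
Proof.
move=> ca nQ; have cr : (c @` cdom c) (c a) by exists a.
by apply: (cinv_continuous cr); rewrite cmapK.
Qed.

Lemma near_cdom c a : cdom c a -> \forall b \near a, cdom c b.
Proof. by move=> ca; apply: open_nbhs_nbhs; split=> //; exact: cdom_open. Qed.

Lemma transition_diff c d a : atlas X c -> atlas X d -> cdom c a -> cdom d a ->
  differentiable (fun u => d (cinv c u)) (c a).
Proof.
move=> Xc Xd ca da; apply: (smooth_diff (atlas_compatible Xc Xd)).
by exists a.
Qed.

Lemma change_source (W : normedModType K) (f : M -> W) c d a :
  atlas X c -> atlas X d -> cdom c a -> cdom d a ->
  differentiable (fun u => f (cinv d u)) (d a) ->
  differentiable (fun u => f (cinv c u)) (c a) /\
  forall h, 'd (fun u => f (cinv c u)) (c a) h =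
    'd (fun u => f (cinv d u)) (d a) ('d (fun u => d (cinv c u)) (c a) h).
Proof.
move=> Xc Xd ca da df; have dt := transition_diff Xc Xd ca da.
have fE : \forall u \near c a, f (cinv d (d (cinv c u))) = f (cinv c u).
  by apply: filterS (near_cinv ca (near_cdom da)) => u du; rewrite cmapK.
have cK := cmapK ca.
have df' : differentiable (fun u => f (cinv d u)) (d (cinv c (c a))) by rewrite cK.
have [d1 d1E] := near_eq_diff fE (differentiable_comp dt df').
split=> // h; rewrite d1E; have := differential_comp h dt df'.
by rewrite cK.
Qed.

Lemma change_target (V : normedModType K) (f : V -> M) c d x :
  {for x, continuous f} -> atlas X c -> atlas X d -> cdom c (f x) -> cdom d (f x) ->
  differentiable (fun v => c (f v)) x ->
  differentiable (fun v => d (f v)) x /\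
  forall h, 'd (fun v => d (f v)) x h =
    'd (fun u => d (cinv c u)) (c (f x)) ('d (fun v => c (f v)) x h).
Proof.
move=> cf Xc Xd cx dx df; have dt := transition_diff Xc Xd cx dx.
have fE : \forall v \near x, d (cinv c (c (f v))) = d (f v).
  have : \forall v \near x, cdom c (f v) by apply: (cf (cdom c)); exact: near_cdom.
  by apply: filterS => v cv; rewrite cmapK.
have [d1 d1E] := near_eq_diff fE (differentiable_comp df dt).
by split=> // h; rewrite d1E; exact: (differential_comp h df dt).
Qed.

Lemma tangent_chart_blin c a : atlas X c -> cdom c a -> blin (tangent_chart X c a).
Proof.
move=> Xc ca; apply: blin_diff; apply: transition_diff => //.
  exact: chart_at_atlas.
exact: chart_at_dom.
Qed.

Lemma tangent_chart_id a : tangent_chart X (chart_at X a) a = id.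
Proof.
have [di iE] := differential_id (chart_at X a a); rewrite -iE.
apply: near_diff_eq => //; apply: filterS (near_range (chart_at_dom X a)) => u.
by move=> /cinv_range[_ uE]; rewrite /= uE.
Qed.

Lemma tangent_map_chart (g : M -> M) c a : {for a, continuous g} ->
  atlas X c -> cdom c a -> cdom c (g a) ->
  differentiable (fun u => c (g (cinv c u))) (c a) ->
  blin (tangent_map X X g a) /\ forall h,
  tangent_chart X c (g a) (tangent_map X X g a h) =
  'd (fun u => c (g (cinv c u))) (c a) (tangent_chart X c a h).
Proof.
move=> cg Xc ca cga dg.
have Xa := chart_at_atlas X a; have aa := chart_at_dom X a.
have Xga := chart_at_atlas X (g a); have gaga := chart_at_dom X (g a).
have [d1 d1E] := change_source (f := fun b => c (g b)) Xa Xc aa ca dg.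
have aK := cmapK aa.
have cf : {for chart_at X a a, continuous (fun u => g (cinv (chart_at X a) u))}.
  apply: (@continuous_comp _ _ _ (cinv (chart_at X a)) g).
    by apply: cinv_continuous; exists a.
  by rewrite aK.
have [d2 d2E] := change_target cf Xc Xga
  (eq_ind_r (fun b => cdom c (g b)) cga aK)
  (eq_ind_r (fun b => cdom (chart_at X (g a)) (g b)) gaga aK) d1.
have [d3 d3E] := change_target cf Xga Xc
  (eq_ind_r (fun b => cdom (chart_at X (g a)) (g b)) gaga aK)
  (eq_ind_r (fun b => cdom c (g b)) cga aK) d2.
split; first exact (blin_diff d2).
move=> h; have := d3E h; rewrite d1E aK => e3.
exact (esym e3).
Qed.

Section ConstantForm.
Context (c : chart M E) (Xc : atlas X c) (alpha : E -> K^o) (ba : blin alpha).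

(** The differential of the local function [alpha \o c]. *)
Definition constant_form (a : M) (h : E) : K^o := alpha (tangent_chart X c a h).

Lemma form_coord_constant d u k : atlas X d -> (d @` (cdom d `&` cdom c)) u ->
  form_coord X d constant_form u k = alpha ('d (fun u => c (cinv d u)) u k).
Proof.
move=> Xd [a [da ca] <-]; rewrite /form_coord /constant_form cmapK//.
have [_ dE] := change_source (f := c) Xd (chart_at_atlas X a) da (chart_at_dom X a)
  (transition_diff (chart_at_atlas X a) Xc (chart_at_dom X a) ca).
congr alpha; exact (esym (dE k)).
Qed.

Lemma constant_form_closed (R : realType) (hK : real_or_complex R K) :
  closed_local_form X (cdom c) constant_form.
Proof.
have oO d : open (d @` (cdom d `&` cdom c)).
  by apply: chart_image_open; exact: cdom_open.
split.
  split=> [a ca|d Xd].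
    exact: blin_comp ba (tangent_chart_blin Xc ca).
  (* In another chart the form is [alpha] after the tangent map of the change of charts, hence
     smooth. *)
  have st := smooth_tangent (atlas_compatible Xd Xc).
  have oT := open_tangent (oO d).
  have sa := smooth_blin setT ba.
  have sc := smooth_comp openT oT (fun _ _ => I) sa st.
  apply: smooth_ext sc => //; move=> [u k] [/= Ou _].
  by rewrite form_coord_constant.
move=> a ca h k; rewrite /exterior_derivative.
have Xa := chart_at_atlas X a; have aa := chart_at_dom X a.
have Oa : (chart_at X a @` (cdom (chart_at X a) `&` cdom c)) (chart_at X a a).
  by exists a.
have st := atlas_compatible Xa Xc.
have key h' k' : 'd (form_coord X (chart_at X a) constant_form ^~ k') (chart_at X a a) h' =
    alpha (diff2 (fun u => c (cinv (chart_at X a) u)) (chart_at X a a) h' k').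
  have d1 := dir_diff (oO (chart_at X a)) st k' Oa.
  have [d2 d2E] := linear_differential
    ('d (c \o cinv (chart_at X a)) (chart_at X a a) k') ba.1 ba.2.
  have fE : \forall u \near chart_at X a a,
      alpha ('d (c \o cinv (chart_at X a)) u k') =
      form_coord X (chart_at X a) constant_form u k'.
    have := near_open_set (oO (chart_at X a)) Oa.
    by apply: filterS => u Ou; rewrite form_coord_constant.
  have [_ ->] := near_eq_diff fE (differentiable_comp d1 d2).
  have := differential_comp h' d1 d2; rewrite d2E; exact.
rewrite !key; have := diff2_sym hK (oO (chart_at X a)) st h k Oa => ->.
by rewrite subrr.
Qed.

End ConstantForm.
End Charts.

(** * The group and its bivector in the chart at the unit *)

Section LieGroupChart.
Context (R : realType) (K : numFieldType) (hK : real_or_complex R K).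
Context (E : completeNormedModType K) (G : topologicalGroupCarrier).
Context (X : banachManifold G E) (hG : banach_lie_group X).

Let c : chart G E := chart_at X 1%g.
Let e : E := c 1%g.
Let Xc : atlas X c. Proof. exact: chart_at_atlas. Qed.
Let c1 : cdom c 1%g. Proof. exact: chart_at_dom. Qed.

Definition chart_mul (q : E * E) : E := c (cinv c q.1 * cinv c q.2)%g.

(** Exactly the set on which [smooth_map] asserts the smoothness of the product between these
    charts. *)
Definition chart_mul_dom : set (E * E) :=
  prod_chart c c @` (cdom (prod_chart c c) `&` @group_mul G @^-1` cdom c).

Local Notation m := chart_mul.
Local Notation S := chart_mul_dom.

Lemma mul_continuous : continuous (@group_mul G).
Proof. by have [[]] := hG. Qed.

Lemma inv_continuous : continuous (@group_inv G).
Proof. by have [_ []] := hG. Qed.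

Lemma mull_continuous (a : G) : continuous (fun b : G => group_mul (a, b)).
Proof.
move=> b; apply: (@continuous_comp _ _ _ (fun b : G => (a, b)) (@group_mul G)).
  by apply: cvg_pair; [exact: cvg_cst|exact: cvg_id].
exact: mul_continuous.
Qed.

Lemma mulr_continuous (b : G) : continuous (fun a : G => group_mul (a, b)).
Proof.
move=> a; apply: (@continuous_comp _ _ _ (fun a : G => (a, b)) (@group_mul G)).
  by apply: cvg_pair; [exact: cvg_id|exact: cvg_cst].
exact: mul_continuous.
Qed.

Lemma chart_mul_dom_open : open S.
Proof.
apply: chart_image_open; apply: open_comp; last exact: cdom_open.
by move=> p _; exact: mul_continuous.
Qed.

Lemma chart_mul_smooth : smooth_on S m.
Proof.
have [[_ sm] _] := hG.
apply: (sm (prod_chart c c) c _ Xc).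
by exists c, c.
Qed.

Lemma chart_mul_domP q : S q -> [/\ cdom c (cinv c q.1), cdom c (cinv c q.2),
  cdom c (group_mul (cinv c q.1, cinv c q.2)), c (cinv c q.1) = q.1 &
  c (cinv c q.2) = q.2].
Proof. by move=> [[a b] [/= [/= ca cb] cab] <-] /=; rewrite !cmapK. Qed.

Lemma chart_mul_dom_mem a b : cdom c a -> cdom c b -> cdom c (group_mul (a, b)) ->
  S (c a, c b).
Proof. by move=> ca cb cab; exists (a, b). Qed.

Lemma chart_mul_dom_unit : S (e, e).
Proof. by apply: chart_mul_dom_mem => //; rewrite /group_mul mulg1. Qed.

Lemma chart_mulg1 : \forall u \near e, m (u, e) = u.
Proof.
apply: filterS (near_range c1) => u /cinv_range[_ uE].
by rewrite /chart_mul /= /e cmapK// mulg1.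
Qed.

Lemma chart_mul1g : \forall u \near e, m (e, u) = u.
Proof.
apply: filterS (near_range c1) => u /cinv_range[_ uE].
by rewrite /chart_mul /= /e cmapK// mul1g.
Qed.

Lemma chart_mulA : \forall u \near e, \forall v \near e, \forall w \near e,
  m (m (u, v), w) = m (u, m (v, w)).
Proof.
have nS : \forall u \near e, \forall v \near e, S (u, v).
  exact (near_curry (near_open_set chart_mul_dom_open chart_mul_dom_unit)).
have := nS; apply: filterS => u nSu.
apply: filterS (filterI nSu nS) => v [Suv nSv].
apply: filterS nSv => w Svw.
(* Only the inner products have to lie in the chart domain: the outer ones are [c] applied to the
   same group element. *)
have [_ _ cuv _ _] := chart_mul_domP Suv; have [_ _ cvw _ _] := chart_mul_domP Svw.
rewrite /chart_mul /= in cuv cvw *.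
rewrite (cmapK (cuv : cdom c (cinv c u * cinv c v)%g)).
by rewrite (cmapK (cvw : cdom c (cinv c v * cinv c w)%g)) mulgA.
Qed.

Lemma tangent_mulr a b : cdom c a -> cdom c b -> cdom c (group_mul (a, b)) ->
  blin (tangent_map X X (fun g => group_mul (g, b)) a) /\ forall h,
  tangent_chart X c (group_mul (a, b)) (tangent_map X X (fun g => group_mul (g, b)) a h) =
  'd m (c a, c b) (tangent_chart X c a h, 0).
Proof.
move=> ca cb cab.
have dm := smooth_diff chart_mul_smooth (chart_mul_dom_mem ca cb cab).
have [d1 d1E] := diff_partial1 dm.
have fE : (fun u => m (u, c b)) = (fun u => c (group_mul (cinv c u, b))).
  by apply/funext => u; rewrite /chart_mul /= cmapK.
rewrite fE in d1 d1E.
have [b1 E1] := tangent_map_chart (@mulr_continuous b a) Xc ca cab d1.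
by split=> // h; exact (eq_trans (E1 h) (d1E _)).
Qed.

Lemma tangent_mull a b : cdom c a -> cdom c b -> cdom c (group_mul (a, b)) ->
  blin (tangent_map X X (fun g => group_mul (a, g)) b) /\ forall h,
  tangent_chart X c (group_mul (a, b)) (tangent_map X X (fun g => group_mul (a, g)) b h) =
  'd m (c a, c b) (0, tangent_chart X c b h).
Proof.
move=> ca cb cab.
have dm := smooth_diff chart_mul_smooth (chart_mul_dom_mem ca cb cab).
have [d1 d1E] := diff_partial2 dm.
have fE : (fun u => m (c a, u)) = (fun u => c (group_mul (a, cinv c u))).
  by apply/funext => u; rewrite /chart_mul /= cmapK.
rewrite fE in d1 d1E.
have [b1 E1] := tangent_map_chart (@mull_continuous a b) Xc cb cab d1.
by split=> // h; exact (eq_trans (E1 h) (d1E _)).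
Qed.

Lemma left_invariant_field_chart (y : E) u : S (u, e) ->
  tangent_chart X c (cinv c u) (left_invariant_field X y (cinv c u)) =
  left_field e m y u.
Proof.
move=> Su; have [cu _ cu1 uE _] := chart_mul_domP Su.
rewrite /= in cu cu1 uE; rewrite /e (cmapK c1) in cu1.
have [_ tE] := tangent_mull cu c1 cu1.
have := tE y; rewrite uE (tangent_chart_id X 1%g).
by rewrite {1}/group_mul /= mulg1.
Qed.

Lemma left_invariant_field_unit (y : E) : left_invariant_field X y 1%g = y.
Proof.
have := left_invariant_field_chart y chart_mul_dom_unit.
rewrite /e (cmapK c1) (tangent_chart_id X 1%g) /= => ->.
exact (left_field_unit chart_mul_dom_open chart_mul_smooth chart_mul_dom_unit chart_mul1g y).
Qed.

(** In the chart, the left invariant field of [y] has derivative [B x y] at the unit along [x]. *)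
Lemma lie_algebra_bracketE : lie_algebra_bracket X = local_bracket e m.
Proof.
have coordE x y : 'd (fun u => tangent_chart X c (cinv c u)
    (left_invariant_field X y (cinv c u))) e x = mixed_diff e m x y.
  have [d1 d1E] := left_field_diff chart_mul_dom_open chart_mul_smooth y chart_mul_dom_unit.
  have fE : \forall u \near e, left_field e m y u = tangent_chart X c (cinv c u)
      (left_invariant_field X y (cinv c u)).
    have nS := near_curry (near_open_set chart_mul_dom_open chart_mul_dom_unit).
    by apply: filterS nS => u /nbhs_singleton Su; rewrite left_invariant_field_chart.
  have dE := near_diff_eq fE d1.
  exact (eq_trans (congr1 (fun f : E -> E => f x) dE) (d1E x)).
apply/funext => x; apply/funext => y.
rewrite /lie_algebra_bracket /vector_field_bracket !left_invariant_field_unit.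
exact (congr2 (fun a b : E => a - b) (coordE x y) (coordE y x)).
Qed.

Section Poisson.
Context (T : projTensor E E) (TT : projTensor (E * E)%type (E * E)%type) (P : G -> T).
Context (hP : poisson_lie_group X TT P).

Definition chart_bivector (u : E) : T :=
  pt_map T (tangent_chart X c (cinv c u)) (tangent_chart X c (cinv c u)) (P (cinv c u)).

Local Notation p := chart_bivector.
Local Notation D := (c @` cdom c).

Lemma skew_chart_bivector u : skew_symmetric (p u).
Proof. by have [_ [[sP _] _] _] := hP; exact: skew_pt_map. Qed.

Lemma chart_bivector_smooth : smooth_on D p.
Proof. by have [_ [[_ sP] _] _] := hP; exact: sP. Qed.

(** The tangent map of the product, restricted to the two axes, is that of a right and of a left
    translation; [prod_bivector] has no mixed part. *)
Lemma multiplicative a b : P (group_mul (a, b)) =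
  pt_map T (tangent_map X X (fun g => group_mul (g, b)) a)
           (tangent_map X X (fun g => group_mul (g, b)) a) (P a) +
  pt_map T (tangent_map X X (fun g => group_mul (a, g)) b)
           (tangent_map X X (fun g => group_mul (a, g)) b) (P b).
Proof.
have [_ _ [[_ sm] mP]] := hP.
rewrite -mP /prod_bivector /=.
set M := tangent_map (prod_manifold X X) X (@group_mul G) (a, b).
have aa := chart_at_dom X a; have bb := chart_at_dom X b.
pose ca := chart_at X a; pose cb := chart_at X b.
pose cab := chart_at X (group_mul (a, b)).
pose f q := cab (group_mul (cinv ca q.1, cinv cb q.2)).
have df : differentiable f (ca a, cb b).
  have pat : atlas (prod_manifold X X) (prod_chart ca cb).
    by exists ca, cb; split=> //; exact: chart_at_atlas.
  apply: (smooth_diff (sm _ _ pat (chart_at_atlas X (group_mul (a, b))))).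
  exists (a, b) => //; split; first by split.
  exact: chart_at_dom.
have bM : blin M by exact (blin_diff df).
have [_ d1E] := diff_partial1 df; have [_ d2E] := diff_partial2 df.
have f1E : (fun v => f (v, cb b)) = (fun v => cab (group_mul (cinv ca v, b))).
  by apply/funext => v; rewrite /f /= (cmapK bb).
have f2E : (fun v => f (ca a, v)) = (fun v => cab (group_mul (a, cinv cb v))).
  by apply/funext => v; rewrite /f /= (cmapK aa).
have M1 : M \o (fun x : E => (x, 0)) = tangent_map X X (fun g => group_mul (g, b)) a.
  apply/funext => h; apply: (eq_trans (esym (d1E h))).
  exact (congr1 (fun k : E -> E => 'd k (ca a) h) f1E).
have M2 : M \o (fun x : E => (0, x)) = tangent_map X X (fun g => group_mul (a, g)) b.
  apply/funext => h; apply: (eq_trans (esym (d2E h))).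
  exact (congr1 (fun k : E -> E => 'd k (cb b) h) f2E).
have [bMM _] := pt_map_spec TT T bM bM.
rewrite (linD bMM.1) !pt_map_comp//; try exact: blin_inl; try exact: blin_inr.
by rewrite -M1 -M2.
Qed.

(** The bundle chart at the product is applied to [multiplicative]; functoriality of [pt_map] moves
    it past the translations. *)
Lemma chart_bivector_mul q : S q -> p (m q) =
  pt_map T (fun h => 'd m q (h, 0)) (fun h => 'd m q (h, 0)) (p q.1) +
  pt_map T (fun h => 'd m q (0, h)) (fun h => 'd m q (0, h)) (p q.2).
Proof.
move=> Sq; have [ca cb cab aE bE] := chart_mul_domP Sq.
have dm := smooth_diff chart_mul_smooth Sq.
have qE : (c (cinv c q.1), c (cinv c q.2)) = q.
  by rewrite aE bE; case: q {Sq dm ca cb cab aE bE}.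
have [b1 E1] := tangent_mulr ca cb cab; have [b2 E2] := tangent_mull ca cb cab.
rewrite qE in E1 E2.
set a := cinv c q.1 in ca cab b1 E1 b2 E2 *; set b := cinv c q.2 in cb cab b1 E1 b2 E2 *.
have bt := tangent_chart_blin Xc cab.
have bta := tangent_chart_blin Xc ca; have btb := tangent_chart_blin Xc cb.
have bJ1 : blin (fun h => 'd m q (h, 0)) := blin_comp (blin_diff dm) (blin_inl E E).
have bJ2 : blin (fun h => 'd m q (0, h)) := blin_comp (blin_diff dm) (blin_inr E E).
have mqE : cinv c (m q) = group_mul (a, b) by exact: (cmapK cab).
have [btt _] := pt_map_spec T T bt bt.
have s1 : pt_map T (tangent_chart X c (group_mul (a, b)))
      (tangent_chart X c (group_mul (a, b)))
    (pt_map T (tangent_map X X (fun g => group_mul (g, b)) a)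
      (tangent_map X X (fun g => group_mul (g, b)) a) (P a)) =
    pt_map T (fun h => 'd m q (h, 0)) (fun h => 'd m q (h, 0)) (p q.1).
  apply: (eq_trans (pt_map_comp T T (P a) b1 b1 bt bt)).
  apply: (eq_trans _ (esym (pt_map_comp T T (P a) bta bta bJ1 bJ1))).
  exact (congr1 (fun A => pt_map T A A (P a)) (funext E1)).
have s2 : pt_map T (tangent_chart X c (group_mul (a, b)))
      (tangent_chart X c (group_mul (a, b)))
    (pt_map T (tangent_map X X (fun g => group_mul (a, g)) b)
      (tangent_map X X (fun g => group_mul (a, g)) b) (P b)) =
    pt_map T (fun h => 'd m q (0, h)) (fun h => 'd m q (0, h)) (p q.2).
  apply: (eq_trans (pt_map_comp T T (P b) b2 b2 bt bt)).
  apply: (eq_trans _ (esym (pt_map_comp T T (P b) btb btb bJ2 bJ2))).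
  exact (congr1 (fun A => pt_map T A A (P b)) (funext E2)).
apply: (eq_trans (congr1 (fun g =>
  pt_map T (tangent_chart X c g) (tangent_chart X c g) (P g)) mqE)).
apply: (eq_trans (congr1 (pt_map T (tangent_chart X c (group_mul (a, b)))
  (tangent_chart X c (group_mul (a, b)))) (multiplicative a b))).
exact (eq_trans (linD btt.1 _ _) (congr2 (fun s t : T => s + t) s1 s2)).
Qed.

Lemma near_chart_bivector_mul : \forall q \near (e, e), p (m q) =
  pt_map T (fun h => 'd m q (h, 0)) (fun h => 'd m q (h, 0)) (p q.1) +
  pt_map T (fun h => 'd m q (0, h)) (fun h => 'd m q (0, h)) (p q.2).
Proof.
apply: filterS (near_open_set chart_mul_dom_open chart_mul_dom_unit) => q.
exact: chart_bivector_mul.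
Qed.

Lemma range_open : open D. Proof. exact: crange_open. Qed.

Lemma range_unit : D e. Proof. by exists 1%g. Qed.

Lemma pairing_constant (alpha beta : E -> K^o) a : blin alpha -> blin beta ->
  cdom c a -> pairing P (constant_form X c alpha) (constant_form X c beta) a =
  pt_form alpha beta (p (c a)).
Proof.
move=> ba bb ca; have bt := tangent_chart_blin Xc ca.
by rewrite /chart_bivector (cmapK ca) pt_form_map.
Qed.

(** For constant forms the inner pairing is a fixed functional of [p], so its differential involves
    only that of [p]. *)
Lemma jacobi_term_constant (alpha beta gamma : E -> K^o) a : blin alpha ->
  blin beta -> blin gamma -> cdom c a ->
  jacobi_term X P (constant_form X c alpha) (constant_form X c beta)
    (constant_form X c gamma) a =
  pt_form alpha (pt_form beta gamma \o 'd p (c a)) (p (c a)).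
Proof.
move=> ba bb bg ca; have bt := tangent_chart_blin Xc ca.
have Da : D (c a) by exists a.
have dp := smooth_diff chart_bivector_smooth Da.
have [bphi _] := pt_form_spec T bb bg.
have [dphi phiE] := linear_differential (p (c a)) bphi.1 bphi.2.
pose f := pairing P (constant_form X c beta) (constant_form X c gamma).
have fE : \forall u \near c a, pt_form beta gamma (p u) = f (cinv c u).
  apply: filterS (near_range ca) => u /cinv_range[cu uE].
  by rewrite /f pairing_constant// uE.
have [d1 d1E] := near_eq_diff fE (differentiable_comp dp dphi).
have [_ d2E] := change_source (f := f) (chart_at_atlas X a) Xc (chart_at_dom X a) ca d1.
have diffE : differential X f a =
    ((pt_form beta gamma : T -> K^o) \o 'd p (c a)) \o tangent_chart X c a.
  apply/funext => h; apply: (eq_trans (d2E h)); rewrite d1E.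
  have := differential_comp (tangent_chart X c a h) dp dphi; rewrite phiE; exact.
apply: (eq_trans (congr1 (fun b : E -> K^o =>
  pt_form (constant_form X c alpha a) b (P a)) diffE)).
have pE : p (c a) = pt_map T (tangent_chart X c a) (tangent_chart X c a) (P a).
  by rewrite /chart_bivector (cmapK ca).
rewrite [in X in _ = pt_form _ _ X]pE.
exact (esym (pt_form_map T (P a) ba (blin_comp bphi (blin_diff dp)) bt bt)).
Qed.

Lemma chart_jacobi (alpha beta gamma : E -> K^o) :
  blin alpha -> blin beta -> blin gamma -> \forall u \near e,
  pt_form alpha (pt_form beta gamma \o 'd p u) (p u) +
  pt_form beta (pt_form gamma alpha \o 'd p u) (p u) +
  pt_form gamma (pt_form alpha beta \o 'd p u) (p u) = 0.
Proof.
move=> ba bb bg; have [_ [_ jP] _] := hP.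
have J := jP (cdom c) _ _ _ (@cdom_open _ _ _ c) (constant_form_closed Xc ba hK)
  (constant_form_closed Xc bb hK) (constant_form_closed Xc bg hK).
apply: filterS (near_open_set range_open range_unit) => _ [a ca <-].
by rewrite -(J a ca) !jacobi_term_constant.
Qed.

Lemma right_trivialization_skew a : skew_symmetric (right_trivialization X P a).
Proof. by have [_ [[sP _] _] _] := hP; exact: skew_pt_map. Qed.

Definition chart_inv (u : E) : E := c (group_inv (cinv c u)).

Lemma chart_inv_continuous : {for e, continuous chart_inv}.
Proof.
apply: (@continuous_comp _ _ _ (cinv c) (fun a => c (group_inv a))).
  by apply: cinv_continuous; exists 1%g.
apply: (@continuous_comp _ _ _ (@group_inv G) c); first exact: inv_continuous.
by apply: cmap_continuous; rewrite /e (cmapK c1) /group_inv invg1.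
Qed.

Lemma chart_inv_unit : chart_inv e = e.
Proof. by rewrite /chart_inv /e (cmapK c1) /group_inv invg1. Qed.

(** Right translation by the inverse of [a] ends at the unit, whose preferred chart is [c] itself,
    so no change of charts is left at the target. *)
Lemma right_trivialization_chart : \forall u \near e,
  pt_map T (fun h => 'd m (u, chart_inv u) (h, 0))
           (fun h => 'd m (u, chart_inv u) (h, 0)) (p u) =
  right_trivialization X P (cinv c u).
Proof.
have ninv : \forall a \near (1%g : G), cdom c (group_inv a).
  have := @inv_continuous 1%g (cdom c); apply.
  by rewrite /group_inv invg1; exact: near_cdom.
apply: filterS (filterI (near_range c1) (near_cinv c1 ninv)).
move=> u [/cinv_range[ca aE] cb]; set a := cinv c u in ca aE cb *.
have ab : group_mul (a, group_inv a) = 1%g by rewrite /group_mul /= mulgV.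
have cab : cdom c (group_mul (a, group_inv a)) by rewrite ab.
have [bR RE] := tangent_mulr ca cb cab.
have Sq := chart_mul_dom_mem ca cb cab.
rewrite aE in RE Sq.
have dm := smooth_diff chart_mul_smooth Sq.
have bJ : blin (fun h => 'd m (u, chart_inv u) (h, 0)).
  exact (blin_comp (blin_diff dm) (blin_inl E E)).
have bt := tangent_chart_blin Xc ca.
have AE : (fun h => 'd m (u, chart_inv u) (h, 0)) \o tangent_chart X c a =
    tangent_map X X (fun g => group_mul (g, group_inv a)) a.
  apply/funext => h; apply: (eq_trans (esym (RE h))).
  by rewrite ab (tangent_chart_id X 1%g).
apply: (eq_trans (pt_map_comp T T (P a) bt bt bJ bJ)).
exact (congr1 (fun A => pt_map T A A (P a)) AE).
Qed.

Lemma right_trivialization_diff :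
  differentiable_at X (right_trivialization X P) 1%g /\
  differential X (right_trivialization X P) 1%g = 'd p e :> (E -> T).
Proof.
have [d1 d1E] := trivialized_diff chart_mul_dom_open chart_mul_smooth chart_mul_dom_unit
  chart_mulg1 chart_mul1g range_unit chart_bivector_smooth near_chart_bivector_mul
  chart_inv_continuous chart_inv_unit.
have [d2 d2E] := near_eq_diff right_trivialization_chart d1.
exact (conj d2 (eq_trans d2E d1E)).
Qed.

End Poisson.
End LieGroupChart.

Theorem theorem1p2 (R : realType) (K : numFieldType) (hK : real_or_complex R K)
    (E : completeNormedModType K) (G : topologicalGroupCarrier)
    (X : banachManifold G E)
    (T : projTensor E E) (TT : projTensor (E * E)%type (E * E)%type)
    (P : G -> T) (hP : poisson_lie_group X TT P) :
  let Delta : G -> T := right_trivialization X P in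
  (forall a : G, skew_symmetric (Delta a)) /\
  differentiable_at X Delta 1%g /\
  lie_bialgebra (lie_algebra_bracket X) (differential X Delta 1%g).
Proof.
move=> Delta; have [hG _ _] := hP.
have [dD DE] := right_trivialization_diff hG hP.
split; first exact: (right_trivialization_skew hP).
split; first exact: dD.
(* Both structures are now those of the local group law and its bivector. *)
rewrite DE (lie_algebra_bracketE hG).
have oS := chart_mul_dom_open hG; have sm := chart_mul_smooth hG.
have See := chart_mul_dom_unit X; have mr := chart_mulg1 X; have ml := chart_mul1g X.
have mA := chart_mulA hG.
have oD := range_open X; have De := range_unit X; have sp := chart_bivector_smooth hP.
have mp := near_chart_bivector_mul hG hP.
have bp := blin_diff (smooth_diff sp De).
split.
- exact (local_bracket_lie hK oS sm See mr ml mA).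
- exact bp.1.
- exact bp.2.
- exact (dual_bracket_lie oS sm See mr ml oD De sp (skew_chart_bivector hP) mp
    (chart_jacobi hK hP)).
- exact (local_cocycle hK oS sm See mr ml oD De sp mp).
Qed.
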